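(* Let $A=T(V)/\langle R\rangle$ be a locally finite dimensional nonnegatively graded connected algebra, and let $\{J_i\}_{i\in\mathbb{N}_0}$ be the associated collection of graded vector subspaces of $T(V)$. Then $A$ is left (resp. right) multi-Koszul if and only if there is an isomorphism of graded vector spaces $\mathrm{Tor}_i^A(k,k)\simeq J_i$ for all $i\in\mathbb{N}_0$.
   Context: Setting. $k$ is a field. $A=\bigoplus_{n\ge 0}A_n$ is a locally finite dimensional nonnegatively graded connected algebra ($A_0=k$, $\dim A_n<\infty$), written $A=T(V)/\langle R\rangle$, where $V\simeq A_{>0}/(A_{>0}\cdot A_{>0})$ is a positively graded vector space with finite dimensional components, $T(V)$ is its tensor algebra with the grading induced from $V$, and $R\subseteq \bigoplus_{n\ge2}V^{\otimes n}$ is a space of relations: a graded subspace with $R\cap(T(V)_{>0}\otimes R\otimes T(V)+T(V)\otimes R\otimes T(V)_{>0})=0$, $T(V)_{>0}=\bigoplus_{n\ge1}V^{\otimes n}$. $\pi:T(V)\to A$ is the projection. $V^{(n)}=V^{\otimes n}$, $V^{(0)}=k$. For subspaces $W_1,\dots,W_m$ of $T(V)$, $W_1\otimes\dots\otimes W_m$ denotes the subspace of $T(V)$ spanned by products $w_1\cdots w_m$; $R^{(i)}=R\otimes\dots\otimes R$ ($i$ factors), $R^{(0)}=k$. The spaces $J_i\subseteq T(V)$. $J_0=k$, $J_2=R$, $J_{2i+1}=(V\otimes J_{2i})\cap(J_{2i}\otimes V)$ for $i\ge0$ (so $J_1=V$), and for $i\ge1$ $$J_{2(i+1)}=\Big(\sum_{N\ge1}\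 \bigcap_{\bar n,\bar m}V^{(m_1)}\otimes J_{2n_1}\otimes\dots\otimes V^{(m_i)}\otimes J_{2n_i}\otimes V^{(m_{i+1})}\Big)\cap R^{(i+1)},$$ where $\bar n=(n_1,\dots,n_i)$ runs over $i$-tuples of nonnegative integers with sum $i$ and $\bar m=(m_1,\dots,m_{i+1})$ over $(i+1)$-tuples of nonnegative integers with sum $N$. They are graded for the grading induced from $V$. Multi-Koszul algebras. $K_{L-R}(A)_i=A\otimes J_i\otimes A$, with $A$-bimodule maps $\delta_i^b:K_{L-R}(A)_i\to K_{L-R}(A)_{i-1}$: if $i=2j+1$ and $\omega=\sum\bar\omega_{(1)}\omega_{(2)}=\sum\omega'_{(1)}\bar\omega'_{(2)}\in J_{2j+1}$ with $\bar\omega_{(1)},\bar\omega'_{(2)}\in V$, $\omega_{(2)},\omega'_{(1)}\in J_{2j}$, then $\delta_i^b(1\otimes\omega\otimes1)=\sum\bar\omega_{(1)}\otimes\omega_{(2)}\otimes1-\sum1\otimes\omega'_{(1)}\otimes\bar\omega'_{(2)}$; if $i=2j\ge2$, then $J_{2j}\subseteq\bigoplus_{N\ge0}\bigcap_{l=0}^N V^{(l)}\otimes J_{2j-1}\otimes V^{(N-l)}$, and writing $\omega=\sum_N\omega^N$ accordingly and $\omega^N=\sum\omega^{N,l}_{(1)}\omega^{N,l}_{(2)}\omega^{N,l}_{(3)}\in V^{(l)}\otimes J_{2j-1}\otimes V^{(N-l)}$ for each $0\le l\le N$, $\delta_i^b(1\otimes\omega\otimes1)=\sum_N\sum_{l=0}^N\sum\pi(\omega^{N,l}_{(1)})\otimes\omega^{N,l}_{(2)}\otimes\pi(\omega^{N,l}_{(3)})$.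 The left (resp. right) multi-Koszul complex is $K_{L-R}(A)_\bullet\otimes_A k$ (resp. $k\otimes_A K_{L-R}(A)_\bullet$), augmented to $k$ by the augmentation of $A$. $A$ is left (resp. right) multi-Koszul if the augmented left (resp. right) multi-Koszul complex is a resolution of the trivial left (resp. right) $A$-module $k$. *)

(* Defs.v *)
From HB Require Import structures.
From mathcomp Require Import all_boot all_algebra.
From mathcomp Require Import finmap.
From mathcomp Require Import boolp classical_sets.
From mathcomp.multinomials Require Import monalg.

Set Implicit Arguments.
Unset Strict Implicit.
Unset Printing Implicit Defensive.

Import GRing.Theory.

Local Open Scope ring_scope.

Record subspace (k : fieldType) (V : lmodType k) := Subspace {
  sp_set :> V -> Prop;
  sp_closed : sp_set 0 /\
    (forall (a : k) (u v : V), sp_set u -> sp_set v -> sp_set (a *: u + v)) }.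

Section Subspaces.
Variables (k : fieldType) (V : lmodType k).
Implicit Types (S U : subspace V) (X : set V).

Lemma sp0 S : S 0. Proof. exact: (sp_closed S).1. Qed.

Lemma spP S a u v : S u -> S v -> S (a *: u + v).
Proof. exact: (sp_closed S).2. Qed.

Lemma spD S u v : S u -> S v -> S (u + v).
Proof. by move=> Su Sv; rewrite -[u]scale1r; apply: spP. Qed.

Lemma spZ S a u : S u -> S (a *: u).
Proof. by move=> Su; rewrite -[_ *: _]addr0; apply: spP => //; apply: sp0. Qed.

Lemma spN S u : S u -> S (- u).
Proof. by rewrite -scaleN1r; apply: spZ. Qed.

Lemma sp_sum S (I : Type) (r : seq I) (P : pred I) (F : I -> V) :
  (forall i, P i -> S (F i)) -> S (\sum_(i <- r | P i) F i).
Proof. by move=> SF; apply: big_ind => //; [exact: sp0|exact: spD]. Qed.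

Definition span_set X : set V := fun x =>
  exists2 s : seq (k * V), {in s, forall p, X p.2} & x = \sum_(p <- s) p.1 *: p.2.

Lemma span_closed X : span_set X 0 /\
  (forall a u v, span_set X u -> span_set X v -> span_set X (a *: u + v)).
Proof.
split; first by exists [::] => //; rewrite big_nil.
move=> a _ _ [s Xs ->] [t Xt ->].
exists ([seq (a * p.1, p.2) | p <- s] ++ t).
  move=> p; rewrite mem_cat => /orP[/mapP[q qs ->] /=|/Xt//].
  exact: Xs.
rewrite big_cat big_map scaler_sumr; congr (_ + _).
by apply: eq_bigr => p _; rewrite scalerA.
Qed.

Definition span X : subspace V := Subspace (span_closed X).

Lemma span_sub X x : X x -> span X x.
Proof.
move=> Xx; exists [:: (1, x)]; last by rewrite big_seq1 scale1r.
by move=> p; rewrite inE => /eqP->.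
Qed.

Lemma span_min X S : (forall x, X x -> S x) -> forall x, span X x -> S x.
Proof.
move=> XS _ [s Xs ->]; rewrite big_seq; apply: sp_sum => p ps.
by apply: spZ; apply: XS; apply: Xs.
Qed.

Lemma full_closed : setT (0 : V) /\
  (forall (a : k) (u v : V), setT u -> setT v -> setT (a *: u + v)).
Proof. by []. Qed.

Definition fullsp : subspace V := Subspace full_closed.

Lemma bigcap_closed (I : Type) (P : set I) (F : I -> subspace V) :
  (\bigcap_(i in P) sp_set (F i))%classic 0 /\
  (forall a u v, (\bigcap_(i in P) sp_set (F i))%classic u ->
     (\bigcap_(i in P) sp_set (F i))%classic v ->
     (\bigcap_(i in P) sp_set (F i))%classic (a *: u + v)).
Proof.
split=> [i _|a u v Fu Fv i Pi]; first exact: sp0.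
by apply: spP; [apply: Fu|apply: Fv].
Qed.

Definition capsp_fam (I : Type) (P : set I) (F : I -> subspace V) : subspace V :=
  Subspace (bigcap_closed P F).

Definition sumsp_fam (I : Type) (P : set I) (F : I -> subspace V) : subspace V :=
  span (\bigcup_(i in P) sp_set (F i))%classic.

Definition capsp S U : subspace V :=
  capsp_fam setT (fun b : bool => if b then S else U).

Definition sumsp S U : subspace V :=
  sumsp_fam setT (fun b : bool => if b then S else U).

Lemma capspE S U x : capsp S U x <-> S x /\ U x.
Proof.
split=> [SUx|[Sx Ux] [] _ //]; split.
- exact: (SUx true I).
- exact: (SUx false I).
Qed.

Lemma subspace_eq S U : (forall x, S x <-> U x) -> S = U.
Proof.
case: S U => [S Sc] [U Uc] /= SU.
have eSU : S = U by apply/funext => x; apply/propext/SU.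
by case: U / eSU Uc {SU} => Uc; rewrite (Prop_irrelevance Sc Uc).
Qed.

Definition is_grading (G : nat -> subspace V) : Prop :=
  (forall x, exists (n : nat) (f : nat -> V),
     (forall i, G i (f i)) /\ x = \sum_(i < n) f i) /\
  (forall (n : nat) (f : nat -> V), (forall i, G i (f i)) ->
     \sum_(i < n) f i = 0 -> forall i, (i < n)%N -> f i = 0).

Definition graded_sub (G : nat -> subspace V) S : Prop :=
  forall x, S x -> sumsp_fam setT (fun n => capsp S (G n)) x.

Definition sp_pred S : pred V := fun x => `[< S x >].

Lemma sp_predP S x : reflect (S x) (x \in sp_pred S).
Proof. exact: asboolP. Qed.

Fact sp_pred_closed S : submod_closed (sp_pred S).
Proof.
split; first by apply/sp_predP; apply: sp0.
by move=> a u v /sp_predP Su /sp_predP Sv; apply/sp_predP; apply: spP.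
Qed.

HB.instance Definition _ S :=
  GRing.isSubmodClosed.Build k V (sp_pred S) (sp_pred_closed S).

Record subsp S := Subsp { subsp_val : V; _ : subsp_val \in sp_pred S }.

HB.instance Definition _ S := [isSub for @subsp_val S].
HB.instance Definition _ S := [Choice of subsp S by <:].
HB.instance Definition _ S := [SubChoice_isSubLmodule of subsp S by <:].

Lemma subspP S (x : subsp S) : S (val x).
Proof. by apply/sp_predP; apply: valP. Qed.

Definition mksub S x (Sx : S x) : subsp S := Sub x (introT (sp_predP S x) Sx).

Definition quotsp S := Quotient.quot (GRing.ZmodClosed.clone V (sp_pred S) _).

HB.instance Definition _ S := GRing.Zmodule.on (quotsp S).

Definition class S (x : V) : quotsp S := \pi_(quotsp S)%qT x.

Lemma class_eq S x y : class S x = class S y <-> S (x - y).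
Proof.
rewrite /class; split.
  by move=> /eqP; rewrite -Quotient.idealrBE => /sp_predP.
by move=> Sxy; apply/eqP; rewrite -Quotient.idealrBE; apply/sp_predP.
Qed.

Lemma class_repr S (q : quotsp S) : class S (repr q) = q.
Proof. exact: reprK. Qed.

Lemma classD S : {morph class S : x y / x + y}.
Proof. by move=> x y; rewrite /class !piE. Qed.

Definition quot_scale S (a : k) (q : quotsp S) := class S (a *: repr q).

Lemma class_scale S a x : quot_scale a (class S x) = class S (a *: x).
Proof.
apply/class_eq; rewrite -scalerBr; apply: spZ.
by apply/class_eq; rewrite class_repr.
Qed.

Fact quot_scaleA S a b (q : quotsp S) :
  quot_scale a (quot_scale b q) = quot_scale (a * b) q.
Proof. by rewrite -[q]class_repr !class_scale scalerA. Qed.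

Fact quot_scale1 S : left_id 1 (@quot_scale S).
Proof. by move=> q; rewrite -[q]class_repr class_scale scale1r. Qed.

Fact quot_scaleDr S : right_distributive (@quot_scale S) +%R.
Proof.
move=> a p q; rewrite -[p]class_repr -[q]class_repr.
by rewrite -classD !class_scale -classD scalerDr.
Qed.

Fact quot_scaleDl S (q : quotsp S) : {morph (@quot_scale S)^~ q : a b / a + b}.
Proof.
by move=> a b; rewrite -[q]class_repr !class_scale -classD scalerDl.
Qed.

HB.instance Definition _ S := GRing.Zmodule_isLmodule.Build k (quotsp S)
  (@quot_scaleA S) (@quot_scale1 S) (@quot_scaleDr S) (@quot_scaleDl S).

Fact class_linear S : linear (class S).
Proof. by move=> a x y; rewrite classD -class_scale. Qed.

HB.instance Definition _ S :=
  GRing.isLinear.Build k V (quotsp S) *:%R (class S) (class_linear S).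

End Subspaces.

Section LinearMaps.
Variables (k : fieldType) (V W : lmodType k).

Section Kernel.
Variable f : {linear V -> W}.

Lemma kersp_closed : f 0 = 0 /\
  (forall a u v, f u = 0 -> f v = 0 -> f (a *: u + v) = 0).
Proof.
split; first exact: raddf0.
by move=> a u v fu fv; rewrite linearP fu fv scaler0 addr0.
Qed.

Definition kersp : subspace V :=
  @Subspace k V (fun x => f x = 0) kersp_closed.

Lemma imsp_closed : (exists x, 0 = f x) /\
  (forall a u v, (exists x, u = f x) -> (exists x, v = f x) ->
     exists x, a *: u + v = f x).
Proof.
split; first by exists 0; rewrite raddf0.
by move=> a _ _ [x ->] [y ->]; exists (a *: x + y); rewrite linearP.
Qed.

Definition imsp : subspace W :=
  @Subspace k W (fun y => exists x, y = f x) imsp_closed.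

Variable S : subspace W.

Lemma presp_closed : S (f 0) /\
  (forall a u v, S (f u) -> S (f v) -> S (f (a *: u + v))).
Proof.
split; first by rewrite raddf0; apply: sp0.
by move=> a u v Su Sv; rewrite linearP; apply: spP.
Qed.

Definition presp : subspace V :=
  @Subspace k V (fun x => S (f x)) presp_closed.

End Kernel.

(* The map V / S -> W / S' induced by f when f maps S into S'. *)
Section QuotientMap.
Variables (S : subspace V) (S' : subspace W) (f : {linear V -> W}).
Hypothesis fS : forall x, S x -> S' (f x).

Definition quotmap of (forall x, S x -> S' (f x)) : quotsp S -> quotsp S' :=
  fun q => class S' (f (repr q)).

Lemma quotmap_class x : quotmap fS (class S x) = class S' (f x).
Proof.
apply/class_eq; rewrite -raddfB; apply: fS.
by apply/class_eq; rewrite class_repr.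
Qed.

Fact quotmap_linear : linear (quotmap fS).
Proof.
move=> a p q; rewrite -[p]class_repr -[q]class_repr -linearP.
by rewrite !quotmap_class !linearP.
Qed.

End QuotientMap.
End LinearMaps.

HB.instance Definition _ (k : fieldType) (V W : lmodType k) (S : subspace V)
    (S' : subspace W) (f : {linear V -> W}) (fS : forall x, S x -> S' (f x)) :=
  GRing.isLinear.Build k (quotsp S) (quotsp S') *:%R (quotmap fS)
    (quotmap_linear fS).

(* The tensor product over k is the free vector space on U * W modulo the
   bilinearity relations. *)

Section Tensor.
Variables (k : fieldType) (U W : lmodType k).

Definition bilinear_rel : set {malg k[(U * W)%type]} := fun z =>
  (exists a u u' w,
     z = << (a *: u + u', w) >> - a *: << (u, w) >> - << (u', w) >>) \/
  (exists a u w w',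
     z = << (u, a *: w + w') >> - a *: << (u, w) >> - << (u, w') >>).

Definition tens := quotsp (span bilinear_rel).

HB.instance Definition _ := GRing.Lmodule.on tens.

Definition tpair (u : U) (w : W) : tens := class (span bilinear_rel) << (u, w) >>.

Lemma tpairPl a u u' w : tpair (a *: u + u') w = a *: tpair u w + tpair u' w.
Proof.
rewrite /tpair -linearP; apply/class_eq; apply: span_sub; left.
by exists a, u, u', w; rewrite opprD addrA.
Qed.

Lemma tpairPr a u w w' : tpair u (a *: w + w') = a *: tpair u w + tpair u w'.
Proof.
rewrite /tpair -linearP; apply/class_eq; apply: span_sub; right.
by exists a, u, w, w'; rewrite opprD addrA.
Qed.

Section Lift.
Variables (Z : lmodType k) (b : U -> W -> Z).

Definition malg_lift (g : {malg k[(U * W)%type]}) : Z :=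
  \sum_(p <- msupp g) g@_p *: b p.1 p.2.

Lemma malg_liftEw (d : {fset (U * W)%type}) g : (msupp g `<=` d)%fset ->
  malg_lift g = \sum_(p <- d) g@_p *: b p.1 p.2.
Proof.
move=> gd; rewrite /malg_lift (big_fset_incl _ gd) // => p _ /mcoeff_outdom->.
by rewrite scale0r.
Qed.

Fact malg_lift_linear : linear malg_lift.
Proof.
move=> a g h; pose d := (msupp g `|` msupp h `|` msupp (a *: g + h))%fset.
rewrite !(@malg_liftEw d) /d ?fsubsetUr //; last first.
- by rewrite -fsetUA fsubsetUl.
- by rewrite fsetUC fsetUA fsubsetUr.
rewrite scaler_sumr -big_split; apply: eq_bigr => p _ /=.
by rewrite mcoeffD mcoeffZ scalerDl scalerA.
Qed.

HB.instance Definition _ :=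
  GRing.isLinear.Build k {malg k[(U * W)%type]} Z *:%R malg_lift malg_lift_linear.

Lemma malg_liftU p : malg_lift << p >> = b p.1 p.2.
Proof. by rewrite /malg_lift msuppU oner_eq0 big_seq_fset1 mcoeffUU scale1r. Qed.

Lemma malg_liftB : {morph malg_lift : g h / g - h}. Proof. exact: linearB. Qed.

Lemma malg_liftZ a : {morph malg_lift : g / a *: g}. Proof. exact: linearZ. Qed.

Definition tlift (t : tens) : Z := malg_lift (repr t).

Hypothesis bl : forall a u u' w, b (a *: u + u') w = a *: b u w + b u' w.
Hypothesis br : forall a u w w', b u (a *: w + w') = a *: b u w + b u w'.

Lemma tlift_class g : tlift (class _ g) = malg_lift g.
Proof.
apply/eqP; rewrite -subr_eq0 -raddfB; apply/eqP.
have /class_eq : class (span bilinear_rel) (repr (class (span bilinear_rel) g))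
  = class _ g by rewrite class_repr.
move: (_ - g); apply: (@span_min _ _ _ (kersp malg_lift)) => z.
case=> [[a [u [u' [w ->]]]]|[a [u [w [w' ->]]]]] /=.
- by rewrite !malg_liftB malg_liftZ !malg_liftU /= bl addrAC addrK subrr.
- by rewrite !malg_liftB malg_liftZ !malg_liftU /= br addrAC addrK subrr.
Qed.

Lemma tlift_pair u w : tlift (tpair u w) = b u w.
Proof. by rewrite tlift_class malg_liftU. Qed.

Lemma tlift_linear : linear tlift.
Proof.
move=> a p q; rewrite -[p]class_repr -[q]class_repr -linearP.
by rewrite !tlift_class linearP.
Qed.

End Lift.
End Tensor.

Section TensorMap.
Variables (k : fieldType) (U W U' W' : lmodType k).
Variables (f : {linear U -> U'}) (g : {linear W -> W'}).

Definition tmap : tens U W -> tens U' W' :=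
  tlift (fun u w => tpair (f u) (g w)).

Let fgl a u u' w :
  tpair (f (a *: u + u')) (g w) = a *: tpair (f u) (g w) + tpair (f u') (g w).
Proof. by rewrite linearP tpairPl. Qed.

Let fgr a u w w' :
  tpair (f u) (g (a *: w + w')) = a *: tpair (f u) (g w) + tpair (f u) (g w').
Proof. by rewrite linearP tpairPr. Qed.

Lemma tmap_pair u w : tmap (tpair u w) = tpair (f u) (g w).
Proof. exact: tlift_pair. Qed.

Fact tmap_linear : linear tmap.
Proof. exact: tlift_linear. Qed.

HB.instance Definition _ :=
  GRing.isLinear.Build k (tens U W) (tens U' W') *:%R tmap tmap_linear.

End TensorMap.

(* M (x)_A N for a right action r of A on M and a left action l of A on N. *)

Section BalancedTensor.
Variables (k : fieldType) (A : Type).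

Definition balanced_rel (M N : lmodType k) (r : M -> A -> M) (l : A -> N -> N) :
    set (tens M N) :=
  fun z => exists m a n, z = tpair (r m a) n - tpair m (l a n).

Definition tensA (M N : lmodType k) (r : M -> A -> M) (l : A -> N -> N) :=
  quotsp (span (balanced_rel r l)).

HB.instance Definition _ M N r l := GRing.Lmodule.on (@tensA M N r l).

Definition tApair (M N : lmodType k) (r : M -> A -> M) (l : A -> N -> N)
    (m : M) (n : N) : tensA r l :=
  class (span (balanced_rel r l)) (tpair m n).

Section Map.
Variables (M N M' N' : lmodType k).
Variables (r : M -> A -> M) (l : A -> N -> N).
Variables (r' : M' -> A -> M') (l' : A -> N' -> N').
Variables (f : {linear M -> M'}) (g : {linear N -> N'}).
Hypothesis fr : forall m a, f (r m a) = r' (f m) a.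
Hypothesis gl : forall a n, g (l a n) = l' a (g n).

Lemma tmap_balanced z : span (balanced_rel r l) z ->
  span (balanced_rel r' l') (tmap f g z).
Proof.
pose S := presp (tmap f g) (span (balanced_rel r' l')).
move: z; apply: (@span_min _ _ _ S) => _ [m [a [n ->]]].
apply: span_sub; exists (f m), a, (g n).
by rewrite raddfB /= !tmap_pair fr gl.
Qed.

Definition tAmap : {linear tensA r l -> tensA r' l'} := quotmap tmap_balanced.

Lemma tAmap_pair m n : tAmap (tApair r l m n) = tApair r' l' (f m) (g n).
Proof. by rewrite /tApair -tmap_pair; apply: quotmap_class. Qed.

End Map.
End BalancedTensor.

(* Nonnegatively indexed chain complexes of vector spaces and their homology;
   cplx_d i goes from degree i.+1 to degree i. *)

Record complex (k : fieldType) := Complex {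
  cplx :> nat -> lmodType k;
  cplx_d : forall i, {linear cplx i.+1 -> cplx i} }.

Section Homology.
Variables (k : fieldType) (C : complex k).

Definition cycles (i : nat) : subspace (C i) :=
  match i with
  | 0 => fullsp (C 0)
  | j.+1 => kersp (cplx_d C j)
  end.

Definition boundaries (i : nat) : subspace (subsp (cycles i)) :=
  presp (val : {linear subsp (cycles i) -> C i}) (imsp (cplx_d C i)).

Definition homology (i : nat) := quotsp (boundaries i).

HB.instance Definition _ i := GRing.Lmodule.on (homology i).

(* ... -> C 1 -> C 0 -> k -> 0 is exact *)
Definition resolves (e : C 0 -> k) : Prop :=
  [/\ forall c, exists x, e x = c,
      forall x, e x = 0 <-> exists y, x = cplx_d C 0 y &
      forall i x, cplx_d C i x = 0 <-> exists y, x = cplx_d C i.+1 y ].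

End Homology.

Section ProductSpaces.
Variables (k : fieldType) (T : lalgType k).
Implicit Types U W : subspace T.

Definition onesp : subspace T := span [set 1]%classic.

Definition mulsp U W : subspace T :=
  span (fun x => exists u w, [/\ U u, W w & x = u * w]).

Definition powsp U (n : nat) : subspace T := iter n (mulsp U) onesp.

End ProductSpaces.

(* The tensor algebra T(V) of the graded vector space V with homogeneous basis
   X, where x has degree deg x, is the free algebra on X: its basis consists of
   the words in X, and V is spanned by the words of length one. *)

Notation tensor_alg k X := {malg k[{fmonom X}]}.

Section TensorAlgebra.
Variables (k : fieldType) (X : choiceType) (deg : X -> nat).
Notation T := (tensor_alg k X).

Definition Vsp : subspace T := span (fun t => exists x : X, t = << fmu x >>).

Definition weight (w : {fmonom X}) : nat := (\sum_(x <- (w : seq X)) deg x)%N.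

Definition Tgr (n : nat) : subspace T :=
  span (fun t => exists2 w : {fmonom X}, weight w = n & t = << w >>).

Definition Tge (m : nat) : subspace T :=
  sumsp_fam (fun n => (m <= n)%N) (powsp Vsp).

End TensorAlgebra.

(* A = T(V)/<R> for a space of relations R.  The grading of A is the one induced
   by the grading of T(V), see Agr below; A is then connected and locally finite
   dimensional since deg is positive with finite fibres. *)

Record presentation (k : fieldType) (A : algType k) := Presentation {
  gen : choiceType;
  gdeg : gen -> nat;
  gdeg_gt0 : forall x, (0 < gdeg x)%N;
  gdeg_fin : forall n, exists s : seq gen, forall x, gdeg x = n -> x \in s;
  rels : subspace (tensor_alg k gen);
  rels_ge2 : forall x, rels x -> Tge k gen 2 x;
  rels_graded : graded_sub (Tgr k gdeg) rels;
  rels_min : forall x, rels x ->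
    sumsp (mulsp (mulsp (Tge k gen 1) rels) (fullsp _))
          (mulsp (mulsp (fullsp _) rels) (Tge k gen 1)) x -> x = 0;
  proj : {lrmorphism tensor_alg k gen -> A};
  proj_surj : forall a, exists t, proj t = a;
  proj_ker : forall t, proj t = 0 <-> mulsp (mulsp (fullsp _) rels) (fullsp _) t;
  (* the augmentation of A, determined by its vanishing on V *)
  aug : {lrmorphism A -> k^o};
  aug_V : forall v, Vsp k gen v -> aug (proj v) = 0 }.

Section MultiKoszul.
Variables (k : fieldType) (A : algType k) (E : presentation A).

Notation T := (tensor_alg k (gen E)).
Notation V := (Vsp k (gen E)).
Notation R := (rels E).

Definition Agr (n : nat) : set A := (proj E @` sp_set (Tgr k (@gdeg _ _ E) n))%classic.

(* V^(m_1) J_{2 n_1} ... V^(m_i) J_{2 n_i} V^(m_(i+1)), where Je n is J_{2 n} *)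
Fixpoint interlace (Je : nat -> subspace T) (ms ns : seq nat) : subspace T :=
  match ms, ns with
  | m :: ms', n :: ns' => mulsp (mulsp (powsp V m) (Je n)) (interlace Je ms' ns')
  | m :: _, [::] => powsp V m
  | [::], _ => onesp T
  end.

(* J_{2 (i+1)} in terms of the J_{2 n} with n <= i *)
Definition Jstep (Je : nat -> subspace T) (i : nat) : subspace T :=
  capsp
    (sumsp_fam (fun N => (1 <= N)%N) (fun N =>
       capsp_fam
         (fun nm : i.-tuple nat * i.+1.-tuple nat => sumn nm.1 = i /\ sumn nm.2 = N)
         (fun nm => interlace Je nm.2 nm.1)))
    (powsp R i.+1).

(* Jtab i n is J_{2 n} for n <= i *)
Fixpoint Jtab (i : nat) : nat -> subspace T :=
  match i with
  | 0 => fun _ => onesp T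
  | i'.+1 => fun n =>
      if (n <= i')%N then Jtab i' n
      else if i' == 0%N then R else Jstep (Jtab i') i'
  end.

Definition Jeven (n : nat) : subspace T := Jtab n n.

Definition J (i : nat) : subspace T :=
  if odd i then capsp (mulsp V (Jeven i./2)) (mulsp (Jeven i./2) V)
  else Jeven i./2.

Lemma Jtab_Jeven i n : (n <= i)%N -> Jtab i n = Jeven n.
Proof.
elim: i => [|i IHi]; first by rewrite leqn0 => /eqP->.
rewrite leq_eqVlt => /orP[/eqP-> //|]; rewrite ltnS => ni /=.
by rewrite ni IHi.
Qed.

Lemma interlace_eq Je Je' (ms ns : seq nat) :
  {in ns, forall n, Je n = Je' n} -> interlace Je ms ns = interlace Je' ms ns.
Proof.
elim: ms ns => [|m ms IHms] [|n ns] //= eqJ.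
rewrite eqJ ?mem_head // IHms // => j js; apply: eqJ.
by rewrite inE js orbT.
Qed.

Lemma Jstep_eq Je Je' i :
  (forall n, (n <= i)%N -> Je n = Je' n) -> Jstep Je i = Jstep Je' i.
Proof.
move=> eqJ; rewrite /Jstep; congr (capsp (sumsp_fam _ _) _).
apply/funext => N; apply: subspace_eq => x.
suff H (nm : i.-tuple nat * i.+1.-tuple nat) : sumn nm.1 = i ->
    interlace Je nm.2 nm.1 = interlace Je' nm.2 nm.1.
  by split=> Hx nm [s1 s2]; have := Hx nm (conj s1 s2); rewrite H.
move=> s1; apply: interlace_eq => n n1; apply: eqJ.
by rewrite -s1 sumnE (big_rem n n1) leq_addr.
Qed.

Lemma J_0 : J 0 = onesp T. Proof. by []. Qed.

Lemma J_2 : J 2 = R. Proof. by []. Qed.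

Lemma J_odd i : J i.*2.+1 = capsp (mulsp V (J i.*2)) (mulsp (J i.*2) V).
Proof. by rewrite /J /= odd_double /= uphalf_double doubleK. Qed.

Lemma J_even i : (1 <= i)%N -> J i.+1.*2 = Jstep (fun n => J n.*2) i.
Proof.
case: i => // i _; rewrite {1}/J odd_double doubleK {1}/Jeven.
have -> : Jtab i.+2 i.+2 = Jstep (Jtab i.+1) i.+1 by rewrite /= ltnn.
by apply: Jstep_eq => n ni; rewrite Jtab_Jeven // /J odd_double doubleK.
Qed.

Definition K (i : nat) := tens (tens A (subsp (J i))) A.

HB.instance Definition _ i := GRing.Lmodule.on (K i).

Definition ktens i (a : A) (w : subsp (J i)) (b : A) : K i := tpair (tpair a w) b.

Definition K_lact i (a : A) (x : K i) : K i :=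
  tlift (fun y b => tpair (tlift (fun a' w => tpair (a * a') w) y) b) x.

Definition K_ract i (x : K i) (b : A) : K i :=
  tlift (fun y b' => tpair y (b' * b)) x.

Lemma K_lactE i a a' (w : subsp (J i)) b :
  K_lact a (ktens a' w b) = ktens (a * a') w b.
Proof.
have l c u u' (w' : subsp (J i)) : tpair (a * (c *: u + u')) w'
    = c *: tpair (a * u) w' + tpair (a * u') w'.
  by rewrite mulrDr -scalerAr tpairPl.
have r c u (w' w'' : subsp (J i)) : tpair (a * u) (c *: w' + w'')
    = c *: tpair (a * u) w' + tpair (a * u) w'' by rewrite tpairPr.
rewrite /K_lact /ktens !tlift_pair // => c.
- by move=> u u' w'; rewrite tlift_linear // tpairPl.
- by move=> u w' w''; rewrite tpairPr.
Qed.

Lemma K_ractE i a (w : subsp (J i)) b b' :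
  K_ract (ktens a w b) b' = ktens a w (b * b').
Proof.
rewrite /K_ract /ktens tlift_pair // => c.
- by move=> u u' w'; rewrite tpairPl.
- by move=> u w' w''; rewrite mulrDl -scalerAl tpairPr.
Qed.

(* The differential of the bimodule complex K_{L-R}(A), with kd_map i = delta_{i+1}.
   The decompositions of w in kd_even exist because J_{2j} is contained in the sum
   over N of the intersections over l of V^(l) J_{2j-1} V^(N-l), so the conditions
   determine the differential on the bimodule generators 1 (x) w (x) 1. *)
Record k_differential := KDifferential {
  kd_map : forall i, {linear K i.+1 -> K i};
  kd_lact : forall i a x, kd_map i (K_lact a x) = K_lact a (kd_map i x);
  kd_ract : forall i x b, kd_map i (K_ract x b) = K_ract (kd_map i x) b;
  kd_odd : forall i, ~~ odd i ->
    forall (w : subsp (J i.+1)) (s : seq (T * subsp (J i)))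
           (s' : seq (subsp (J i) * T)),
    {in s, forall p, V p.1} -> {in s', forall p, V p.2} ->
    val w = \sum_(p <- s) p.1 * val p.2 ->
    val w = \sum_(p <- s') val p.1 * p.2 ->
    kd_map i (ktens 1 w 1) = \sum_(p <- s) ktens (proj E p.1) p.2 1
                             - \sum_(p <- s') ktens 1 p.1 (proj E p.2);
  kd_even : forall i, odd i ->
    forall (w : subsp (J i.+1)) (M : nat) (wN : nat -> T)
           (s : nat -> nat -> seq (T * subsp (J i) * T)),
    val w = \sum_(N < M) wN N ->
    (forall N l, (N < M)%N -> (l <= N)%N ->
       {in s N l, forall p, powsp V l p.1.1 /\ powsp V (N - l) p.2} /\
       wN N = \sum_(p <- s N l) p.1.1 * val p.1.2 * p.2) ->
    kd_map i (ktens 1 w 1) =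
      \sum_(N < M) \sum_(l < N.+1) \sum_(p <- s N l)
        ktens (proj E p.1.1) p.1.2 (proj E p.2) }.

Definition triv_l (a : A) (c : k^o) : k^o := aug E a * c.
Definition triv_r (c : k^o) (a : A) : k^o := c * aug E a.

Definition triv (E : presentation A) : Type := k.
HB.instance Definition _ := GRing.Zmodule.on (triv E).

Fact triv_scaleA a b (c : triv E) : triv_l a (triv_l b c) = triv_l (a * b) c.
Proof. by rewrite /triv_l rmorphM mulrA. Qed.
Fact triv_scale1 : left_id 1 (triv_l : A -> triv E -> triv E).
Proof. by move=> c; rewrite /triv_l rmorph1 mul1r. Qed.
Fact triv_scaleDr : right_distributive (triv_l : A -> triv E -> triv E) +%R.
Proof. by move=> a b c; rewrite /triv_l mulrDr. Qed.
Fact triv_scaleDl (c : triv E) :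
  {morph (triv_l : A -> triv E -> triv E)^~ c : a b / a + b}.
Proof. by move=> a b; rewrite /triv_l rmorphD mulrDl. Qed.

HB.instance Definition _ := GRing.Zmodule_isLmodule.Build A (triv E)
  triv_scaleA triv_scale1 triv_scaleDr triv_scaleDl.

(* J_0 = k, so K_0 = A (x) k (x) A; this is a (x) w (x) b |-> aug a * w * aug b. *)
Definition K_aug (x : K 0) : k :=
  tlift (fun y b => tlift (fun a w => aug E a * aug E (proj E (val w))) y
                    * aug E b : k^o) x.

Lemma K_augE a (w : subsp (J 0)) b :
  K_aug (ktens a w b) = aug E a * aug E (proj E (val w)) * aug E b.
Proof.
have l c u u' (w' : subsp (J 0)) : aug E (c *: u + u') * aug E (proj E (val w'))
    = c *: (aug E u * aug E (proj E (val w')) : k^o)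
      + aug E u' * aug E (proj E (val w')).
  by rewrite linearP /= mulrDl -scalerAl.
have r c u (w' w'' : subsp (J 0)) : aug E u * aug E (proj E (val (c *: w' + w'')))
    = c *: (aug E u * aug E (proj E (val w')) : k^o)
      + aug E u * aug E (proj E (val w'')).
  by rewrite !linearP /= mulrDr -scalerAr.
rewrite /K_aug /ktens !tlift_pair // => c.
- by move=> u u' b'; rewrite tlift_linear // mulrDl -scalerAl.
- by move=> u b' b''; rewrite linearP /= mulrDr -scalerAr.
Qed.

Section Complexes.
Variable D : k_differential.

Definition left_complex : complex k :=
  @Complex k (fun i => tensA (@K_ract i) triv_l)
    (fun i => tAmap (f := kd_map D i) (g := idfun : {linear k^o -> k^o})
                (@kd_ract D i) (fun _ _ => erefl)).

Definition left_aug (x : left_complex 0) : k :=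
  tlift (fun (y : K 0) (c : k^o) => K_aug y * c : k^o) (repr x).

Definition right_complex : complex k :=
  @Complex k (fun i => tensA triv_r (@K_lact i))
    (fun i => tAmap (f := idfun : {linear k^o -> k^o}) (g := kd_map D i)
                (fun _ _ => erefl) (@kd_lact D i)).

Definition right_aug (x : right_complex 0) : k :=
  tlift (fun (c : k^o) (y : K 0) => c * K_aug y : k^o) (repr x).

End Complexes.

Definition left_multi_Koszul : Prop :=
  exists D : k_differential, resolves (@left_aug D).

Definition right_multi_Koszul : Prop :=
  exists D : k_differential, resolves (@right_aug D).

End MultiKoszul.

Section Restriction.
Variables (k : fieldType) (A : algType k).

Definition restr (M : lmodType A) : Type := M.
HB.instance Definition _ M := GRing.Zmodule.on (restr M).

Definition restr_scale (M : lmodType A) (c : k) (x : restr M) : restr M :=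
  (c%:A : A) *: (x : M).

Fact restr_scaleA M a b (x : restr M) :
  restr_scale a (restr_scale b x) = restr_scale (a * b) x.
Proof. by rewrite /restr_scale scalerA -scalerAl mul1r scalerA. Qed.
Fact restr_scale1 M : left_id 1 (@restr_scale M).
Proof. by move=> x; rewrite /restr_scale !scale1r. Qed.
Fact restr_scaleDr M : right_distributive (@restr_scale M) +%R.
Proof. by move=> c x y; rewrite /restr_scale scalerDr. Qed.
Fact restr_scaleDl M (x : restr M) : {morph (@restr_scale M)^~ x : a b / a + b}.
Proof. by move=> a b; rewrite /restr_scale !scalerDl. Qed.

HB.instance Definition _ M := GRing.Zmodule_isLmodule.Build k (restr M)
  (@restr_scaleA M) (@restr_scale1 M) (@restr_scaleDr M) (@restr_scaleDl M).

Definition restr_map (M N : lmodType A) (f : {linear M -> N}) :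
  restr M -> restr N := f.

Fact restr_map_linear (M N : lmodType A) (f : {linear M -> N}) : linear (restr_map f).
Proof. by move=> a x y; apply: linearP. Qed.

HB.instance Definition _ (M N : lmodType A) (f : {linear M -> N}) :=
  GRing.isLinear.Build k (restr M) (restr N) *:%R (@restr_map M N f)
    (@restr_map_linear M N f).

Definition restr_lact (M : lmodType A) (a : A) (x : restr M) : restr M :=
  a *: (x : M).

Fact restr_map_lact (M N : lmodType A) (f : {linear M -> N}) a x :
  restr_map f (restr_lact a x) = restr_lact a (restr_map f x).
Proof. exact: linearZ. Qed.

Definition projective (P : lmodType A) : Prop :=
  forall (M N : lmodType A) (g : {linear M -> N}) (f : {linear P -> N}),
    (forall y, exists x, g x = y) ->
    exists h : {linear P -> M}, forall x, g (h x) = f x.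

End Restriction.

(* Graded projective resolutions ... -> P_1 -> P_0 -> k -> 0 of the trivial left
   A-module, with k in degree 0 *)
Record graded_resolution (k : fieldType) (A : algType k) (E : presentation A) :=
  GradedResolution {
    res : nat -> lmodType A;
    res_gr : forall i, nat -> subspace (restr (res i));
    res_d : forall i, {linear res i.+1 -> res i};
    res_aug : {linear res 0 -> triv E};
    res_proj : forall i, projective (res i);
    res_grading : forall i, is_grading (res_gr i);
    res_gr_act : forall i m n a x, Agr E m a -> res_gr i n x ->
      res_gr i (m + n)%N (a *: (x : res i));
    res_d_gr : forall i n x, res_gr i.+1 n x -> res_gr i n (res_d i x);
    res_aug_gr : forall n x, (0 < n)%N -> res_gr 0 n x -> res_aug x = 0;
    res_aug_surj : forall c, exists x, res_aug x = c;
    res_exact0 : forall x, res_aug x = 0 <-> exists y, x = res_d 0 y;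
    res_exact : forall i x, res_d i x = 0 <-> exists y, x = res_d i.+1 y }.

(* Tor^A(k,k), computed from a resolution P of the left module k *)

Section Tor.
Variables (k : fieldType) (A : algType k) (E : presentation A).
Variable P : graded_resolution E.

Definition tor_complex : complex k :=
  @Complex k (fun i => tensA (triv_r E) (@restr_lact _ _ (res P i)))
    (fun i => tAmap (f := idfun : {linear k^o -> k^o}) (g := restr_map (res_d P i))
                (fun _ _ => erefl) (restr_map_lact (res_d P i))).

Definition Tor (i : nat) := homology tor_complex i.

HB.instance Definition _ i := GRing.Lmodule.on (Tor i).

Definition tor_complex_gr (i n : nat) : subspace (tor_complex i) :=
  span (fun z => exists (c : k^o) (x : restr (res P i)),
          res_gr P i n x /\ z = tApair (triv_r E) (@restr_lact _ _ _) c x).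

Definition Tor_gr (i n : nat) : set (Tor i) := fun h =>
  exists2 z : subsp (cycles tor_complex i),
    tor_complex_gr i n (val z) & h = class (boundaries tor_complex i) z.

Definition Tor_iso_J (i : nat) : Prop :=
  exists f : {linear Tor i -> subsp (J E i)}, bijective f /\
    forall n h, Tor_gr n h <-> Tgr k (@gdeg _ _ E) n (val (f h)).

End Tor.

(* Main.v *)
(* Write A = T/I with T = T(V), and let L be the augmented left complex with
   L_i = A (x) J_i.

   The left complex, the bimodule complex and the right complex are exact at the
   same time: tensoring the augmented bimodule complex, which splits one-sidedly
   when it is exact, over A with k gives the two one-sided complexes, and
   conversely exactness lifts along the filtration by the weight of the outer
   factor A.

   For the comparison with Tor, J_{i+2} is contained in R J_i, every J_i is free
   as a left generating space (t (x) c |-> tc is injective on T (x) J_i), and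
   R meets T_+ R T + T R T_+ trivially.  This makes L minimal in the strong sense
   that d(1 (x) w) in A_+ ker d forces w = 0.  Lift the identity of k to a graded
   map phi from L to a projective resolution P; w |-> [1 (x) phi(1 (x) w)] is a
   linear map g_i from J_i to Tor_i.  If L is exact below degree i, a homotopy
   inverse of phi exists up to degree i, and minimality makes g_i injective.  If
   L is exact, then g_i is also surjective.  If J_i and Tor_i are isomorphic as
   graded spaces, then g_i is surjective because the weight spaces of J_i are
   finite dimensional; then ker d = im d + A_+ ker d in degree i, and L is exact
   there by the graded Nakayama lemma. *)

From HB Require Import structures.
From mathcomp Require Import all_boot all_algebra.
From mathcomp Require Import finmap.
From mathcomp Require Import boolp classical_sets.
From mathcomp.multinomials Require Import monalg.
Require Import Defs.

Set Implicit Arguments.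
Unset Strict Implicit.
Unset Printing Implicit Defensive.

Import GRing.Theory.

Local Open Scope ring_scope.

(** * Linear maps and tensor products *)

(** The relations may mix word lengths, so [R] and the [J_i] are graded by weight but not by length.
    Two decompositions of [T] run side by side: length cuts words into outer letters and a middle
    part, weight serves finite dimensionality, the filtration argument and Nakayama. As the length
    components of an element of [J_i] need not lie in [J_i], length is measured in front of a chosen
    factor: if [T (x) U -> T] is injective, the length of the first tensor factor is well defined on
    [T U]. The same injectivity reduces intersections such as that of [U B] and [U' B] to their
    first factors, by applying a projection to one factor only. This is how [J_{i+2}] is placed in
    [R J_i]; with the mirror image it gives [d d = 0], since the double differential telescopes to
    two end terms that vanish once the length pieces are summed. The homotopy inverse of [phi] is
    available only as far as [L] is known to be exact, which makes the passage from Tor to exactness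
    an induction on the degree. *)

Lemma malgZU (k : fieldType) (K : choiceType) (a b : k) (w : K) :
  a *: << b *g w >> = << a * b *g w >>.
Proof. by apply/malgP => p; rewrite mcoeffZ !mcoeffU; case: eqP; rewrite ?mulr0. Qed.

Section Extension.
Variables (k : fieldType) (V W : lmodType k).

Lemma linear_pack (f : V -> W) : linear f -> exists g : {linear V -> W}, g =1 f.
Proof.
move=> lf; pose m := GRing.isLinear.Build k V W *:%R f lf.
by exists (HB.pack_for {linear V -> W} f m).
Qed.

Definition closedP (G : set (V * W)) : Prop := G 0 /\
  forall a u v, G u -> G v -> G (a *: u + v).

(** Subspaces come without bases, so every splitting used below (left inverses, retractions,
    sections, separating projections) rests on this use of Zorn's lemma: a single-valued linear
    graph is enlarged to a total one. *)
Lemma functional_extend (G : subspace (V * W)%type) :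
  (forall w, G (0, w) -> w = 0) ->
  exists f : {linear V -> W}, forall v w, G (v, w) -> f v = w.
Proof.
move=> Gf.
(* The graph [G] is adjoined inside the predicate so that the empty chain satisfies it too. *)
pose P (S : set (V * W)) := closedP (S `|` G)%classic /\
  forall w, (S `|` G)%classic (0, w) -> w = 0.
have [F FP Ft|M [[[M0 Mc] Mf] maxM]] := @Zorn_bigcup _ P.
  have [->|/set0P[X0 FX0]] := eqVneq F set0.
    rewrite bigcup_set0; split; last by move=> w; rewrite set0U; apply: Gf.
    by rewrite set0U; split; [exact: sp0|move=> a u v; apply: spP].
  have key u v : ((\bigcup_(X in F) X) `|` G)%classic u ->
      ((\bigcup_(X in F) X) `|` G)%classic v ->
      exists X, [/\ F X, (X `|` G)%classic u & (X `|` G)%classic v].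
    move=> [[X FX Xu]|Gu] [[Y FY Yv]|Gv].
    - have [XY|YX] := Ft _ _ FX FY.
        by exists Y; split=> //; left=> //; apply: XY.
      by exists X; split=> //; left=> //; apply: YX.
    - by exists X; split=> //; [left|right].
    - by exists Y; split=> //; [right|left].
    - by exists X0; split=> //; right.
  split; first split.
  - by right; apply: sp0.
  - move=> a u v Uu Uv; have [X [FX Xu Xv]] := key _ _ Uu Uv.
    have [[_ Xc] _] := FP _ FX.
    have [Xz|Gz] := Xc a u v Xu Xv; last by right.
    by left; exists X.
  - move=> w Uw; have [X [FX Xw _]] := key _ _ Uw Uw.
    by have [_] := FP _ FX; apply.
pose H := (M `|` G)%classic.
have Hc a u v : H u -> H v -> H (a *: u + v) := Mc a u v.
(* A vector [v] outside the domain could be sent to 0: the graph [B] spanned by [H] and [(v, 0)]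
   would still be single-valued, against maximality. *)
have Htot v : exists w, H (v, w).
  apply: contrapT => nv.
  pose B := [set z : V * W | exists a u, H u /\ z = a *: (v, 0) + u]%classic.
  have HB z : H z -> B z by move=> Hz; exists 0, z; rewrite scale0r add0r.
  have BG : (B `|` G)%classic = B.
    by apply: setUidl => z Gz; apply: HB; right.
  have nBv : ~ H (v, 0) by move=> Hv; apply: nv; exists 0.
  apply: (maxM B); first split.
  - by move=> z Mz; apply: HB; left.
  - move=> /(_ (v, 0)) BM; apply: nBv; left; apply: BM.
    by exists 1, 0; rewrite scale1r addr0.
  split; rewrite BG; first split; first by apply: HB.
  - move=> a _ _ [b [u [Hu ->]]] [c [u' [Hu' ->]]].
    exists (a * b + c), (a *: u + u'); split; first exact: Hc.
    by rewrite scalerDr scalerA scalerDl addrACA.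
  - move=> w [a [[u1 u2] [Hu [e1 e2]]]]; move: e1 e2 => /=.
    rewrite scaler0 add0r => /esym e1 ->; have [a0|a0] := eqVneq a 0.
      by move: e1; rewrite a0 scale0r add0r => u0; apply: Mf; rewrite -u0.
    case: nv; exists (- a^-1 *: u2).
    have -> : v = - a^-1 *: u1.
      by rewrite -(addr0_eq e1) scalerN scaleNr opprK scalerA mulVf ?scale1r.
    have -> : (- a^-1 *: u1, - a^-1 *: u2) = - a^-1 *: (u1, u2) + 0.
      by rewrite addr0.
    exact: Hc.
have [f fH] := choice Htot.
have Hfun v w : H (v, w) -> f v = w.
  move=> Hv; apply/eqP; rewrite -subr_eq0; apply/eqP; apply: Mf.
  have -> : (0, f v - w) = -1 *: (v, w) + (v, f v).
    by congr pair; rewrite /= ?scaleN1r 1?addrC ?subrr // addrC.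
  exact: Hc.
have lf : linear f.
  by move=> a u v; apply: Hfun; apply: (Hc a (u, f u) (v, f v)).
have [g gf] := linear_pack lf.
by exists g => v w Gv; rewrite gf; apply: Hfun; right.
Qed.

End Extension.

Section LinearFun.
Variables (k : fieldType) (V W : lmodType k) (f : V -> W) (lf : linear f).

Lemma lin_sum (I : Type) (r : seq I) (P : pred I) (F : I -> V) :
  f (\sum_(i <- r | P i) F i) = \sum_(i <- r | P i) f (F i).
Proof.
have [g gE] := linear_pack lf.
by rewrite -gE linear_sum; apply: eq_bigr => i _; rewrite gE.
Qed.

Lemma lin0 : f 0 = 0.
Proof. by have [g gE] := linear_pack lf; rewrite -gE linear0. Qed.

Lemma linD x y : f (x + y) = f x + f y.
Proof. by have [g gE] := linear_pack lf; rewrite -!gE linearD. Qed.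

Lemma linB x y : f (x - y) = f x - f y.
Proof. by have [g gE] := linear_pack lf; rewrite -!gE linearB. Qed.

Lemma linZ a x : f (a *: x) = a *: f x.
Proof. by have [g gE] := linear_pack lf; rewrite -!gE linearZ. Qed.

End LinearFun.

Lemma lin_comb (k : fieldType) (V W : lmodType k) (c : k) (f g : V -> W) :
  linear f -> linear g -> linear (fun x => c *: f x + g x).
Proof.
move=> lf lg a u v; rewrite lf lg !scalerDr !scalerA (mulrC c a).
by rewrite addrACA.
Qed.

Section Factor.
Variable k : fieldType.

(** The pairs [(f u, h u)] form a subspace of [V * W], single-valued because [h] vanishes on the
    kernel of [f]. *)
Lemma linear_factor (U V W : lmodType k) (f : {linear U -> V}) (h : {linear U -> W}) :
  (forall u, f u = 0 -> h u = 0) ->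
  exists g : {linear V -> W}, forall u, g (f u) = h u.
Proof.
move=> fh.
have Gc : (exists u, (0 : V * W) = (f u, h u)) /\ forall (a : k) z z',
    (exists u, z = (f u, h u)) -> (exists u, z' = (f u, h u)) ->
    exists u, a *: z + z' = (f u, h u).
  split; first by exists 0; rewrite !linear0.
  by move=> a _ _ [u ->] [u' ->]; exists (a *: u + u'); rewrite !linearP.
have [|g gP] := @functional_extend k V W (Subspace Gc).
  by move=> w [u [/esym/fh hu ->]].
by exists g => u; apply: gP; exists u.
Qed.

Lemma linear_left_inverse (U V : lmodType k) (f : {linear U -> V}) :
  (forall u, f u = 0 -> u = 0) ->
  exists g : {linear V -> U}, forall u, g (f u) = u.
Proof. by move=> fi; apply: (linear_factor (h := idfun)) => u /fi. Qed.

Definition inc (V : lmodType k) (S : subspace V) (s : subsp S) : V := val s.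

Fact inc_linear (V : lmodType k) (S : subspace V) : linear (@inc V S).
Proof. by move=> a x y; apply: (linearP val). Qed.

HB.instance Definition _ (V : lmodType k) (S : subspace V) :=
  GRing.isLinear.Build k (subsp S) V *:%R (@inc V S) (@inc_linear V S).

Lemma inc_inj (V : lmodType k) (S : subspace V) : injective (@inc V S).
Proof. exact: val_inj. Qed.

Lemma incP (V : lmodType k) (S : subspace V) (s : subsp S) : S (inc s).
Proof. exact: subspP. Qed.

Lemma incK (V : lmodType k) (S : subspace V) x (Sx : S x) : inc (mksub Sx) = x.
Proof. by []. Qed.

Lemma retraction (V : lmodType k) (S : subspace V) :
  exists g : {linear V -> subsp S}, forall s, g (inc s) = s.
Proof.
apply: (linear_left_inverse (f := @inc V S)) => s s0.
by apply: inc_inj; rewrite s0 (lin0 (@inc_linear V S)).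
Qed.

Lemma retract_id (V : lmodType k) (S : subspace V) (g : {linear V -> subsp S}) x :
  (forall s, g (inc s) = s) -> S x -> inc (g x) = x.
Proof. by move=> gK Sx; rewrite -[x in g x](incK Sx) gK. Qed.

Lemma linear_section (U V : lmodType k) (d : {linear U -> V}) :
  exists s : {linear V -> U}, forall u, d (s (d u)) = d u.
Proof.
have [g gK] := retraction (kersp d).
have [|s sP] := @linear_factor _ _ _ d (idfun \- (@inc _ _ \o g)).
  by move=> u du0; rewrite /= (retract_id gK) ?subrr.
by exists s => u; rewrite sP /= linearB (incP (g u)) subr0.
Qed.

Lemma class_eq0 (V : lmodType k) (S : subspace V) x : class S x = 0 <-> S x.
Proof.
have <- : class S 0 = 0 by exact: linear0.
by rewrite class_eq subr0.
Qed.

(** [U] still embeds in the quotient by [U'], and a left inverse of this embedding gives the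
    projection. *)
Lemma separation (V : lmodType k) (U U' : subspace V) :
  (forall u, U u -> U' u -> u = 0) ->
  exists P : {linear V -> V}, (forall u, U u -> P u = u) /\ (forall u, U' u -> P u = 0).
Proof.
move=> UU'; have [|g gP] := @linear_left_inverse _ _ (class U' \o @inc _ U).
  move=> u /= /class_eq0 U'u; apply: inc_inj; rewrite linear0.
  by apply: UU' => //; apply: incP.
exists (@inc _ U \o g \o class U'); split=> u Uu /=.
  by have /= := gP (mksub Uu) => ->.
by have -> : class U' u = 0; [apply/class_eq0|rewrite !linear0].
Qed.

Lemma linear_sum_maps (V W : lmodType k) (I : Type) (r : seq I) (P : pred I)
    (F : I -> {linear V -> W}) :
  exists g : {linear V -> W}, forall x, g x = \sum_(i <- r | P i) F i x.
Proof.
have l : linear (fun x => \sum_(i <- r | P i) F i x).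
  move=> a x y; rewrite scaler_sumr -big_split; apply: eq_bigr => i _ /=.
  exact: linearP.
by have [g gE] := linear_pack l; exists g.
Qed.

Lemma equalizer_closed (V W : lmodType k) (f g : {linear V -> W}) :
  f 0 = g 0 /\ forall (a : k) u v, f u = g u -> f v = g v ->
    f (a *: u + v) = g (a *: u + v).
Proof.
split; first by rewrite !linear0.
by move=> a u v fu fv; rewrite !linearP fu fv.
Qed.

(** Linear identities are proved below by showing that this subspace contains a spanning set. *)
Definition equalizer (V W : lmodType k) (f g : {linear V -> W}) :=
  @Subspace k V (fun x => f x = g x) (equalizer_closed f g).

(* A linear map fixing [U] and sending [U'] into [U] computes intersections of
   products such as [A U B] and [A U' B] by applying it to the middle factor. *)
Lemma cap_projection (V : lmodType k) (U U' : subspace V) :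
  exists f : {linear V -> V}, (forall u, U u -> f u = u) /\
    (forall u, U' u -> capsp U U' (f u)).
Proof.
have [q qK] := retraction (capsp U U').
(* The image of [U'] under [1 - q] is a complement of the intersection inside [U']. It meets [U] in
   0, so that [separation] applies. *)
have Cc : (exists2 u, U' u & 0 = u - inc (q u)) /\ forall (a : k) x y,
    (exists2 u, U' u & x = u - inc (q u)) -> (exists2 u, U' u & y = u - inc (q u)) ->
    exists2 u, U' u & a *: x + y = u - inc (q u).
  split; first by exists 0; [exact: sp0|rewrite !linear0 addr0].
  move=> a _ _ [u Uu ->] [v Uv ->]; exists (a *: u + v); first exact: spP.
  by rewrite !linearP scalerDr addrACA.
have [|P [PU PC]] := @separation _ U (Subspace Cc).
  move=> _ /[swap] -[u U'u ->] Uuq; have /capspE[Uq _] := incP (q u).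
  have Uu : U u by rewrite -(subrK (inc (q u)) u); apply: spD.
  by rewrite (retract_id qK) ?subrr //; apply/capspE.
exists P; split=> // u U'u; have -> : P u = inc (q u); last exact: incP.
have /capspE[Uq _] := incP (q u).
apply/eqP; rewrite -subr_eq0 -{1}(PU _ Uq) -linearB; apply/eqP.
by apply: PC; exists u.
Qed.

End Factor.

Section TensorTools.
Variable k : fieldType.
Implicit Types U V W Z : lmodType k.

Lemma tpairl_linear U W (w : W) : linear (fun u : U => tpair u w).
Proof. by move=> a u u'; apply: tpairPl. Qed.

Lemma tpairr_linear U W (u : U) : linear (tpair u : W -> tens U W).
Proof. by move=> a w w'; apply: tpairPr. Qed.

Lemma tens_span U W (S : subspace (tens U W)) :
  (forall u w, S (tpair u w)) -> forall t, S t.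
Proof.
move=> Sp t; rewrite -[t]class_repr [repr t]monalgE linear_sum.
apply: sp_sum => -[u w] _.
by rewrite -[X in << X *g _ >>]mulr1 -malgZU linearZ; apply: spZ; apply: Sp.
Qed.

Lemma tens_eq U W Z (f g : {linear tens U W -> Z}) :
  (forall u w, f (tpair u w) = g (tpair u w)) -> f =1 g.
Proof. by move=> fg; apply: (@tens_span _ _ (equalizer f g)). Qed.

Lemma tens_eqf U W Z (f g : tens U W -> Z) : linear f -> linear g ->
  (forall u w, f (tpair u w) = g (tpair u w)) -> f =1 g.
Proof.
move=> lf lg fg; have [F FE] := linear_pack lf; have [G GE] := linear_pack lg.
by move=> x; rewrite -FE -GE; apply: tens_eq => u w; rewrite FE GE.
Qed.

Lemma tens_lift U W Z (b : U -> W -> Z) :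
  (forall w, linear (b^~ w)) -> (forall u, linear (b u)) ->
  exists F : {linear tens U W -> Z}, forall u w, F (tpair u w) = b u w.
Proof.
move=> bl br; have [|F FE] := @linear_pack _ _ _ (tlift b).
  by apply: tlift_linear => *; [apply: bl|apply: br].
by exists F => u w; rewrite FE tlift_pair // => *; [apply: bl|apply: br].
Qed.

(** A tensor product is given by its universal property, [ft_span] being the uniqueness part,
    because the same space is used with several decompositions: [A (x) W (x) A] is split on the left
    and on the right, and [A] itself is [k (x) A]. *)
Record free_tensor U W Z (p : U -> W -> Z) := FreeTensor {
  ft_l : forall w, linear (fun u => p u w);
  ft_r : forall u, linear (p u);
  ft_span : forall S : subspace Z, (forall u w, S (p u w)) -> forall t, S t;
  ft_lift : forall (Z' : lmodType k) (b : U -> W -> Z'),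
    (forall w, linear (b^~ w)) -> (forall u, linear (b u)) ->
    exists F : {linear Z -> Z'}, forall u w, F (p u w) = b u w }.

Lemma free_tensor_tens U W : @free_tensor U W (tens U W) (@tpair k U W).
Proof.
split; [exact: tpairl_linear|exact: tpairr_linear|exact: tens_span|exact: tens_lift].
Qed.

Lemma ft_eqf U W Z (Z' : lmodType k) (p : U -> W -> Z) (f g : Z -> Z') : free_tensor p ->
  linear f -> linear g -> (forall u w, f (p u w) = g (p u w)) -> f =1 g.
Proof.
move=> ft lf lg fg; have [F FE] := linear_pack lf; have [G GE] := linear_pack lg.
move=> x; rewrite -FE -GE; apply: (ft_span ft (S := equalizer F G)) => u w /=.
by rewrite FE GE.
Qed.

Lemma ft_map U V Z (U' V' Z' : lmodType k) (p : U -> V -> Z) (p' : U' -> V' -> Z')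
    (f : {linear U -> U'}) (g : {linear V -> V'}) : free_tensor p -> free_tensor p' ->
  exists F : {linear Z -> Z'}, forall u v, F (p u v) = p' (f u) (g v).
Proof.
move=> ft ft'; apply: (ft_lift ft) => [w|u] a x y.
  by rewrite (linearP f); apply: (ft_l ft').
by rewrite (linearP g); apply: (ft_r ft').
Qed.

(** Over a field exactness yields the identity [v = f (h v) + s (g v)], which tensoring with a fixed
    space preserves; [ft_exact] uses it in this form. *)
Lemma exact_split U V Z (f : {linear U -> V}) (g : {linear V -> Z}) :
  (forall v, g v = 0 -> exists u, v = f u) ->
  exists (h : {linear V -> U}) (s : {linear Z -> V}), forall v, v = f (h v) + s (g v).
Proof.
move=> ex; have [sf sfP] := linear_section f; have [sg sgP] := linear_section g.
exists (sf \o (idfun \- (sg \o g))), sg => v /=.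
have [|u uE] := ex (v - sg (g v)); first by rewrite linearB sgP subrr.
by rewrite /= {1}uE sfP -uE subrK.
Qed.

Lemma ft_exact U V Z W (ZU ZV ZZ : lmodType k) (pU : U -> W -> ZU) (pV : V -> W -> ZV)
    (pZ : Z -> W -> ZZ) (f : {linear U -> V}) (g : {linear V -> Z})
    (F : {linear ZU -> ZV}) (G : {linear ZV -> ZZ}) :
  free_tensor pU -> free_tensor pV -> free_tensor pZ ->
  (forall v, g v = 0 -> exists u, v = f u) ->
  (forall u w, F (pU u w) = pV (f u) w) ->
  (forall u w, G (pV u w) = pZ (g u) w) ->
  forall t, G t = 0 -> exists s, t = F s.
Proof.
move=> fU fV fZ ex FE GE t t0; have [h [s hsE]] := exact_split ex.
have [S SE] := ft_map s (idfun : {linear W -> W}) fZ fV.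
have [H HE] := ft_map h (idfun : {linear W -> W}) fV fU.
have tE : (idfun : {linear ZV -> _}) =1 (F \o H) \+ (S \o G).
  apply: (ft_eqf fV (linearP idfun) (linearP _)) => v w; rewrite /= HE FE GE SE /=.
  by rewrite -(linD (ft_l fV w)) -hsE.
by exists (H t); rewrite -[LHS]/(idfun t) tE /= t0 linear0 addr0.
Qed.

Lemma ft_surj U V Z (U' V' Z' : lmodType k) (p : U -> V -> Z) (p' : U' -> V' -> Z') (f : U -> U')
    (g : V -> V') (F : {linear Z -> Z'}) : free_tensor p' ->
  (forall u v, F (p u v) = p' (f u) (g v)) ->
  (forall v, exists u, v = f u) -> (forall v, exists u, v = g u) ->
  forall t, exists s, t = F s.
Proof.
move=> ft FE fs gs; apply: (ft_span ft (S := imsp F)) => u w.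
have [u' ->] := fs u; have [w' ->] := gs w.
by exists (p u' w'); rewrite FE.
Qed.

End TensorTools.

(** * Weight decompositions *)

Section FiniteDimension.
Variables (k : fieldType) (V : lmodType k).

Lemma span_seq_coord (s : seq V) x :
  span (fun y => y \in s) x -> exists c : nat -> k, x = \sum_(i < size s) c i *: s`_i.
Proof.
have Sc : (exists c : nat -> k, (0 : V) = \sum_(i < size s) c i *: s`_i) /\
    forall (a : k) u v, (exists c : nat -> k, u = \sum_(i < size s) c i *: s`_i) ->
    (exists c : nat -> k, v = \sum_(i < size s) c i *: s`_i) ->
    exists c : nat -> k, a *: u + v = \sum_(i < size s) c i *: s`_i.
  split; first by exists (fun=> 0); rewrite big1 // => i _; rewrite scale0r.
  move=> a _ _ [c ->] [d ->]; exists (fun i => a * c i + d i).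
  rewrite scaler_sumr -big_split; apply: eq_bigr => i _ /=.
  by rewrite scalerDl scalerA.
apply: (@span_min _ _ _ (Subspace Sc)) => y ys /=.
have iy : (index y s < size s)%N by rewrite index_mem.
exists (fun i => (i == index y s)%:R); rewrite (bigD1 (Ordinal iy)) //= eqxx scale1r.
rewrite nth_index // big1 ?addr0 // => i /negbTE ii.
by rewrite -[_ == _]/(i == Ordinal iy) ii scale0r.
Qed.

(* If [y] is not in [g S], then [y], [g y], [g (g y)], ... are linearly independent. *)
Lemma injective_surjective (S : subspace V) (s : seq V) (g : {linear V -> V}) :
  (forall x, S x -> span (fun y => y \in s) x) -> (forall x, S x -> S (g x)) ->
  (forall x, S x -> g x = 0 -> x = 0) -> forall y, S y -> exists2 x, S x & g x = y.
Proof.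
move=> Ss gS gi y Sy; apply: contrapT => ny.
pose v n := iter n g y.
have Sv n : S (v n) by elim: n => //= n; apply: gS.
(* In a vanishing combination the coefficient of [y] must be 0, since otherwise [y] would lie in
   [g S]; then [g] can be cancelled and induction applies. *)
have ind n : forall u : nat -> k, \sum_(i < n) u i *: v i = 0 ->
    forall i, (i < n)%N -> u i = 0.
  elim: n => [//|n IHn] u; rewrite big_ord_recl /=.
  set z := \sum_(i < n) u i.+1 *: v i.
  have -> : \sum_(i < n) u (bump 0 i) *: v (bump 0 i) = g z.
    by rewrite linear_sum; apply: eq_bigr => i _; rewrite linearZ.
  have Sz : S z by apply: sp_sum => i _; apply: spZ.
  move=> /eqP; rewrite addr_eq0 => /eqP uz.
  have u0 : u 0%N = 0.
    apply/eqP/negPn/negP => nz; apply: ny; exists (- (u 0%N)^-1 *: z); first exact: spZ.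
    by rewrite linearZ_LR scaleNr -scalerN -uz scalerA mulVf // scale1r.
  have /(IHn (fun i => u i.+1)) z0 : z = 0.
    by apply: gi => //; apply/eqP; rewrite -oppr_eq0 -uz u0 scale0r.
  by case=> // i; apply: z0.
have [c cE] := choice (fun n => span_seq_coord (Ss _ (Sv n))).
(* There is one more iterate than there are generators, so the coordinate matrix has a nonzero left
   kernel, that is, a nontrivial relation among the [v n]. *)
pose C := \matrix_(i < (size s).+1, j < size s) c i j.
have : (0 < \rank (kermx C))%N.
  by rewrite mxrank_ker subn_gt0 ltnS; apply: leq_trans (rank_leq_col _) _.
rewrite lt0n mxrank_eq0 => /rowV0Pn[u /sub_kermxP uC /negP]; apply; apply/eqP/rowP => i.
pose w n := if insub n is Some j then u 0 j else 0.
have wE j : w (nat_of_ord j) = u 0 j by rewrite /w valK.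
rewrite -wE mxE; apply: (ind (size s).+1) => //.
under eq_bigr => j _ do rewrite cE scaler_sumr wE.
rewrite exchange_big big1 // => j _ /=.
under eq_bigr do rewrite scalerA.
rewrite -scaler_suml; have /rowP/(_ j) := uC; rewrite !mxE.
by under eq_bigr do rewrite mxE; move=> ->; rewrite scale0r.
Qed.

End FiniteDimension.

Section WeightDecomposition.
Variable k : fieldType.
Implicit Types U V W : lmodType k.

(** A grading is carried by its projections instead of its components, so that maps, tensor products
    and quotients handle it through linear identities. Asking for the sum up to every [M >= N] makes
    the projections vanish beyond [N]. *)
Definition wdecomp V (pr : nat -> {linear V -> V}) : Prop :=
  (forall m n x, pr m (pr n x) = if m == n then pr n x else 0) /\
  forall x, exists N, forall M, (N <= M)%N -> x = \sum_(n < M) pr n x.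

Definition wstable V (pr : nat -> {linear V -> V}) (S : subspace V) : Prop :=
  forall n x, S x -> S (pr n x).

Section Theory.
Variables (V : lmodType k) (pr : nat -> {linear V -> V}).
Hypothesis dec : wdecomp pr.

Lemma wd_id n x : pr n (pr n x) = pr n x.
Proof. by rewrite dec.1 eqxx. Qed.

Lemma wd_neq m n x : m != n -> pr m (pr n x) = 0.
Proof. by rewrite dec.1 => /negbTE ->. Qed.

Lemma wd_sum x : exists N, x = \sum_(n < N) pr n x.
Proof. by have [N NP] := dec.2 x; exists N; apply: NP. Qed.

Lemma wd_bound x : exists N, forall n, (N <= n)%N -> pr n x = 0.
Proof.
have [N NP] := dec.2 x; exists N => n Nn.
have := NP n.+1 (leqW Nn); rewrite big_ord_recr /= -(NP n Nn) => xE.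
by apply: (addrI x); rewrite addr0.
Qed.

Lemma wd_eq W (f g : {linear V -> W}) : (forall n x, f (pr n x) = g (pr n x)) -> f =1 g.
Proof.
move=> fg x; have [N ->] := wd_sum x; rewrite !linear_sum.
by apply: eq_bigr => i _; apply: fg.
Qed.

Lemma wd_ext x y : (forall n, pr n x = pr n y) -> x = y.
Proof.
move=> xy; have [N xN] := dec.2 x; have [M yM] := dec.2 y.
rewrite (xN (maxn N M)) ?leq_maxl // (yM (maxn N M)) ?leq_maxr //.
by apply: eq_bigr => i _; apply: xy.
Qed.

Lemma wd_span (S : subspace V) x : (forall n, S (pr n x)) -> S x.
Proof. by move=> Sx; have [N ->] := wd_sum x; apply: sp_sum. Qed.

(** Each vector has finitely many nonzero components, so a linear map may be prescribed on each
    weight separately. This produces homogeneous lifts, and maps that depend on the length of a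
    word. *)
Lemma wd_glue W (h : nat -> {linear V -> W}) :
  exists h0 : {linear V -> W}, forall n x, h0 (pr n x) = h n (pr n x).
Proof.
have [N NP] := choice wd_bound.
pose f x := \sum_(n < N x) h n (pr n x).
have fE M x : (N x <= M)%N -> f x = \sum_(n < M) h n (pr n x).
  move=> NM; rewrite /f (big_ord_widen M (fun n => h n (pr n x)) NM) big_mkcond.
  by apply: eq_bigr => i _; case: ltnP => // /NP ->; rewrite linear0.
have lf : linear f.
  move=> a x y; pose M := maxn (N (a *: x + y)) (maxn (N x) (N y)).
  rewrite !(fE M) ?leq_max ?leqnn ?orbT // scaler_sumr -big_split.
  by apply: eq_bigr => i _; rewrite /= !linearP.
have [g gE] := linear_pack lf; exists g => n x; rewrite gE.
rewrite (fE (maxn n.+1 (N (pr n x)))) ?leq_maxr //.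
have nM : (n < maxn n.+1 (N (pr n x)))%N by rewrite leq_maxl.
rewrite (bigD1 (Ordinal nM)) //= wd_id big1 ?addr0 // => i ni.
by rewrite wd_neq ?linear0.
Qed.

Lemma wd_sub (S : subspace V) : wstable pr S ->
  exists prS : nat -> {linear subsp S -> subsp S},
    wdecomp prS /\ forall n (s : subsp S), inc (prS n s) = pr n (inc s).
Proof.
move=> St; have /choice[prS prSE] n : exists p : {linear subsp S -> subsp S},
    forall s : subsp S, inc (p s) = pr n (inc s).
  have l : linear (fun s : subsp S => mksub (St n _ (incP s))).
    move=> a x y; apply: inc_inj; rewrite [RHS]linearP !incK.
    by rewrite (linearP (@inc _ V S)) (linearP (pr n)).
  by have [p pE] := linear_pack l; exists p => s; rewrite pE.
exists prS; split=> //; split=> [m n s|s].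
  by apply: inc_inj; rewrite !prSE dec.1; case: eqP; rewrite ?prSE ?linear0.
have [N NP] := dec.2 (inc s); exists N => M NM; apply: inc_inj.
by rewrite (lin_sum (@inc_linear _ V S)) {1}(NP M) //; apply: eq_bigr => i _; rewrite prSE.
Qed.

Lemma wd_quot W (p : {linear V -> W}) :
  (forall y, exists x, p x = y) -> (forall n x, p x = 0 -> p (pr n x) = 0) ->
  exists prW : nat -> {linear W -> W},
    wdecomp prW /\ forall n x, prW n (p x) = p (pr n x).
Proof.
move=> ps pk; have /choice[prW prWE] n : exists q : {linear W -> W},
    forall x, q (p x) = p (pr n x).
  by apply: (linear_factor (f := p) (h := p \o pr n)) => x; apply: pk.
exists prW; split=> //; split=> [m n y|y]; have [x <-] := ps y.
  by rewrite !prWE dec.1; case: eqP; rewrite ?linear0.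
have [N NP] := dec.2 x; exists N => M NM.
by rewrite {1}(NP M NM) linear_sum; apply: eq_bigr => i _; rewrite prWE.
Qed.

End Theory.

Lemma wd_grading V (G : nat -> subspace V) : is_grading G ->
  exists pr : nat -> {linear V -> V}, wdecomp pr /\ forall n x, G n x <-> pr n x = x.
Proof.
move=> [Gs Gd].
have /choice[c cP] x : exists f : nat -> V, (forall i, G i (f i)) /\
    exists N, forall M, (N <= M)%N -> x = \sum_(i < M) f i.
  have [N [f [Gf ->]]] := Gs x.
  (* The family obtained from [Gs] may continue with nonzero terms after [N]; it is cut off
     there. *)
  exists (fun i => if (i < N)%N then f i else 0); split.
    by move=> i; case: ifP => // _; apply: sp0.
  exists N => M NM; rewrite (big_ord_widen M _ NM) big_mkcond.
  by apply: eq_bigr.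
have cU x f : (forall i, G i (f i)) ->
    (exists N, forall M, (N <= M)%N -> x = \sum_(i < M) f i) -> c x =1 f.
  move=> Gf [N NP] i; have [Gc [N' NP']] := cP x; pose M := maxn i.+1 (maxn N N').
  apply/eqP; rewrite -subr_eq0; apply/eqP; apply: (Gd M (fun i => c x i - f i)).
  - by move=> j; apply: spD => //; apply: spN.
  - rewrite big_split sumrN /= -NP ?leq_max ?leqnn ?orbT // -NP' ?subrr //.
    by rewrite !leq_max leqnn !orbT.
  - by rewrite leq_maxl.
have cl n : linear (c^~ n).
  move=> a x y; apply: (cU _ (fun n => a *: c x n + c y n)).
    by move=> i; apply: spP; apply: (cP _).1.
  have [_ [N NP]] := cP x; have [_ [N' NP']] := cP y; exists (maxn N N') => M.
  rewrite geq_max => /andP[NM NM']; rewrite {1}(NP M NM) {1}(NP' M NM').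
  by rewrite scaler_sumr -big_split.
have [pr prE] := choice (fun n => linear_pack (cl n)).
have Gpr n x : G n x -> forall m, pr m x = if m == n then x else 0.
  move=> Gx m; rewrite prE.
  apply: (cU _ (fun m => if m == n then x else 0)) => [i|].
    by case: eqP => [->//|_]; apply: sp0.
  exists n.+1 => M nM; rewrite (bigD1 (Ordinal nM)) //= eqxx big1 ?addr0 // => i.
  by move=> /negbTE ni; rewrite -[_ == _]/(i == Ordinal nM) ni.
exists pr; split; first split.
- by move=> m n x; apply: Gpr; rewrite prE; apply: (cP x).1.
- move=> x; have [_ [N NP]] := cP x; exists N => M /NP {1}->.
  by apply: eq_bigr => i _; rewrite prE.
- move=> n x; split=> [/Gpr ->|<-]; first by rewrite eqxx.
  by rewrite prE; apply: (cP x).1.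
Qed.

Lemma ft_spanw U V (Z : lmodType k) (p : U -> V -> Z) (prU : nat -> {linear U -> U})
    (prV : nat -> {linear V -> V}) (S : subspace Z) :
  free_tensor p -> wdecomp prU -> wdecomp prV ->
  (forall i j u v, S (p (prU i u) (prV j v))) -> forall t, S t.
Proof.
move=> ft dU dV Sp; apply: (ft_span ft) => u v.
have [N ->] := wd_sum dU u; have [M ->] := wd_sum dV v.
rewrite (lin_sum (ft_r ft _)); apply: sp_sum => i _.
by rewrite (lin_sum (ft_l ft _)); apply: sp_sum.
Qed.

Lemma wd_tens U V (Z : lmodType k) (p : U -> V -> Z) (prU : nat -> {linear U -> U})
    (prV : nat -> {linear V -> V}) : free_tensor p -> wdecomp prU -> wdecomp prV ->
  exists pr : nat -> {linear Z -> Z}, wdecomp pr /\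
    forall n i j u v, pr n (p (prU i u) (prV j v)) =
      if n == (i + j)%N then p (prU i u) (prV j v) else 0.
Proof.
move=> ft dU dV.
have /choice[F FE] (ij : nat * nat) : exists F : {linear Z -> Z},
    forall u v, F (p u v) = p (prU ij.1 u) (prV ij.2 v).
  exact: (ft_map _ _ ft ft).
have /choice[pr prE] n : exists q : {linear Z -> Z},
    forall x, q x = \sum_(i < n.+1) F (nat_of_ord i, (n - i)%N) x.
  exact: (@linear_sum_maps k Z Z _ _ _ (fun i : 'I_n.+1 => F (nat_of_ord i, (n - i)%N))).
have prh n i j u v : pr n (p (prU i u) (prV j v)) =
    if n == (i + j)%N then p (prU i u) (prV j v) else 0.
  have [->|nij] := eqVneq n; rewrite prE.
    have ij : (i < (i + j).+1)%N by rewrite ltnS leq_addr.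
    rewrite (bigD1 (Ordinal ij)) //= FE /= addKn (wd_id dU) (wd_id dV) big1 ?addr0 //.
    move=> l li; rewrite FE /= (wd_neq dU) //; exact: (lin0 (ft_l ft _)).
  apply: big1 => l _; rewrite FE /=; have [li|] := eqVneq (nat_of_ord l) i.
    rewrite (@wd_neq _ _ dV (n - l)%N); first exact: (lin0 (ft_r ft _)).
    by apply: contra nij => /eqP <-; rewrite -li subnKC // -ltnS.
  by move=> li; rewrite (wd_neq dU) //; exact: (lin0 (ft_l ft _)).
exists pr; split=> //; split=> [m n|].
  have [N NE] : exists N : {linear Z -> Z}, forall x, N x =
      if m == n then pr n x else 0.
    by case: eqP; [exists (pr n)|exists \0].
  move=> x; rewrite -NE -[LHS]/((pr m \o pr n) x).
  apply: (ft_spanw (S := equalizer (pr m \o pr n) N) ft dU dV) => i j u v /=.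
  rewrite NE prh; case: ifP => [/eqP->|_]; first by rewrite prh.
  by rewrite linear0 if_same.
have Sc : (exists N, forall M, (N <= M)%N -> 0 = \sum_(n < M) pr n 0) /\
    forall (a : k) x y, (exists N, forall M, (N <= M)%N -> x = \sum_(n < M) pr n x) ->
    (exists N, forall M, (N <= M)%N -> y = \sum_(n < M) pr n y) ->
    exists N, forall M, (N <= M)%N -> a *: x + y = \sum_(n < M) pr n (a *: x + y).
  split; first by exists 0%N => M _; rewrite big1 // => i _; rewrite linear0.
  move=> a x y [N NP] [N' NP']; exists (maxn N N') => M; rewrite geq_max => /andP[h h'].
  rewrite {1}(NP M h) {1}(NP' M h') scaler_sumr -big_split.
  by apply: eq_bigr => i _; rewrite /= linearP.
apply: (ft_spanw (S := Subspace Sc) ft dU dV) => i j u v /=.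
exists (i + j).+1 => M ijM; rewrite (bigD1 (Ordinal ijM)) //= prh eqxx.
rewrite big1 ?addr0 // => n /negbTE nij.
by rewrite prh -[_ == _]/(n == Ordinal ijM) nij.
Qed.

Lemma malg_span (K : choiceType) (S : subspace {malg k[K]}) :
  (forall w, S << w >>) -> forall t, S t.
Proof.
move=> Sw t; rewrite [t]monalgE; apply: sp_sum => w _.
by rewrite -[X in << X *g _ >>]mulr1 -malgZU; apply/spZ/Sw.
Qed.

Lemma malg_lin (K : choiceType) V (h : K -> V) :
  exists f : {linear {malg k[K]} -> V}, forall w, f << w >> = h w.
Proof.
pose f (g : {malg k[K]}) := \sum_(p <- msupp g) g@_p *: h p.
have fE (d : {fset K}) g : (msupp g `<=` d)%fset -> f g = \sum_(p <- d) g@_p *: h p.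
  move=> gd; rewrite /f (big_fset_incl _ gd) // => p _ /mcoeff_outdom->.
  by rewrite scale0r.
have lf : linear f.
  move=> a g g'; pose d := (msupp g `|` msupp g' `|` msupp (a *: g + g'))%fset.
  rewrite !(@fE d) /d ?fsubsetUr //; last first.
  - by rewrite -fsetUA fsubsetUl.
  - by rewrite fsetUC fsetUA fsubsetUr.
  rewrite scaler_sumr -big_split; apply: eq_bigr => p _ /=.
  by rewrite mcoeffD mcoeffZ scalerDl scalerA.
have [F FE] := linear_pack lf; exists F => w.
by rewrite FE /f msuppU oner_eq0 big_seq_fset1 mcoeffUU scale1r.
Qed.

End WeightDecomposition.

(** * Free algebras *)

(** Stands for the tensor algebra: [word_span] and [word_lift] say that the words form a basis.
    [free_scalerAr] is a separate field since an [lalgType] only moves scalars out of the left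
    factor. *)
Record free_words (k : fieldType) (T : lalgType k) (X : Type) (word : seq X -> T) :=
  FreeWords {
    free_scalerAr : forall (a : k) (s t : T), s * (a *: t) = a *: (s * t);
    wordM : forall s t, word (s ++ t) = word s * word t;
    word_nil : word [::] = 1;
    word_span : forall S : subspace T, (forall s, S (word s)) -> forall t, S t;
    word_lift : forall (Z : lmodType k) (h : seq X -> Z),
      exists F : {linear T -> Z}, forall s, F (word s) = h s }.

Section ProductSubspaces.
Variables (k : fieldType) (T : lalgType k) (X : Type) (word : seq X -> T).
Hypothesis fw : free_words word.
Implicit Types U W Z S : subspace T.

Lemma mulr_linear (s : T) : linear ( *%R s : T -> T).
Proof. by move=> a x y; rewrite mulrDr (free_scalerAr fw). Qed.

Lemma mull_linear (s : T) : linear (fun t : T => t * s).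
Proof. by move=> a x y; rewrite mulrDl scalerAl. Qed.

Lemma free_mulrP (s : T) a x y : s * (a *: x + y) = a *: (s * x) + s * y.
Proof. exact: mulr_linear. Qed.

Lemma free_mullP (s : T) a x y : (a *: x + y) * s = a *: (x * s) + y * s.
Proof. exact: mull_linear. Qed.

Lemma mulspI U W u w : U u -> W w -> mulsp U W (u * w).
Proof. by move=> Uu Ww; apply: span_sub; exists u, w. Qed.

Lemma mulsp_ind U W S : (forall u w, U u -> W w -> S (u * w)) ->
  forall x, mulsp U W x -> S x.
Proof. by move=> H; apply: span_min => _ [u [w [Uu Ww ->]]]; apply: H. Qed.

Lemma mulsp_indf U W (Y : lmodType k) (f : {linear T -> Y}) (S : subspace Y) :
  (forall u w, U u -> W w -> S (f (u * w))) -> forall x, mulsp U W x -> S (f x).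
Proof. by move=> H; apply: (@mulsp_ind _ _ (presp f S)). Qed.

Lemma mulspS U U' W W' : (forall x, U x -> U' x) -> (forall x, W x -> W' x) ->
  forall x, mulsp U W x -> mulsp U' W' x.
Proof. by move=> UU WW; apply: mulsp_ind => u w /UU ? /WW ?; apply: mulspI. Qed.

Lemma mulspA U W Z : mulsp (mulsp U W) Z = mulsp U (mulsp W Z).
Proof.
apply: subspace_eq => x; split; apply: mulsp_ind.
  move=> y z + Zz; have [f fE] := linear_pack (mull_linear z).
  rewrite -[_ * _]fE; apply: mulsp_indf => u w Uu Ww.
  by rewrite fE -mulrA; do 2?apply: mulspI.
move=> u y Uu; have [f fE] := linear_pack (mulr_linear u).
rewrite -[_ * _]fE; apply: mulsp_indf => w z Ww Zz.
by rewrite fE mulrA; do 2?apply: mulspI.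
Qed.

Lemma onespP x : onesp T x <-> exists a : k, x = a%:A.
Proof.
split=> [|[a ->]]; last by apply: spZ; apply: span_sub.
have Sc : (exists a : k, (0 : T) = a%:A) /\ forall (a : k) (u v : T),
   (exists b : k, u = b%:A) -> (exists b : k, v = b%:A) -> exists b : k, a *: u + v = b%:A.
  split; first by exists 0; rewrite scale0r.
  by move=> a _ _ [b ->] [c ->]; exists (a * b + c); rewrite scalerA -scalerDl.
by apply: (@span_min _ _ _ (Subspace Sc)) => _ -> /=; exists 1; rewrite scale1r.
Qed.

Lemma onesp1 : onesp T 1. Proof. exact: span_sub. Qed.

Lemma mul1sp U : mulsp (onesp T) U = U.
Proof.
apply: subspace_eq => x; split=> [|Ux]; last by rewrite -[x]mul1r; apply/mulspI/Ux/onesp1.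
by apply: mulsp_ind => _ u /onespP[a ->] Uu; rewrite -scalerAl mul1r; apply: spZ.
Qed.

Lemma mulsp1 U : mulsp U (onesp T) = U.
Proof.
apply: subspace_eq => x; split=> [|Ux]; last by rewrite -[x]mulr1; apply/mulspI/onesp1.
by apply: mulsp_ind => u _ Uu /onespP[a ->]; rewrite (free_scalerAr fw) mulr1; apply: spZ.
Qed.

Lemma sumspI U W u w : U u -> W w -> sumsp U W (u + w).
Proof. by move=> Uu Ww; apply: spD; apply: span_sub; [exists true|exists false]. Qed.

Lemma sumspP U W x : sumsp U W x <-> exists u w, [/\ U u, W w & x = u + w].
Proof.
split=> [|[u [w [Uu Ww ->]]]]; last exact: sumspI.
have Sc : (exists u w, [/\ U u, W w & (0 : T) = u + w]) /\ forall (a : k) (x y : T),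
   (exists u w, [/\ U u, W w & x = u + w]) -> (exists u w, [/\ U u, W w & y = u + w]) ->
   exists u w, [/\ U u, W w & a *: x + y = u + w].
  split; first by exists 0, 0; split; rewrite ?addr0 //; apply: sp0.
  move=> a _ _ [u [w [Uu Ww ->]]] [u' [w' [Uu' Ww' ->]]].
  exists (a *: u + u'), (a *: w + w'); split; try exact: spP.
  by rewrite scalerDr addrACA.
apply: (@span_min _ _ _
  (Subspace Sc)) => y [[] _ /= Sy].
  by exists y, 0; split; rewrite ?addr0 //; apply: sp0.
by exists 0, y; split; rewrite ?add0r //; apply: sp0.
Qed.

Lemma sumspS U U' W W' : (forall x, U x -> U' x) -> (forall x, W x -> W' x) ->
  forall x, sumsp U W x -> sumsp U' W' x.
Proof. by move=> UU WW x /sumspP[u [w [/UU Uu /WW Ww ->]]]; apply: sumspI. Qed.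

Lemma mulspDl U W Z x : mulsp (sumsp U W) Z x <-> sumsp (mulsp U Z) (mulsp W Z) x.
Proof.
split.
  apply: mulsp_ind => _ z /sumspP[u [w [Uu Ww ->]]] Zz; rewrite mulrDl.
  by apply: sumspI; apply: mulspI.
move=> /sumspP[u [w [Uu Ww ->]]]; apply: spD; move: Uu Ww.
  by move=> + _; apply: mulspS => // y Uy; apply/sumspP; exists y, 0; split;
     rewrite ?addr0 //; apply: sp0.
by move=> _; apply: mulspS => // y Uy; apply/sumspP; exists 0, y; split;
   rewrite ?add0r //; apply: sp0.
Qed.

Lemma powsp_add U m n : powsp U (m + n) = mulsp (powsp U m) (powsp U n).
Proof. by elim: m => [|m IHm]; rewrite ?mul1sp // mulspA -IHm. Qed.

Lemma powsp1 U : powsp U 1 = U. Proof. exact: mulsp1. Qed.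

Lemma powspSl U n : powsp U n.+1 = mulsp U (powsp U n). Proof. by []. Qed.

Lemma powspSr U n : powsp U n.+1 = mulsp (powsp U n) U.
Proof. by rewrite -addn1 powsp_add powsp1. Qed.

End ProductSubspaces.

Section FreeAlgebra.
Variables (k : fieldType) (T : lalgType k) (X : Type) (word : seq X -> T).
Hypothesis fw : free_words word.
Implicit Types U W Z S C B : subspace T.

Definition letters : subspace T := span (fun t => exists x : X, t = word [:: x]).
Notation V := letters.
Notation Vn := (powsp V).

Definition wordge m : subspace T := sumsp_fam (fun n => (m <= n)%N) (powsp V).
Notation Tp := (wordge 1).

Lemma word_wd (deg : seq X -> nat) : exists pr : nat -> {linear T -> T}, wdecomp pr /\
  forall n s, pr n (word s) = if n == deg s then word s else 0.
Proof.
have /choice[pr prE] n := word_lift fw (fun s => if n == deg s then word s else 0 : T).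
exists pr; split=> //; split=> [m n|].
  have [Z ZE] : exists Z : {linear T -> T}, forall x, Z x = if m == n then pr n x else 0.
    by case: eqP; [exists (pr n)|exists \0].
  move=> x; rewrite -ZE -[LHS]/((pr m \o pr n) x); move: x.
  apply: (@word_span _ _ _ _ fw (equalizer (pr m \o pr n) Z)) => w /=; rewrite ZE prE.
  by case: ifP => [/eqP->|_]; rewrite ?prE // linear0 if_same.
have Sc : (exists N, forall M, (N <= M)%N -> 0 = \sum_(n < M) pr n 0) /\
    forall (a : k) x y, (exists N, forall M, (N <= M)%N -> x = \sum_(n < M) pr n x) ->
    (exists N, forall M, (N <= M)%N -> y = \sum_(n < M) pr n y) ->
    exists N, forall M, (N <= M)%N -> a *: x + y = \sum_(n < M) pr n (a *: x + y).
  split; first by exists 0%N => M _; rewrite big1 // => i _; rewrite linear0.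
  move=> a x y [N NP] [N' NP']; exists (maxn N N') => M; rewrite geq_max => /andP[h h'].
  rewrite {1}(NP M h) {1}(NP' M h') scaler_sumr -big_split.
  by apply: eq_bigr => i _; rewrite /= linearP.
apply: (@word_span _ _ _ _ fw (Subspace Sc)) => s /=.
exists (deg s).+1 => M sM; rewrite (bigD1 (Ordinal sM)) //= prE eqxx.
by rewrite big1 ?addr0 // => n /negbTE ns; rewrite prE -[_ == _]/(n == Ordinal sM) ns.
Qed.

Definition lenp : nat -> {linear T -> T} := projT1 (cid (word_wd (@size X))).

Lemma lenp_dec : wdecomp lenp. Proof. exact: (projT2 (cid (word_wd (@size X)))).1. Qed.

Lemma lenpE n s : lenp n (word s) = if n == size s then word s else 0.
Proof. exact: (projT2 (cid (word_wd (@size X)))).2. Qed.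

Lemma Vn_word s : Vn (size s) (word s).
Proof.
elim: s => [|x s IHs]; first by rewrite (word_nil fw); apply: onesp1.
by rewrite -cat1s (wordM fw); apply: mulspI => //; apply: span_sub; exists x.
Qed.

Lemma Vn_span n S : (forall s, size s = n -> S (word s)) -> forall x, Vn n x -> S x.
Proof.
elim: n S => [|n IHn] S Sw.
  by move=> x /onespP[a ->]; apply: spZ; rewrite -(word_nil fw); apply: Sw.
apply: mulsp_ind => v y Vv; have [f fE] := linear_pack (mulr_linear fw v).
rewrite -[_ * _]fE; apply: (IHn (presp f S)) => s sn /=; rewrite fE.
have [g gE] := linear_pack (mull_linear (word s)).
rewrite -[_ * _]gE; apply: (@span_min _ _ _ (presp g S)) Vv => _ [x ->] /=; rewrite gE.
by rewrite -(wordM fw); apply: Sw; rewrite /= sn.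
Qed.

Lemma VnP n x : Vn n x <-> lenp n x = x.
Proof.
split=> [|<-].
  apply: (@Vn_span _ (equalizer (lenp n) idfun)) => s <- /=.
  by rewrite lenpE eqxx.
apply: (@word_span _ _ _ _ fw (presp (lenp n) (Vn n))) => s /=; rewrite lenpE.
by case: eqP => [->|_]; [apply: Vn_word|apply: sp0].
Qed.

Lemma VnM m n x y : Vn m x -> Vn n y -> Vn (m + n) (x * y).
Proof. by move=> Vx Vy; rewrite (powsp_add fw); apply: mulspI. Qed.

Lemma TgeP m x : wordge m x <-> forall n, (n < m)%N -> lenp n x = 0.
Proof.
split=> [+ n nm|x0].
  apply: (@span_min _ _ _ (kersp (lenp n))) => y [i mi /VnP <-] /=.
  by apply: (wd_neq lenp_dec); apply: contraTneq (leq_trans nm mi) => ->; rewrite ltnn.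
apply: (wd_span lenp_dec) => n; case: (ltnP n m) => [/x0 ->|mn]; first exact: sp0.
by apply: span_sub; exists n => //; apply/VnP/(wd_id lenp_dec).
Qed.

Lemma Tge_word s m : (m <= size s)%N -> wordge m (word s).
Proof. by move=> ms; apply: span_sub; exists (size s) => //; apply: Vn_word. Qed.

Lemma Tge_span m S : (forall s, (m <= size s)%N -> S (word s)) ->
  forall x, wordge m x -> S x.
Proof.
move=> Sw; apply: span_min => y [n mn]; apply: (Vn_span (S := S)) => s sn.
by apply: Sw; rewrite sn.
Qed.

Lemma Tge_mul m n x y : wordge m x -> wordge n y -> wordge (m + n) (x * y).
Proof.
move=> Tx Ty; have [f fE] := linear_pack (mull_linear y).
rewrite -[_ * _]fE; apply: (Tge_span (S := presp f (wordge (m + n)))) Tx => s ms /=.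
rewrite fE; have [g gE] := linear_pack (mulr_linear fw (word s)).
rewrite -[_ * _]gE; apply: (Tge_span (S := presp g (wordge (m + n)))) Ty => t nt /=.
by rewrite gE -(wordM fw); apply: Tge_word; rewrite size_cat leq_add.
Qed.

Lemma Tge0 x : wordge 0 x. Proof. exact/TgeP. Qed.

Lemma Vn_Tge n x : Vn n x -> wordge n x.
Proof. by move=> Vx; apply: span_sub; exists n. Qed.

Lemma V_Tp v : V v -> Tp v.
Proof. by move=> Vv; apply: Vn_Tge; rewrite (powsp1 fw). Qed.

Lemma Tp_split x : exists (a : k) y, Tp y /\ x = a%:A + y.
Proof.
have /onespP[a xa] : Vn 0 (lenp 0 x) by apply/VnP/(wd_id lenp_dec).
exists a, (x - a%:A); rewrite addrCA subrr addr0; split=> //.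
by apply/TgeP => -[] // _; rewrite linearB -xa (wd_id lenp_dec) subrr.
Qed.

(** Cutting a word after its first [l] and before its last [m] letters identifies
    [V^l (x) T (x) V^m] with a subspace of [T], so a trilinear map on it extends to [T]. Taking
    [l = 0] or [m = 0] cuts on one side only. *)
Lemma mid_lift (Z : lmodType k) (b : T -> T -> T -> Z) l m :
  (forall y z, linear (fun x => b x y z)) -> (forall x z, linear (fun y => b x y z)) ->
  (forall x y, linear (b x y)) ->
  exists F : {linear T -> Z}, forall x y z : T, Vn l x -> Vn m z -> F (x * y * z) = b x y z.
Proof.
move=> b1 b2 b3.
(* Words shorter than [l + m] receive a meaningless value; none occurs in a product [x * y * z] with
   outer lengths [l] and [m]. *)
pose h w : Z := b (word (take l w))
  (word (drop l (take (size w - m) w))) (word (drop (size w - m) w)).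
have [F FE] := word_lift fw h; exists F => x y z Vx Vz.
have [fx fxE] := linear_pack (mull_linear z).
have [bz bzE] := linear_pack (b3 x y).
have [xy xyE] := linear_pack (mulr_linear fw (x * y)).
have -> : x * y * z = xy z by rewrite xyE.
rewrite -bzE; apply: (@Vn_span m (equalizer (F \o xy) bz)) Vz => u um /=.
rewrite xyE bzE {xy xyE bz bzE fx fxE z}.
have [by_ byE] := linear_pack (b2 x (word u)).
have [f fE] := linear_pack (mull_linear (word u)).
have [g gE] := linear_pack (mulr_linear fw x).
rewrite -byE -[_ * word u]fE -[x * y]gE; apply: (@word_span _ _ _ _ fw (equalizer (F \o (f \o g)) by_)).
move=> t /=; rewrite gE fE byE {f fE g gE by_ byE y}.
have [bx bxE] := linear_pack (b1 (word t) (word u)).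
have [f fE] := linear_pack (mull_linear (word t)).
have [g gE] := linear_pack (mull_linear (word u)).
rewrite -bxE -[_ * word u]gE -[x * _]fE.
apply: (@Vn_span l (equalizer (F \o (g \o f)) bx)) Vx => s sl /=.
rewrite fE gE bxE -!(wordM fw) FE /h /= size_cat size_cat um addnK -size_cat.
by rewrite (take_size_cat _ (erefl (size (s ++ t)))) !drop_size_cat // -catA take_size_cat.
Qed.

(** Injectivity of [T (x) C -> T], recorded as a linear left inverse so that maps on [T C] can be
    defined on [T (x) C]. *)
Definition lfree C : Prop := exists lam : {linear T -> tens T (subsp C)},
  forall (t : T) (c : subsp C), lam (t * inc c) = tpair t c.

Definition rfree C : Prop := exists rho : {linear T -> tens (subsp C) T},
  forall (c : subsp C) (t : T), rho (inc c * t) = tpair c t.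

(** [C] is a minimal space of generators of the left ideal [T C]. This is the condition that can be
    checked directly; freeness follows by [lmin_lfree]. *)
Definition lmin C : Prop := forall x, C x -> mulsp Tp C x -> x = 0.

Lemma wd_tensl (U W : lmodType k) (pr : nat -> {linear U -> U}) : wdecomp pr ->
  exists prt : nat -> {linear tens U W -> tens U W},
    wdecomp prt /\ forall n u w, prt n (tpair u w) = tpair (pr n u) w.
Proof.
move=> dec; pose prW (n : nat) : {linear W -> W} := if n is 0%N then idfun else \0.
have dW : wdecomp prW.
  split; first by case=> [|m] [|n] x //=; rewrite if_same.
  by move=> x; exists 1%N => -[] // M _; rewrite big_ord_recl /= big1 ?addr0.
have [prt [dt prtE]] := wd_tens (free_tensor_tens U W) dec dW; exists prt; split=> // n u w.
have [N uN] := wd_sum dec u; rewrite {1}uN (lin_sum (tpairl_linear _)) linear_sum.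
transitivity (\sum_(i < N) if nat_of_ord i == n then tpair (pr n u) w else 0).
  apply: eq_bigr => i _; rewrite -[w in LHS]/(prW 0%N w) prtE addn0 eq_sym.
  by case: eqP => [->|].
rewrite -big_mkcond /=; have [nN|Nn] := ltnP n N.
  by rewrite (big_pred1 (Ordinal nN)).
rewrite big_pred0 => [|i]; last by apply/eqP => iN; move: Nn; rewrite -iN leqNgt ltn_ord.
rewrite {1}uN linear_sum big1 ?(lin0 (tpairl_linear _)) // => i _.
apply: (wd_neq dec); apply: contraTneq Nn => ->.
by rewrite -ltnNge.
Qed.

(* [kap j] inverts multiplication on words [t] of length [j] and kills longer
   ones, so multiplication [T (x) C -> T] is injective by triangularity. *)
Lemma lmin_lfree C : lmin C -> lfree C.
Proof.
move=> minC; have [P0 [P0C P0T]] := separation minC.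
have [g gK] := retraction C; pose P : {linear T -> subsp C} := g \o P0.
have PC (c : subsp C) : P (inc c) = c by rewrite /P /= P0C ?gK //; apply: incP.
have PT x : mulsp Tp C x -> P x = 0 by move=> /P0T Px; rewrite /P /= Px linear0.
have /choice[kap kapE] j : exists F : {linear T -> tens T (subsp C)},
    forall x y z : T, Vn j x -> Vn 0 z -> F (x * y * z) = tpair x (P (y * z)).
  apply: mid_lift => [y z|x z|x y]; first exact: tpairl_linear.
    move=> a y y'; rewrite free_mullP (linearP P); exact: tpairr_linear.
  move=> a z z'; rewrite (free_mulrP fw) (linearP P); exact: tpairr_linear.
have [mu muE] : exists mu : {linear tens T (subsp C) -> T},
    forall t c, mu (tpair t c) = t * inc c.
  apply: tens_lift => [c|t]; first exact: mull_linear.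
  by move=> a c c'; rewrite (linearP (@inc _ _ C)); apply: (mulr_linear fw).
have [len1 [dl len1E]] := @wd_tensl _ (subsp C) _ lenp_dec.
have klin i j : linear (fun x => kap j (mu (len1 i x))) by move=> a x y; rewrite !linearP.
have kap_diag j x : kap j (mu (len1 j x)) = len1 j x.
  apply: (tens_eqf (klin j j) (linearP (len1 j))) => t c.
  rewrite len1E muE -[_ * inc c]mulr1 kapE ?mulr1 ?PC //; last exact: onesp1.
  exact/VnP/(wd_id lenp_dec).
have kap_gt i j x : (j < i)%N -> kap j (mu (len1 i x)) = 0.
  move=> ji; apply: (tens_eqf (klin i j) (linearP \0)) => t c; rewrite len1E muE.
  have [f fE] := linear_pack (mull_linear (inc c)); rewrite -fE.
  have Vt : Vn i (lenp i t) by apply/VnP/(wd_id lenp_dec).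
  apply: (@Vn_span i (kersp (kap j \o f))) Vt => s si /=; rewrite fE.
  (* After the first [j] letters at least one letter is left in front of [c], and [P] kills
     [T_+ C]. *)
  rewrite -(cat_take_drop j s) (wordM fw) -mulrA -[_ * _]mulr1 kapE ?mulr1.
  - rewrite PT ?(lin0 (tpairr_linear _)) //; apply: mulspI; last exact: incP.
    by apply: Tge_word; rewrite size_drop si subn_gt0.
  - by have := Vn_word (take j s); rewrite size_take si ji.
  - exact: onesp1.
have mu_inj x : mu x = 0 -> x = 0.
  move=> mux; apply: (wd_ext dl) => j; rewrite (linear0 (len1 j)).
  (* Strong induction on the length [j]: the lower components are 0 already and [kap j] kills the
     higher ones, so [kap j (mu x)] is the component of length [j]. *)
  have [n] := ubnP j; elim: n j => // n IHn j jn.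
  have [N xN] := dl.2 x; have jM : (j < maxn N j.+1)%N by rewrite leq_maxr.
  have := linear0 (kap j); rewrite -mux {1}(xN (maxn N j.+1)) ?leq_maxl // !linear_sum.
  rewrite (bigD1 (Ordinal jM)) //= kap_diag big1 ?addr0 // => i ij.
  case: (ltngtP i j) => [ij'|ji|ij']; last by rewrite -val_eqE /= ij' eqxx in ij.
    by rewrite IHn ?linear0 // (leq_trans ij').
  exact: kap_gt.
have [lam lamE] := linear_left_inverse mu_inj.
by exists lam => t c; rewrite -(muE t c) lamE.
Qed.

Lemma lfree_lift C (Z : lmodType k) (b : T -> subsp C -> Z) : lfree C ->
  (forall c, linear (b^~ c)) -> (forall t, linear (b t)) ->
  exists F : {linear T -> Z}, forall (t : T) (c : subsp C), F (t * inc c) = b t c.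
Proof.
move=> [lam lamE] bl br; have [F FE] := tens_lift bl br.
by exists (F \o lam) => t c; rewrite /= lamE FE.
Qed.

(** By freeness of [B] the map [P (x) id] is well defined on [T B]. With [P] fixing [U] and killing
    [U'], it fixes [U B] and kills [U' B]. *)
Lemma cap_mulsp0 U U' B : lfree B -> (forall x, U x -> U' x -> x = 0) ->
  forall x, mulsp U B x -> mulsp U' B x -> x = 0.
Proof.
move=> lB UU'; have [P [PU PU']] := separation UU'.
have [||F FE] := @lfree_lift B T (fun t b => P t * inc b) lB.
- move=> c a t t'; rewrite (linearP P); exact: mull_linear.
- by move=> t a c c'; rewrite (linearP (@inc _ _ B)); apply: (mulr_linear fw).
move=> x xU xU'; have <- : F x = x.
  move: x xU {xU'}; apply: (@mulsp_ind _ _ _ _ (equalizer F idfun)) => u b Uu Bb /=.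
  by rewrite -(incK Bb) FE PU.
move: x xU' {xU}; apply: (@mulsp_ind _ _ _ _ (kersp F)) => u b Uu Bb /=.
by rewrite -(incK Bb) FE PU' // mul0r.
Qed.

(** The same argument in the second factor: [id (x) p], for a retraction [p] onto [B'], fixes [T B']
    and sends [U B] into [U B']. *)
Lemma cap_mulsp_sub U B B' : lfree B -> (forall x, B' x -> B x) ->
  forall x, mulsp U B x -> mulsp (fullsp T) B' x -> mulsp U B' x.
Proof.
move=> lB B'B; have [p pK] := retraction B'.
have [||F FE] := @lfree_lift B T (fun t b => t * inc (p (inc b))) lB.
- by move=> c; apply: mull_linear.
- move=> t a c c'; rewrite (linearP (@inc _ _ B)) (linearP p) (linearP (@inc _ _ B')).
  exact: (mulr_linear fw).
move=> x xU xB'; have <- : F x = x.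
  move: x xB' {xU}; apply: (@mulsp_ind _ _ _ _ (equalizer F idfun)) => u b _ Bb /=.
  by rewrite -(incK (B'B _ Bb)) FE incK (retract_id pK).
move: x xU {xB'}; apply: mulsp_indf => u b Uu Bb.
by rewrite -(incK Bb) FE; apply: mulspI => //; apply: incP.
Qed.

(** The last letter is split off, and the projection that separates [C] from [T_+ C] acts on what
    precedes it. *)
Lemma lmin_mulV C : lmin C -> lmin (mulsp C V).
Proof.
move=> minC; have [P [PC PT]] := separation minC.
have [|||F FE] := @mid_lift T (fun x y z => P (x * y) * z) 0 1.
- by move=> y z a x x'; rewrite free_mullP (linearP P); apply: mull_linear.
- by move=> x z a y y'; rewrite (free_mulrP fw) (linearP P); apply: mull_linear.
- by move=> x y; apply: (mulr_linear fw).
have {}FE y v : V v -> F (y * v) = P y * v.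
  by move=> Vv; rewrite -[y * v]mul1r mulrA FE ?mul1r ?(powsp1 fw) //; apply: onesp1.
move=> x xC xT; have <- : F x = x.
  move: x xC {xT}; apply: (@mulsp_ind _ _ _ _ (equalizer F idfun)) => c v Cc Vv /=.
  by rewrite FE // PC.
rewrite -(mulspA fw) in xT.
move: x xT {xC}; apply: (@mulsp_ind _ _ _ _ (kersp F)) => c v Cc Vv /=.
by rewrite FE // PT // mul0r.
Qed.

End FreeAlgebra.

(** * The spaces of a Koszul family *)

Lemma parityP i : (exists j, i = j.*2) \/ (exists j, i = j.*2.+1).
Proof.
by rewrite -(odd_double_half i); case: (odd i); [right|left]; exists i./2.
Qed.

Section KoszulSpaces.
Variables (k : fieldType) (T : lalgType k) (X : Type) (word : seq X -> T).
Hypothesis fw : free_words word.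
Notation V := (letters word).
Notation Tp := (wordge word 1).
Notation full := (fullsp T).

(** The consequences of the definition of the [J_i] from which the differential and its minimality
    are derived. They are invariant under reversal of words, so right-handed facts come from
    left-handed ones. In [ks_even] one and the same piece [wN N] is decomposed for every [l]. *)
Record koszul_spaces (R : subspace T) (J : nat -> subspace T) := KoszulSpaces {
  ks_0 : J 0%N = onesp T;
  ks_pow : forall j x, J j.*2 x -> powsp R j x;
  ks_odd : forall j, J j.*2.+1 = capsp (mulsp V (J j.*2)) (mulsp (J j.*2) V);
  ks_even : forall j w, J j.+1.*2 w -> exists M (wN : nat -> T),
    w = \sum_(N < M) wN N /\ forall N l, (l <= N)%N ->
      mulsp (mulsp (powsp V l) (J j.*2.+1)) (powsp V (N - l)) (wN N);
  ks_ge2 : forall x, R x -> wordge word 2 x;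
  ks_min : forall x, R x ->
    sumsp (mulsp (mulsp Tp R) full) (mulsp (mulsp full R) Tp) x -> x = 0 }.

(** [T_+ (U B)] is [(T_+ U) B], so the intersection with [U B] is computed in the first factor. *)
Lemma lmin_mul (U B : subspace T) : lmin word U -> lfree B -> lmin word (mulsp U B).
Proof.
move=> mU lB x xUB xT; rewrite -(mulspA fw) in xT.
exact: (cap_mulsp0 fw lB mU xUB xT).
Qed.

Lemma lmin_sub (C C' : subspace T) : (forall x, C' x -> C x) -> lmin word C -> lmin word C'.
Proof. by move=> CC mC x /CC Cx xT; apply: mC => //; apply: mulspS xT. Qed.

Lemma lmin_onesp : lmin word (onesp T).
Proof.
move=> x x1; rewrite (mulsp1 fw) => /(TgeP fw)/(_ 0%N isT) <-.
by apply/esym/(VnP fw 0 x).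
Qed.

Lemma lmin_letters : lmin word V.
Proof.
move=> x Vx xT.
have /(TgeP fw)/(_ 1%N isT) : wordge word 2 x.
  move: x xT {Vx}; apply: mulsp_ind => t v Tt Vv.
  by apply: (Tge_mul fw (m := 1) (n := 1)) => //; apply: V_Tp.
by have /(VnP fw) -> : powsp V 1 x by rewrite (powsp1 fw).
Qed.

Section Facts.
Variables (R : subspace T) (J : nat -> subspace T).
Hypothesis ks : koszul_spaces R J.
Notation I := (mulsp (mulsp full R) full).

Lemma mulsp_fullr (U : subspace T) x : U x -> mulsp U full x.
Proof. by move=> Ux; rewrite -[x]mulr1; apply: mulspI. Qed.

Lemma lmin_rel : lmin word R.
Proof.
move=> x Rx xT; apply: (ks_min ks) => //; rewrite -[x]addr0; apply: sumspI; last exact: sp0.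
exact: mulsp_fullr.
Qed.

(** A minimal space times a free one is minimal, and minimality passes to subspaces. As [J_{2j}]
    lies in [R^(j)] and [J_{2j+1}] in [V J_{2j}], this leads to the freeness of all [J_i]. *)
Lemma lmin_pow j : lmin word (powsp R j).
Proof.
elim: j => [|j IHj]; first exact: lmin_onesp.
exact/(lmin_mul lmin_rel)/(lmin_lfree fw).
Qed.

Lemma lmin_Jeven j : lmin word (J j.*2).
Proof. by apply: (@lmin_sub (powsp R j)) => [x|]; [apply: (ks_pow ks)|apply: lmin_pow]. Qed.

Lemma J_oddP j x : J j.*2.+1 x <-> mulsp V (J j.*2) x /\ mulsp (J j.*2) V x.
Proof. by rewrite (ks_odd ks) capspE. Qed.

Lemma lmin_J i : lmin word (J i).
Proof.
have [[j ->]|[j ->]] := parityP i; first exact: lmin_Jeven.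
apply: (@lmin_sub (mulsp V (J j.*2))) => [x /J_oddP[]//|].
exact/(lmin_mul lmin_letters)/(lmin_lfree fw)/lmin_Jeven.
Qed.

Lemma lfree_J i : lfree (J i). Proof. exact/(lmin_lfree fw)/lmin_J. Qed.

Lemma lfree_JV j : lfree (mulsp (J j.*2) V).
Proof. exact/(lmin_lfree fw)/(lmin_mulV fw)/lmin_J. Qed.

Lemma mulsp_powl n (U : subspace T) x : mulsp (powsp V n) U x -> mulsp full U x.
Proof. exact: mulspS. Qed.

Lemma Jeven_sub j x : J j.+1.*2 x -> mulsp full (J j.*2.+1) x.
Proof.
move=> /(ks_even ks)[M [wN [-> wP]]]; apply: sp_sum => N _.
by have := wP N N (leqnn N); rewrite subnn (mulsp1 fw); apply: mulsp_powl.
Qed.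

Lemma mulsp_fullA (U : subspace T) x : mulsp full (mulsp full U) x -> mulsp full U x.
Proof. by rewrite -(mulspA fw); apply: mulspS. Qed.

(** Even case: [R R^(j)] and [T J_{2j}] meet in [R J_{2j}], because [R^(j)] is free and contains
    [J_{2j}]. Odd case: the same with [J_{2j} V] as the free space, which contains [J_{2j+1}], after
    the even case has been applied inside [J_{2j+2} V]. *)
Lemma J_step i x : J i.+2 x -> mulsp R (J i) x.
Proof.
have [[j ->]|[j ->]] := parityP i => Jx.
  apply: (cap_mulsp_sub fw (B := powsp R j)); first exact/(lmin_lfree fw)/lmin_pow.
  - exact: ks_pow.
  - exact: (ks_pow ks (j := j.+1)).
  - apply/mulsp_fullA/(@mulspS _ _ full _ (J j.*2.+1)) => //; last exact: (Jeven_sub (j := j)).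
    by move=> y /J_oddP[+ _]; apply: mulspS.
have /J_oddP[xV xJ] : J j.+1.*2.+1 x by [].
apply: (cap_mulsp_sub fw (B := mulsp (J j.*2) V)); first exact: lfree_JV.
- by move=> y /J_oddP[].
- rewrite -(mulspA fw); move: x xJ {xV Jx}; apply: mulspS => // y Jy.
  apply: (cap_mulsp_sub fw (B := powsp R j)); first exact/(lmin_lfree fw)/lmin_pow.
  + exact: ks_pow.
  + exact: (ks_pow ks (j := j.+1)).
  + apply/mulsp_fullA/(@mulspS _ _ full _ (J j.*2.+1)) => //; last exact: (Jeven_sub (j := j)).
    by move=> z /J_oddP[+ _]; apply: mulspS.
- by apply/mulsp_fullA; move: x xV {xJ Jx}; apply: mulspS => // y /Jeven_sub.
Qed.

Lemma ideal_R x : R x -> I x.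
Proof. by move=> Rx; apply: mulsp_fullr; rewrite -[x]mul1r; apply: mulspI. Qed.

(** Since [w] lies in [R J_{2j}] and [J_{2j}] is free, the claim reduces to first factors: [R] meets
    [T_+ I + I V] in 0, by minimality of the relations. *)
Lemma min_even j w : J j.+1.*2 w ->
  sumsp (mulsp Tp (mulsp I (J j.*2))) (mulsp (mulsp I V) (J j.*2)) w -> w = 0.
Proof.
move=> Jw wS; apply: (cap_mulsp0 fw (B := J j.*2) (U' := sumsp (mulsp Tp I) (mulsp I V)))
  (J_step (i := j.*2) Jw) _.
- exact: lfree_J.
- move=> r Rr rS; apply: (ks_min ks) => //; apply: sumspS rS => x.
    have -> : mulsp Tp I = mulsp (mulsp (mulsp Tp full) R) full by rewrite !(mulspA fw).
    move=> H; apply: mulspS H => // y H; apply: mulspS H => // z.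
    by apply: mulsp_ind => s t Ts _; apply: (Tge_mul fw (m := 1) (n := 0)) (Tge0 fw t).
  rewrite (mulspA fw (mulsp full R)) => H; apply: mulspS H => // y.
  by apply: mulsp_ind => s t _ Vt; apply: (Tge_mul fw (m := 0)) (V_Tp fw Vt); apply: Tge0.
- by apply/mulspDl; rewrite (mulspA fw Tp).
Qed.

Lemma ideal_ge2 x : I x -> wordge word 2 x.
Proof.
apply: mulsp_ind => y t yR _; apply: (Tge_mul fw (m := 2) (n := 0)) (Tge0 fw t).
move: y yR; apply: mulsp_ind => s r _ Rr.
exact: (Tge_mul fw (Tge0 fw s) (ks_ge2 ks Rr)).
Qed.

(** The first factors to be compared are [V] and the elements of length at least 2, which include
    both [T_+ T_+] and the ideal. *)
Lemma min_odd j w : J j.*2.+1 w ->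
  sumsp (mulsp Tp (mulsp Tp (J j.*2))) (mulsp I (J j.*2)) w -> w = 0.
Proof.
move=> /J_oddP[wV _] wS; apply: (cap_mulsp0 fw (B := J j.*2) (U' := wordge word 2)) wV _.
- exact: lfree_J.
- move=> v Vv /(TgeP fw)/(_ 1%N isT).
  by have /(VnP fw) -> : powsp V 1 v by rewrite (powsp1 fw).
- move: wS; rewrite -(mulspA fw) => /mulspDl; apply: mulspS => // y /sumspP[u [i [uT Ii ->]]].
  apply: spD; last exact: ideal_ge2.
  by apply: mulsp_ind uT => s t; apply: (Tge_mul fw (m := 1)).
Qed.

End Facts.

Implicit Types U W C : subspace T.

(** Reversal of words, the anti-automorphism that exchanges left-handed and right-handed
    statements. *)
Definition wrev : {linear T -> T} :=
  projT1 (cid (word_lift fw (fun s => word (rev s) : T))).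

Lemma wrev_word s : wrev (word s) = word (rev s).
Proof. exact: (projT2 (cid (word_lift fw (fun s => word (rev s) : T)))). Qed.

Lemma wrevK x : wrev (wrev x) = x.
Proof.
rewrite -[LHS]/((wrev \o wrev) x) -[RHS]/(idfun x).
by apply: (@word_span _ _ _ _ fw (equalizer (wrev \o wrev) idfun)) => s /=; rewrite !wrev_word revK.
Qed.

Lemma wrevM x y : wrev (x * y) = wrev y * wrev x.
Proof.
have [f fE] := linear_pack (mull_linear y).
have [g gE] := linear_pack (mulr_linear fw (wrev y)).
rewrite -[x * y]fE -gE; move: x.
apply: (@word_span _ _ _ _ fw (equalizer (wrev \o f) (g \o wrev))) => s /=.
rewrite fE gE {f fE g gE}.
have [f fE] := linear_pack (mulr_linear fw (word s)).
have [g gE] := linear_pack (mull_linear (wrev (word s))).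
rewrite -[_ * y]fE -gE; move: y.
apply: (@word_span _ _ _ _ fw (equalizer (wrev \o f) (g \o wrev))) => t /=.
by rewrite fE gE -(wordM fw) !wrev_word rev_cat (wordM fw).
Qed.

Definition revsp (U : subspace T) := presp wrev U.

Lemma revspE U x : revsp U x <-> U (wrev x). Proof. by []. Qed.

Lemma revspK U : revsp (revsp U) = U.
Proof. by apply: subspace_eq => x; rewrite /= wrevK. Qed.

Lemma revsp_sub U W : (forall x, U x -> W x) -> forall x, revsp U x -> revsp W x.
Proof. by move=> UW x; apply: UW. Qed.

Lemma revsp_mul U W : revsp (mulsp U W) = mulsp (revsp W) (revsp U).
Proof.
have sub A B x : mulsp A B (wrev x) -> mulsp (revsp B) (revsp A) x.
  rewrite -{2}(wrevK x); apply: mulsp_indf => a b Aa Bb.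
  by rewrite wrevM; apply: mulspI; rewrite /= wrevK.
apply: subspace_eq => x; split; first exact: sub.
move=> xWU; rewrite revspE; rewrite -(revspK U) -(revspK W); apply: sub.
by rewrite wrevK.
Qed.

Lemma revsp_one : revsp (onesp T) = onesp T.
Proof.
have w1 : wrev 1 = 1 by rewrite -(word_nil fw) wrev_word.
apply: subspace_eq => x; split=> /onespP[a xa]; apply/onespP; exists a.
  by rewrite -(wrevK x) xa linearZ w1.
by rewrite xa linearZ w1.
Qed.

Lemma revsp_letters : revsp V = V.
Proof.
have sub x : V (wrev x) -> V x.
  rewrite -{2}(wrevK x); apply: (@span_min _ _ _ (presp wrev V)) => _ [y ->] /=.
  by rewrite wrev_word; apply: span_sub; exists y.
by apply: subspace_eq => x; split=> Vx; apply: sub; rewrite ?wrevK.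
Qed.

Lemma revsp_pow U n : revsp (powsp U n) = powsp (revsp U) n.
Proof.
elim: n => [|n IHn]; first exact: revsp_one.
by rewrite (powspSr fw) /= revsp_mul IHn.
Qed.

Lemma lenp_wrev n x : lenp fw n (wrev x) = wrev (lenp fw n x).
Proof.
rewrite -[LHS]/((lenp fw n \o wrev) x) -[RHS]/((wrev \o lenp fw n) x); move: x.
apply: (@word_span _ _ _ _ fw (equalizer _ _)) => s /=.
by rewrite wrev_word !lenpE size_rev; case: eqP; rewrite ?wrev_word ?linear0.
Qed.

Lemma revsp_ge n : revsp (wordge word n) = wordge word n.
Proof.
apply: subspace_eq => x; split=> /(TgeP fw) H; apply/(TgeP fw) => m mn.
  by rewrite -(wrevK x) lenp_wrev H ?linear0.
by rewrite lenp_wrev H ?linear0.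
Qed.

Lemma revsp_full : revsp full = full. Proof. exact: subspace_eq. Qed.

Lemma koszul_spaces_rev R J : koszul_spaces R J -> koszul_spaces (revsp R) (revsp \o J).
Proof.
move=> ks; split.
- by rewrite /= (ks_0 ks) revsp_one.
- by move=> j x; rewrite -revsp_pow; apply: revsp_sub => y; apply: (ks_pow ks).
- move=> j /=; rewrite (ks_odd ks); apply: subspace_eq => x.
  rewrite revspE !capspE -!revspE !revsp_mul revsp_letters; tauto.
- move=> j w /(ks_even ks)[M [wN [wE wP]]]; exists M, (fun N => wrev (wN N)); split.
    by rewrite -(wrevK w) wE linear_sum.
  move=> N l lN; have := wP N (N - l)%N (leq_subr l N); rewrite subKn // => H.
  have : revsp (mulsp (mulsp (powsp V (N - l)) (J j.*2.+1)) (powsp V l)) (wrev (wN N)).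
    by rewrite revspE wrevK.
  by rewrite !revsp_mul !revsp_pow revsp_letters (mulspA fw).
- by move=> x /(ks_ge2 ks); rewrite -revspE revsp_ge.
- move=> x Rx xS; rewrite -(wrevK x) (ks_min ks Rx) ?linear0 //.
  move: xS => /sumspP[u [w [Hu Hw ->]]]; rewrite linearD addrC; apply: sumspI.
    by rewrite -revspE !revsp_mul revsp_ge revsp_full -(mulspA fw).
  by rewrite -revspE !revsp_mul revsp_ge revsp_full -(mulspA fw).
Qed.

Lemma lfree_rfree C : lfree (revsp C) -> rfree C.
Proof.
move=> [lam lamE]; have [g gK] := retraction C.
have [||G GE] := @tens_lift _ T (subsp (revsp C)) (tens (subsp C) T)
    (fun t c => tpair (g (wrev (inc c))) (wrev t)).
- by move=> c a t t'; rewrite (linearP wrev); apply: tpairr_linear.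
- move=> t a c c'; rewrite (linearP (@inc _ _ (revsp C))) (linearP wrev) (linearP g).
  exact: tpairl_linear.
exists (G \o lam \o wrev) => c t /=; rewrite wrevM.
have Cc : revsp C (wrev (inc c)) by rewrite revspE wrevK; apply: incP.
by rewrite -[X in wrev t * X](incK Cc) lamE GE incK !wrevK gK.
Qed.

End KoszulSpaces.

(** * Free bimodules *)

Section BimoduleExists.
Variables (k : fieldType) (A : algType k).

(* [bt a w b] is the tensor [a (x) w (x) b] of the free bimodule [A (x) W (x) A]. *)
Record free_bimodule (W B : lmodType k) (bt : A -> W -> A -> B) := FreeBimodule {
  bt_linl : forall w b, linear (fun a => bt a w b);
  bt_linm : forall a b, linear (fun w => bt a w b);
  bt_linr : forall a w, linear (bt a w);
  bim_span : forall S : subspace B, (forall a w b, S (bt a w b)) -> forall x, S x;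
  bim_lift : forall (Z : lmodType k) (b : A -> W -> A -> Z),
    (forall y z, linear (fun x => b x y z)) -> (forall x z, linear (fun y => b x y z)) ->
    (forall x y, linear (b x y)) ->
    exists F : {linear B -> Z}, forall x y z, F (bt x y z) = b x y z }.

Lemma free_bimodule_tens (W : lmodType k) :
  @free_bimodule W (tens (tens A W) A) (fun a w b => tpair (tpair a w) b).
Proof.
split.
- by move=> w b c a a'; rewrite tpairPl; apply: tpairPl.
- by move=> a b c w w'; rewrite tpairPr; apply: tpairPl.
- by move=> a w c b b'; apply: tpairPr.
- move=> S Sb; apply: tens_span => y b.
  have [f fE] := linear_pack (tpairl_linear (U := tens A W) b).
  by rewrite -fE; apply: (@tens_span _ _ _ (presp f S)) => a w /=; rewrite fE.
- move=> Z b b1 b2 b3.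
  have /choice[G GE] z : exists G : {linear tens A W -> Z},
      forall x y, G (tpair x y) = b x y z.
    exact: (tens_lift (b := fun x y => b x y z)).
  have [||F FE] := @tens_lift _ (tens A W) A Z (fun y z => G z y).
  + by move=> z; apply: linearP.
  + move=> y c z z'; have lr := lin_comb c (linearP (G z)) (linearP (G z')).
    apply: (tens_eqf (linearP (G (c *: z + z'))) lr) => x w.
    by rewrite !GE b3.
  by exists F => x y z; rewrite FE GE.
Qed.

End BimoduleExists.

Section Bimodule.
Variables (k : fieldType) (A : algType k) (W : lmodType k) (B : lmodType k).
Variable bt : A -> W -> A -> B.
Hypothesis fb : free_bimodule bt.

Lemma bim_eqf (Z : lmodType k) (f g : B -> Z) : linear f -> linear g ->
  (forall a w b, f (bt a w b) = g (bt a w b)) -> f =1 g.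
Proof.
move=> lf lg fg; have [F FE] := linear_pack lf; have [G GE] := linear_pack lg.
move=> x; rewrite -FE -GE; move: x; apply: (bim_span fb (S := equalizer F G)) => a w b /=.
by rewrite FE GE.
Qed.

Lemma lact_exists (a : A) : exists F : {linear B -> B},
  forall x w b, F (bt x w b) = bt (a * x) w b.
Proof.
apply: (bim_lift fb) => [w b c x x'|x b|x w]; last exact: (bt_linr fb).
  by rewrite mulrDr -scalerAr; apply: (bt_linl fb).
exact: (bt_linm fb).
Qed.

Lemma ract_exists (a : A) : exists F : {linear B -> B},
  forall x w b, F (bt x w b) = bt x w (b * a).
Proof.
apply: (bim_lift fb) => [w b|x b|x w c b b']; first exact: (bt_linl fb).
  exact: (bt_linm fb).
by rewrite mulrDl -scalerAl; apply: (bt_linr fb).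
Qed.

Definition lact a : {linear B -> B} := projT1 (cid (lact_exists a)).
Definition ract a : {linear B -> B} := projT1 (cid (ract_exists a)).

Lemma lactE a x (w : W) b : lact a (bt x w b) = bt (a * x) w b.
Proof. exact: (projT2 (cid (lact_exists a))). Qed.

Lemma ractE a x (w : W) b : ract a (bt x w b) = bt x w (b * a).
Proof. exact: (projT2 (cid (ract_exists a))). Qed.

Lemma lin_comp (U V Z : lmodType k) (f : {linear V -> Z}) (g : {linear U -> V}) :
  linear (fun x => f (g x)).
Proof. by move=> c x y; rewrite !linearP. Qed.

Lemma lact_ract a b x : lact a (ract b x) = ract b (lact a x).
Proof.
move: x; apply: bim_eqf; try exact: lin_comp.
by move=> x w z; rewrite !(ractE, lactE).
Qed.

Lemma lact_mul a b x : lact a (lact b x) = lact (a * b) x.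
Proof.
move: x; apply: bim_eqf; [exact: lin_comp|exact: linearP|].
by move=> x w z; rewrite !lactE mulrA.
Qed.

Lemma ract_mul a b x : ract a (ract b x) = ract (b * a) x.
Proof.
move: x; apply: bim_eqf; [exact: lin_comp|exact: linearP|].
by move=> x w z; rewrite !ractE mulrA.
Qed.

Lemma lact_linear x : linear (fun a => lact a x).
Proof.
move=> c a b; have l := lin_comb c (linearP (lact a)) (linearP (lact b)).
move: x; apply: (bim_eqf (linearP (lact (c *: a + b))) l) => x w z.
by rewrite !lactE mulrDl -scalerAl; apply: (bt_linl fb).
Qed.

Lemma ract_linear x : linear (fun a => ract a x).
Proof.
move=> c a b; have l := lin_comb c (linearP (ract a)) (linearP (ract b)).
move: x; apply: (bim_eqf (linearP (ract (c *: a + b))) l) => x w z.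
by rewrite !ractE mulrDr -scalerAr; apply: (bt_linr fb).
Qed.

Lemma lact1 x : lact 1 x = x.
Proof.
rewrite -[RHS]/(idfun x); move: x; apply: bim_eqf; try exact: linearP.
by move=> a w b; rewrite lactE mul1r.
Qed.

Lemma ract1 x : ract 1 x = x.
Proof.
rewrite -[RHS]/(idfun x); move: x; apply: bim_eqf; try exact: linearP.
by move=> a w b; rewrite ractE mulr1.
Qed.

Lemma bt_act a (w : W) b : bt a w b = lact a (ract b (bt 1 w 1)).
Proof. by rewrite ractE lactE mulr1 mul1r. Qed.

End Bimodule.

Section BimoduleMaps.
Variables (k : fieldType) (A : algType k) (W W' B B' : lmodType k).
Variables (bt : A -> W -> A -> B) (bt' : A -> W' -> A -> B').
Hypotheses (fb : free_bimodule bt) (fb' : free_bimodule bt').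

Definition bimodule_map (F : B -> B') : Prop :=
  (forall a x, F (lact fb a x) = lact fb' a (F x)) /\
  (forall a x, F (ract fb a x) = ract fb' a (F x)).

Lemma bimodule_extend (f : {linear W -> B'}) :
  exists F : {linear B -> B'}, bimodule_map F /\ forall w, F (bt 1 w 1) = f w.
Proof.
have [|||F FE] := bim_lift fb (b := fun a w b => lact fb' a (ract fb' b (f w))).
- by move=> w b; apply: lact_linear.
- by move=> a b c w w'; rewrite !linearP.
- by move=> a w c b b'; rewrite ract_linear linearP.
exists F; split; first split=> a.
- apply: (bim_eqf fb); try exact: lin_comp.
  by move=> x w b; rewrite lactE !FE lact_mul.
- apply: (bim_eqf fb); try exact: lin_comp.
  by move=> x w b; rewrite ractE !FE -lact_ract ract_mul.
- by move=> w; rewrite FE ract1 lact1.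
Qed.

End BimoduleMaps.

(** * The bimodule complex *)

Lemma lin_bigsum (k : fieldType) (V W : lmodType k) (I : Type) (r : seq I) (P : pred I)
    (F : I -> V -> W) :
  (forall i, linear (F i)) -> linear (fun x => \sum_(i <- r | P i) F i x).
Proof.
move=> lF a x y; rewrite scaler_sumr -big_split; apply: eq_bigr => i _ /=.
exact: lF.
Qed.

Lemma lin_sub (k : fieldType) (V W : lmodType k) (f g : V -> W) :
  linear f -> linear g -> linear (fun x => f x - g x).
Proof. by move=> lf lg a x y; rewrite lf lg opprD scalerBr addrACA. Qed.

(** The number of length pieces varies with the vector, so identities between such sums are stated
    for all large [M]; closure under linear combinations makes them provable on a spanning set. *)
Lemma eventually_closed (k : fieldType) (V W : lmodType k) (f g : nat -> V -> W) :
  (forall n, linear (f n)) -> (forall n, linear (g n)) ->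
  (exists N, forall M, (N <= M)%N -> f M 0 = g M 0) /\ forall (a : k) x y,
    (exists N, forall M, (N <= M)%N -> f M x = g M x) ->
    (exists N, forall M, (N <= M)%N -> f M y = g M y) ->
    exists N, forall M, (N <= M)%N -> f M (a *: x + y) = g M (a *: x + y).
Proof.
move=> lf lg; split; first by exists 0%N => M _; rewrite (lin0 (lf M)) (lin0 (lg M)).
move=> a x y [N NP] [N' NP']; exists (maxn N N') => M; rewrite geq_max => /andP[h h'].
by rewrite lf lg NP ?NP'.
Qed.

Section Differential.
Variables (k : fieldType) (T : lalgType k) (X : Type) (word : seq X -> T).
Hypothesis fw : free_words word.
Variables (R : subspace T) (J : nat -> subspace T).
Hypothesis ks : koszul_spaces word R J.
Variables (A : algType k) (pi : {linear T -> A}).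
Hypotheses (piM : forall x y, pi (x * y) = pi x * pi y) (pi1 : pi 1 = 1).
Notation V := (letters word).
Notation Vn := (powsp V).
Notation full := (fullsp T).
Notation I := (mulsp (mulsp full R) full).
Hypothesis pi_ker : forall t, pi t = 0 <-> I t.
Variables (B : nat -> lmodType k) (bt : forall i, A -> subsp (J i) -> A -> B i).
Hypothesis fb : forall i, free_bimodule (@bt i).
Notation trip l i m := (mulsp (mulsp (Vn l) (J i)) (Vn m)).

Lemma trip_indf l m (U : subspace T) (Z : lmodType k) (f : {linear T -> Z})
    (S : subspace Z) :
  (forall x c z, Vn l x -> U c -> Vn m z -> S (f (x * c * z))) ->
  forall y, mulsp (mulsp (Vn l) U) (Vn m) y -> S (f y).
Proof.
move=> H y; apply: mulsp_indf => t z + Vz.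
have [g gE] := linear_pack (mull_linear z); rewrite -gE.
rewrite -[f (g t)]/((f \o g) t); apply: mulsp_indf => x c Vx Uc /=.
by rewrite gE; apply: H.
Qed.

Lemma trip_eq l m (U : subspace T) (Z : lmodType k) (f g : T -> Z) :
  linear f -> linear g ->
  (forall x c z, Vn l x -> U c -> Vn m z -> f (x * c * z) = g (x * c * z)) ->
  forall y, mulsp (mulsp (Vn l) U) (Vn m) y -> f y = g y.
Proof.
move=> lf lg; have [F FE] := linear_pack lf; have [G GE] := linear_pack lg.
move=> H y yT; rewrite -FE -GE.
apply: (@trip_indf l m U _ idfun (equalizer F G)) yT => x c z Vx Uc Vz /=.
by rewrite FE GE H.
Qed.

Lemma mulsp_eq (U W : subspace T) (Z : lmodType k) (f g : T -> Z) :
  linear f -> linear g -> (forall u w, U u -> W w -> f (u * w) = g (u * w)) ->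
  forall y, mulsp U W y -> f y = g y.
Proof.
move=> lf lg; have [F FE] := linear_pack lf; have [G GE] := linear_pack lg.
move=> H y yT; rewrite -FE -GE.
apply: (@mulsp_ind _ _ U W (equalizer F G)) yT => u w Uu Ww /=.
by rewrite FE GE H.
Qed.

Lemma Phi_exists i l m : exists F : {linear T -> B i},
  forall x (c : subsp (J i)) z, Vn l x -> Vn m z -> F (x * inc c * z) = bt (pi x) c (pi z).
Proof.
have [g gK] := retraction (J i).
have [|||F FE] := @mid_lift _ _ _ _ fw _ (fun x y z => bt (pi x) (g y) (pi z)) l m.
- by move=> y z a x x'; rewrite linearP; apply: (bt_linl (fb i)).
- by move=> x z a y y'; rewrite linearP; apply: (bt_linm (fb i)).
- by move=> x y a z z'; rewrite linearP; apply: (bt_linr (fb i)).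
by exists F => x c z Vx Vz; rewrite FE // gK.
Qed.

(* On [V^l J_i V^m], [Phi i l m] applies [pi] to the two outer factors. *)
Definition Phi i l m : {linear T -> B i} := projT1 (cid (Phi_exists i l m)).

Lemma PhiE i l m x c z (Jc : J i c) : Vn l x -> Vn m z ->
  Phi i l m (x * c * z) = bt (pi x) (mksub Jc) (pi z).
Proof. by move=> Vx Vz; rewrite -{1}(incK Jc); apply: (projT2 (cid (Phi_exists i l m))). Qed.

Lemma Phi_lact i l m n y x : Vn n y -> trip l i m x ->
  Phi i (n + l) m (y * x) = lact (fb i) (pi y) (Phi i l m x).
Proof.
move=> Vy; move: x.
apply: trip_eq; [move=> a u v; rewrite (free_mulrP fw) linearP //|exact: lin_comp|].
move=> x c z Vx Jc Vz; rewrite (PhiE Jc Vx Vz) lactE -piM !mulrA.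
by rewrite (PhiE Jc) //; apply: (VnM fw).
Qed.

Lemma Phi_ract i l m n y x : Vn n y -> trip l i m x ->
  Phi i l (m + n) (x * y) = ract (fb i) (pi y) (Phi i l m x).
Proof.
move=> Vy; move: x.
apply: trip_eq; [move=> a u v; rewrite free_mullP linearP //|exact: lin_comp|].
move=> x c z Vx Jc Vz; rewrite (PhiE Jc Vx Vz) ractE -piM -mulrA.
by rewrite (PhiE Jc) //; apply: (VnM fw).
Qed.

(** Here [t c] goes to [pi t (x) c (x) 1] for [t] of any length. On [V^n J_i] this agrees with
    [Phi i n 0]; being one map for all [n], it can be applied to elements of [R J_i], whose first
    factors mix lengths. *)
Definition LK i : {linear T -> B i} := projT1 (cid (lfree_lift (lfree_J fw ks i)
  (fun c a x y => etrans (congr1 (fun u => bt u c 1) (linearP pi a x y))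
     (bt_linl (fb i) c 1 a (pi x) (pi y)))
  (fun t => bt_linm (fb i) (pi t) 1))).

Lemma LKE i t c (Jc : J i c) : LK i (t * c) = bt (pi t) (mksub Jc) 1.
Proof. by rewrite -{1}(incK Jc) /LK; case: cid. Qed.

Lemma LK_Phi i n x : mulsp (Vn n) (J i) x -> Phi i n 0 x = LK i x.
Proof.
move: x; apply: mulsp_eq; try exact: linearP.
move=> t c Vt Jc; rewrite -[t * c]mulr1 PhiE //; last exact: onesp1.
by rewrite mulr1 LKE pi1.
Qed.

Lemma pi_rel x : R x -> pi x = 0.
Proof. by move=> /(ideal_R (R := R)) /pi_ker. Qed.

Lemma LK_rel i x : mulsp R (J i) x -> LK i x = 0.
Proof.
move: x; apply: (@mulsp_eq _ _ _ _ \0); try exact: linearP.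
by move=> t c Rt Jc; rewrite LKE pi_rel // (lin0 (bt_linl (fb i) _ _)).
Qed.

Lemma rfree_J i : rfree (J i).
Proof.
exact/(lfree_rfree (fw := fw))/(lfree_J fw (koszul_spaces_rev fw ks)).
Qed.

Lemma J_step_r i x : J i.+2 x -> mulsp (J i) R x.
Proof.
move=> Jx; have Jrx : revsp fw (J i.+2) (wrev fw x) by rewrite revspE wrevK.
have := J_step fw (koszul_spaces_rev fw ks) Jrx.
by rewrite -revsp_mul revspE wrevK.
Qed.

Lemma RK_exists i : exists F : {linear T -> B i},
  forall (c : subsp (J i)) t, F (inc c * t) = bt 1 c (pi t).
Proof.
have [rho rhoE] := rfree_J i.
have [||G GE] := @tens_lift _ (subsp (J i)) T (B i) (fun c t => bt 1 c (pi t)).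
- by move=> t; apply: (bt_linm (fb i)).
- by move=> c a t t'; rewrite linearP; apply: (bt_linr (fb i)).
by exists (G \o rho) => c t /=; rewrite rhoE GE.
Qed.

Definition RK i : {linear T -> B i} := projT1 (cid (RK_exists i)).

Lemma RKE i t c (Jc : J i c) : RK i (c * t) = bt 1 (mksub Jc) (pi t).
Proof. by rewrite -{1}(incK Jc); apply: (projT2 (cid (RK_exists i))). Qed.

Lemma RK_Phi i n x : mulsp (J i) (Vn n) x -> Phi i 0 n x = RK i x.
Proof.
move: x; apply: mulsp_eq; try exact: linearP.
move=> c t Jc Vt; rewrite -[c * t]mul1r mulrA PhiE //; last exact: onesp1.
by rewrite mul1r RKE pi1.
Qed.

Lemma RK_rel i x : mulsp (J i) R x -> RK i x = 0.
Proof.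
move: x; apply: (@mulsp_eq _ _ _ _ \0); try exact: linearP.
by move=> c t Jc Rt; rewrite RKE pi_rel // (lin0 (bt_linr (fb i) _ _)).
Qed.

(** A single [wN N] need not lie in [R J_i] or in [J_i R]; the sum [w] lies in both. The end terms
    are therefore rewritten with [LK] and [RK], which do not depend on [N], and summed, after which
    [pi] kills the relations. *)
Lemma Phi_ends i w M (wN : nat -> T) : J i.+2 w -> w = \sum_(N < M) wN N ->
  (forall N, (N < M)%N -> mulsp (Vn N.+1) (J i) (wN N)) ->
  (forall N, (N < M)%N -> mulsp (J i) (Vn N.+1) (wN N)) ->
  \sum_(N < M) (Phi i N.+1 0 (wN N) - Phi i 0 N.+1 (wN N)) = 0.
Proof.
move=> Jw wE wL wR; rewrite big_split sumrN /=.
rewrite (eq_bigr (fun N : 'I_M => LK i (wN N))); last first.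
  by move=> N _; rewrite LK_Phi //; apply: wL.
rewrite -linear_sum -wE LK_rel ?sub0r; last exact: (J_step fw ks).
rewrite (eq_bigr (fun N : 'I_M => RK i (wN N))); last first.
  by move=> N _; rewrite RK_Phi //; apply: wR.
by rewrite -linear_sum -wE RK_rel ?oppr0 //; apply: J_step_r.
Qed.

Lemma mulsp_seql U i x : mulsp U (J i) x -> exists s : seq (T * subsp (J i)),
  {in s, forall p, U p.1} /\ x = \sum_(p <- s) p.1 * inc p.2.
Proof.
have Sc : (exists s : seq (T * subsp (J i)), {in s, forall p, U p.1} /\
      0 = \sum_(p <- s) p.1 * inc p.2) /\ forall (a : k) (x y : T),
    (exists s : seq (T * subsp (J i)), {in s, forall p, U p.1} /\
      x = \sum_(p <- s) p.1 * inc p.2) ->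
    (exists s : seq (T * subsp (J i)), {in s, forall p, U p.1} /\
      y = \sum_(p <- s) p.1 * inc p.2) ->
    exists s : seq (T * subsp (J i)), {in s, forall p, U p.1} /\
      a *: x + y = \sum_(p <- s) p.1 * inc p.2.
  split; first by exists [::]; rewrite big_nil.
  move=> a _ _ [s [sU ->]] [t [tU ->]].
  exists ([seq (a *: p.1, p.2) | p <- s] ++ t); split.
    move=> p; rewrite mem_cat => /orP[/mapP[q qs ->] /=|/tU//].
    by apply: spZ; apply: sU.
  rewrite big_cat big_map scaler_sumr; congr (_ + _).
  by apply: eq_bigr => p _; rewrite -scalerAl.
apply: (@mulsp_ind _ _ _ _ (Subspace Sc)) => u c Uu Jc /=.
exists [:: (u, mksub Jc)]; split; last by rewrite big_seq1 incK.
by move=> p; rewrite inE => /eqP ->.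
Qed.

Lemma mulsp_seqr U i x : mulsp (J i) U x -> exists s : seq (subsp (J i) * T),
  {in s, forall p, U p.2} /\ x = \sum_(p <- s) inc p.1 * p.2.
Proof.
have Sc : (exists s : seq (subsp (J i) * T), {in s, forall p, U p.2} /\
      0 = \sum_(p <- s) inc p.1 * p.2) /\ forall (a : k) (x y : T),
    (exists s : seq (subsp (J i) * T), {in s, forall p, U p.2} /\
      x = \sum_(p <- s) inc p.1 * p.2) ->
    (exists s : seq (subsp (J i) * T), {in s, forall p, U p.2} /\
      y = \sum_(p <- s) inc p.1 * p.2) ->
    exists s : seq (subsp (J i) * T), {in s, forall p, U p.2} /\
      a *: x + y = \sum_(p <- s) inc p.1 * p.2.
  split; first by exists [::]; rewrite big_nil.
  move=> a _ _ [s [sU ->]] [t [tU ->]].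
  exists ([seq (p.1, a *: p.2) | p <- s] ++ t); split.
    move=> p; rewrite mem_cat => /orP[/mapP[q qs ->] /=|/tU//].
    by apply: spZ; apply: sU.
  rewrite big_cat big_map scaler_sumr; congr (_ + _).
  by apply: eq_bigr => p _; rewrite (free_scalerAr fw).
apply: (@mulsp_ind _ _ _ _ (Subspace Sc)) => c u Jc Uu /=.
exists [:: (mksub Jc, u)]; split; last by rewrite big_seq1 incK.
by move=> p; rewrite inE => /eqP ->.
Qed.

Lemma trip_seq U U' i x : mulsp (mulsp U (J i)) U' x ->
  exists s : seq (T * subsp (J i) * T),
  {in s, forall p, U p.1.1 /\ U' p.2} /\ x = \sum_(p <- s) p.1.1 * inc p.1.2 * p.2.
Proof.
have Sc : (exists s : seq (T * subsp (J i) * T), {in s, forall p, U p.1.1 /\ U' p.2} /\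
      0 = \sum_(p <- s) p.1.1 * inc p.1.2 * p.2) /\ forall (a : k) (x y : T),
    (exists s : seq (T * subsp (J i) * T), {in s, forall p, U p.1.1 /\ U' p.2} /\
      x = \sum_(p <- s) p.1.1 * inc p.1.2 * p.2) ->
    (exists s : seq (T * subsp (J i) * T), {in s, forall p, U p.1.1 /\ U' p.2} /\
      y = \sum_(p <- s) p.1.1 * inc p.1.2 * p.2) ->
    exists s : seq (T * subsp (J i) * T), {in s, forall p, U p.1.1 /\ U' p.2} /\
      a *: x + y = \sum_(p <- s) p.1.1 * inc p.1.2 * p.2.
  split; first by exists [::]; rewrite big_nil.
  move=> a _ _ [s [sU ->]] [t [tU ->]].
  exists ([seq (a *: p.1.1, p.1.2, p.2) | p <- s] ++ t); split.
    move=> p; rewrite mem_cat => /orP[/mapP[q qs ->] /=|/tU//].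
    by have [Uq Uq'] := sU q qs; split=> //; apply: spZ.
  rewrite big_cat big_map scaler_sumr; congr (_ + _).
  by apply: eq_bigr => p _; rewrite /= -!scalerAl.
apply: (@mulsp_ind _ _ _ _ (Subspace Sc)) => y z /mulsp_seql[s [sU ->]] Uz /=.
exists [seq (p, z) | p <- s]; split; last by rewrite big_map mulr_suml.
by move=> p /mapP[q qs ->] /=; split=> //; apply: sU.
Qed.

(** The conditions of [k_differential], restated for an abstract free algebra and for bimodules
    given by their universal property, where the computations take place. *)
Record kdifferential (d : forall i, {linear B i.+1 -> B i}) : Prop := Kdifferential {
  kdiff_bim : forall i, bimodule_map (fb i.+1) (fb i) (d i);
  kdiff_odd : forall i, ~~ odd i ->
    forall (w : subsp (J i.+1)) (s : seq (T * subsp (J i))) (s' : seq (subsp (J i) * T)),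
    {in s, forall p, V p.1} -> {in s', forall p, V p.2} ->
    inc w = \sum_(p <- s) p.1 * inc p.2 -> inc w = \sum_(p <- s') inc p.1 * p.2 ->
    d i (bt 1 w 1) = \sum_(p <- s) bt (pi p.1) p.2 1 - \sum_(p <- s') bt 1 p.1 (pi p.2);
  kdiff_even : forall i, odd i ->
    forall (w : subsp (J i.+1)) (M : nat) (wN : nat -> T)
           (s : nat -> nat -> seq (T * subsp (J i) * T)),
    inc w = \sum_(N < M) wN N ->
    (forall N l, (N < M)%N -> (l <= N)%N ->
       {in s N l, forall p, powsp V l p.1.1 /\ powsp V (N - l) p.2} /\
       wN N = \sum_(p <- s N l) p.1.1 * inc p.1.2 * p.2) ->
    d i (bt 1 w 1) =
      \sum_(N < M) \sum_(l < N.+1) \sum_(p <- s N l) bt (pi p.1.1) p.1.2 (pi p.2) }.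

Lemma Phi_seql i (s : seq (T * subsp (J i))) : {in s, forall p, V p.1} ->
  Phi i 1 0 (\sum_(p <- s) p.1 * inc p.2) = \sum_(p <- s) bt (pi p.1) p.2 1.
Proof.
move=> sV; rewrite linear_sum !big_seq; apply: eq_bigr => p /sV Vp.
rewrite -[p.1 * _]mulr1 (PhiE (incP p.2)) ?(powsp1 fw) ?pi1 //; last exact: onesp1.
by congr (bt _ _ _); apply: inc_inj.
Qed.

Lemma Phi_seqr i (s : seq (subsp (J i) * T)) : {in s, forall p, V p.2} ->
  Phi i 0 1 (\sum_(p <- s) inc p.1 * p.2) = \sum_(p <- s) bt 1 p.1 (pi p.2).
Proof.
move=> sV; rewrite linear_sum !big_seq; apply: eq_bigr => p /sV Vp.
rewrite -[inc _ * _]mul1r mulrA (PhiE (incP p.1)) ?(powsp1 fw) ?pi1 //; last exact: onesp1.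
by congr (bt _ _ _); apply: inc_inj.
Qed.

Lemma Phi_seq i l m (s : seq (T * subsp (J i) * T)) :
  {in s, forall p, Vn l p.1.1 /\ Vn m p.2} ->
  Phi i l m (\sum_(p <- s) p.1.1 * inc p.1.2 * p.2) =
    \sum_(p <- s) bt (pi p.1.1) p.1.2 (pi p.2).
Proof.
move=> sV; rewrite linear_sum !big_seq; apply: eq_bigr => p /sV[Vp Vp'].
by rewrite (PhiE (incP p.1.2)) //; congr (bt _ _ _); apply: inc_inj.
Qed.

Lemma J_odd_cap i x : ~~ odd i -> J i.+1 x -> mulsp V (J i) x /\ mulsp (J i) V x.
Proof.
have [[j ->]|[j ->]] := parityP i; last by rewrite /= odd_double.
by move=> _ /(J_oddP ks).
Qed.

Lemma J_even_dec i w : odd i -> J i.+1 w -> exists M (wN : nat -> T),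
  w = \sum_(N < M) wN N /\ forall N l, (l <= N)%N -> trip l i (N - l) (wN N).
Proof.
have [[j ->]|[j ->]] := parityP i; first by rewrite odd_double.
by move=> _ /(ks_even ks).
Qed.

Section Given.
Variable d : forall i, {linear B i.+1 -> B i}.
Hypothesis kd : kdifferential d.

Lemma d_evenE i w (Jw : J i.+1 w) : ~~ odd i ->
  d i (bt 1 (mksub Jw) 1) = Phi i 1 0 w - Phi i 0 1 w.
Proof.
move=> oi; have [/mulsp_seql[s [sV ws]] /mulsp_seqr[s' [sV' ws']]] := J_odd_cap oi Jw.
rewrite (kdiff_odd kd oi sV sV') ?incK // {1}ws ws'.
by rewrite Phi_seql // Phi_seqr.
Qed.

Lemma d_oddE i w (Jw : J i.+1 w) M (wN : nat -> T) : odd i ->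
  w = \sum_(N < M) wN N ->
  (forall N l, (N < M)%N -> (l <= N)%N -> trip l i (N - l) (wN N)) ->
  d i (bt 1 (mksub Jw) 1) = \sum_(N < M) \sum_(l < N.+1) Phi i l (N - l) (wN N).
Proof.
move=> oi wE wT.
have /choice[s sP] (Nl : nat * nat) : exists s : seq (T * subsp (J i) * T),
    (Nl.1 < M)%N -> (Nl.2 <= Nl.1)%N ->
    {in s, forall p, Vn Nl.2 p.1.1 /\ Vn (Nl.1 - Nl.2) p.2} /\
    wN Nl.1 = \sum_(p <- s) p.1.1 * inc p.1.2 * p.2.
  case: (ltnP Nl.1 M) => [NM|]; last by exists [::].
  case: (leqP Nl.2 Nl.1) => [lN|]; last by exists [::].
  by have [s sP] := trip_seq (wT _ _ NM lN); exists s.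
rewrite (kdiff_even kd oi (wN := wN) (s := fun N l => s (N, l)) (M := M)) ?incK //.
  apply: eq_bigr => N _; apply: eq_bigr => l _.
  have [sV ->] := sP (nat_of_ord N, nat_of_ord l) (ltn_ord N) (ltn_ord l).
  by rewrite Phi_seq.
by move=> N l NM lN; apply: (sP (N, l)).
Qed.

Lemma d_Phi i l m y : ~~ odd i -> trip l i.+1 m y ->
  d i (Phi i.+1 l m y) = Phi i l.+1 m y - Phi i l m.+1 y.
Proof.
move=> oi; move: y; apply: trip_eq; [exact: lin_comp| |].
  exact: lin_sub (linearP _) (linearP _).
move=> x c z Vx Jc Vz; rewrite PhiE // (bt_act (fb _)).
rewrite (kdiff_bim kd i).1 (kdiff_bim kd i).2 d_evenE //.
have [cL cR] := J_odd_cap oi Jc.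
have cL' : mulsp (Vn 1) (J i) c by rewrite (powsp1 fw).
have cR' : mulsp (mulsp (Vn 0) (J i)) (Vn 1) c by rewrite mul1sp (powsp1 fw).
have cL0 : trip 1 i 0 c by rewrite (mulsp1 fw).
rewrite !linearB -!(Phi_ract Vz) // -!(Phi_lact Vx); try by rewrite !mulrA addn1 addn0.
- rewrite (powsp_add fw) -(mulspA fw); exact: mulspI.
- exact: mulspI.
Qed.

Lemma dd_gen i (w : subsp (J i.+2)) :
  d i (d i.+1 (bt 1 w 1)) = 0 -> forall a b, d i (d i.+1 (bt a w b)) = 0.
Proof.
move=> dw a b; rewrite (bt_act (fb _)).
by rewrite !(kdiff_bim kd _).1 !(kdiff_bim kd _).2 dw !linear0.
Qed.

Lemma telescope_ord (Z : zmodType) (G : nat -> Z) n :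
  \sum_(l < n) (G l.+1 - G l) = G n - G 0%N.
Proof. by rewrite -(big_mkord xpredT (fun l => G l.+1 - G l)) telescope_sumr. Qed.

Lemma telescope_Phi i N y :
  \sum_(l < N.+1) (Phi i l.+1 (N - l) y - Phi i l (N - l).+1 y) =
  Phi i N.+1 0 y - Phi i 0 N.+1 y.
Proof.
transitivity (\sum_(l < N.+1) (Phi i l.+1 (N.+1 - l.+1) y - Phi i l (N.+1 - l) y)).
  by apply: eq_bigr => l _; rewrite subSS subSn // -ltnS.
by rewrite (telescope_ord (fun l => Phi i l (N.+1 - l) y)) subnn subn0.
Qed.

(** Each term [Phi l (N - l)] is sent to the same term with one more letter on the left minus the
    one with one more letter on the right, so the sum over [l] telescopes to the two terms treated
    in [Phi_ends]. *)
Lemma dd_even i (w : subsp (J i.+2)) : ~~ odd i -> d i (d i.+1 (bt 1 w 1)) = 0.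
Proof.
move=> oi; have oi1 : odd i.+1 by rewrite /= oi.
have [M [wN [wE wT]]] := J_even_dec oi1 (incP w).
have -> : w = mksub (incP w) by apply: inc_inj.
rewrite (d_oddE (incP w) oi1 wE) => [|N l _]; last exact: wT.
rewrite linear_sum.
rewrite (eq_bigr (fun N : 'I_M => Phi i N.+1 0 (wN N) - Phi i 0 N.+1 (wN N))).
  apply: (Phi_ends (incP w) wE) => N _.
    have := wT N N (leqnn N); rewrite subnn (mulsp1 fw) (powspSr fw) (mulspA fw).
    by apply: mulspS => // y Jy; have [] := J_odd_cap oi Jy.
  have := wT N 0%N isT; rewrite subn0 mul1sp powspSl -(mulspA fw).
  by apply: mulspS => // y Jy; have [] := J_odd_cap oi Jy.
move=> N _; rewrite -telescope_Phi linear_sum; apply: eq_bigr => l _.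
by rewrite d_Phi //; apply: wT; rewrite -ltnS.
Qed.

(** The number of letters in front of the factor from [U] is well defined on [T U] by freeness,
    although [U] itself may mix lengths. *)
Lemma length_component U : lfree U -> exists F : nat -> {linear T -> T},
  (forall n t c, U c -> F n (t * c) = lenp fw n t * c) /\
  (forall n m y, mulsp (Vn m) U y -> F n y = if n == m then y else 0).
Proof.
move=> lU; have /choice[F FE] n : exists F : {linear T -> T},
    forall t (c : subsp U), F (t * inc c) = lenp fw n t * inc c.
  apply: lfree_lift => // [c a t t'|t a c c'].
    by rewrite linearP; apply: mull_linear.
  by rewrite linearP; apply: (mulr_linear fw).
have FE' n t c (Uc : U c) : F n (t * c) = lenp fw n t * c by rewrite -(incK Uc) FE.
exists F; split=> // n m y yU.
have [Z ZE] : exists Z : {linear T -> T}, forall y, Z y = if n == m then y else 0.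
  by case: eqP; [exists idfun|exists \0].
rewrite -ZE; move: y yU; apply: mulsp_eq; try exact: linearP.
move=> t c Vt Uc; rewrite FE' // ZE; move/(VnP fw): Vt => <-.
by rewrite (lenp_dec fw).1; case: (n =P m) => // _; rewrite mul0r.
Qed.

(** The length pieces now belong to the factors in [J_{i+1}] of two different expressions of [u],
    one in [V J_{i+1}] and one in [J_{i+1} V]. Once the pieces [XL N u] and [XR N u] are shown to
    coincide, the two sums telescope as in [dd_even]. *)
Lemma dd_odd i u (Ju : J i.+2 u) : odd i -> d i (d i.+1 (bt 1 (mksub Ju) 1)) = 0.
Proof.
move=> oi; have oi1 : ~~ odd i.+1 by rewrite /= oi.
have [F [_ FV]] := length_component (lfree_J fw ks i).
(* The pieces given by [ks_even] are recovered as the components of [c] relative to [J_i], hence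
   depend linearly on [c]. *)
have FJ c : J i.+1 c -> (forall N l, (l <= N)%N -> trip l i (N - l) (F N c)) /\
    exists M0, forall M, (M0 <= M)%N -> c = \sum_(N < M) F N c.
  move=> Jc; have [M0 [wN [cE wT]]] := J_even_dec oi Jc.
  have Fc n : F n c = if (n < M0)%N then wN n else 0.
    rewrite cE linear_sum /= (eq_bigr (fun N : 'I_M0 => if n == N then wN N else 0)).
      case: ltnP => nM.
        rewrite (bigD1 (Ordinal nM)) //= eqxx big1 ?addr0 // => N.
        by rewrite -val_eqE eq_sym => /negbTE /= ->.
      by rewrite big1 // => N _; rewrite gtn_eqF // (leq_trans (ltn_ord N) nM).
    move=> N _; apply: FV; have := wT N N (leqnn N).
    by rewrite subnn (mulsp1 fw).
  split=> [N l lN|]; first by rewrite Fc; case: ifP => _; [apply: wT|apply: sp0].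
  exists M0 => M MM; rewrite {1}cE (big_ord_widen M _ MM) big_mkcond.
  by apply: eq_bigr => N _; rewrite Fc.
have /choice[XL XLE] N : exists G : {linear T -> T},
    forall x y : T, V x -> G (x * y) = x * F N y.
  have [|||G GE] := @mid_lift _ _ _ _ fw _ (fun x y z => x * F N (y * z)) 1 0.
  - by move=> y z; apply: mull_linear.
  - by move=> x z a y y'; rewrite free_mullP linearP; apply: (mulr_linear fw).
  - by move=> x y a z z'; rewrite (free_mulrP fw) linearP; apply: (mulr_linear fw).
  exists G => x y Vx; rewrite -[x * y]mulr1 GE ?mulr1 ?(powsp1 fw) //; exact: onesp1.
have /choice[XR XRE] N : exists G : {linear T -> T},
    forall y z : T, V z -> G (y * z) = F N y * z.
  have [|||G GE] := @mid_lift _ _ _ _ fw _ (fun x y z => F N (x * y) * z) 0 1.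
  - by move=> y z a x x'; rewrite free_mullP linearP; apply: mull_linear.
  - by move=> x z a y y'; rewrite (free_mulrP fw) linearP; apply: mull_linear.
  - by move=> x y; apply: (mulr_linear fw).
  exists G => y z Vz; rewrite -[y * z]mul1r mulrA GE ?mul1r ?(powsp1 fw) //; exact: onesp1.
have [uL uR] := J_odd_cap oi1 Ju.
have [[j ij]|[j ij]] := parityP i; first by rewrite ij odd_double in oi.
(* [J_i] lies in [J_{2j} V], and components relative to the latter serve to compare the two families
   of pieces. *)
have [G [_ GV]] := length_component (lfree_JV fw ks j).
have Jij c : J i c -> mulsp V (J j.*2) c /\ mulsp (J j.*2) V c.
  by rewrite ij => /(J_oddP ks).
have XLV N : mulsp (Vn N.+1) (J i) (XL N u).
  move: u uL {Ju uR}; apply: mulsp_indf => x c Vx Jc; rewrite XLE //.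
  have := (FJ c Jc).1 N N (leqnn N); rewrite subnn (mulsp1 fw) powspSl (mulspA fw) => H.
  exact: mulspI.
have XRV N : mulsp (J i) (Vn N.+1) (XR N u) /\
    mulsp (Vn N.+1) (mulsp (J j.*2) V) (XR N u).
  split; move: u uR {Ju uL XLV}; apply: mulsp_indf => c z Jc Vz; rewrite XRE //.
    have := (FJ c Jc).1 N 0%N isT; rewrite subn0 mul1sp (powspSr fw) -(mulspA fw) => H.
    exact: mulspI.
  have := (FJ c Jc).1 N N (leqnn N); rewrite subnn (mulsp1 fw) (powspSr fw) => H.
  rewrite -(mulspA fw); apply: mulspI => //; rewrite (mulspA fw).
  by move: H; apply: mulspS => // y /Jij[].
have sumL : exists M0, forall M, (M0 <= M)%N -> u = \sum_(N < M) XL N u.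
  have Sc := eventually_closed (f := fun M (y : T) => y) (g := fun M y => \sum_(N < M) XL N y)
    (fun M => linearP idfun) (fun M => lin_bigsum _ _ (fun N : 'I_M => linearP (XL N))).
  move: u uL {Ju uR XLV XRV}; apply: (@mulsp_ind _ _ _ _ (Subspace Sc)) => x c Vx Jc /=.
  have [_ [M0 cE]] := FJ c Jc; exists M0 => M /cE {1}->; rewrite mulr_sumr.
  by apply: eq_bigr => N _; rewrite XLE.
have sumR : exists M0, forall M, (M0 <= M)%N -> u = \sum_(N < M) XR N u.
  have Sc := eventually_closed (f := fun M (y : T) => y) (g := fun M y => \sum_(N < M) XR N y)
    (fun M => linearP idfun) (fun M => lin_bigsum _ _ (fun N : 'I_M => linearP (XR N))).
  move: u uR {Ju uL XLV XRV sumL}.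
  apply: (@mulsp_ind _ _ _ _ (Subspace Sc)) => c z Jc Vz /=.
  have [_ [M0 cE]] := FJ c Jc; exists M0 => M /cE {1}->; rewrite mulr_suml.
  by apply: eq_bigr => N _; rewrite XRE.
(* Both are the component of [u] with [N + 1] letters in front of [J_{2j} V]. *)
have XLR N : XL N u = XR N u.
  have [ML uML] := sumL; have [MR uMR] := sumR; pose M := maxn N.+1 (maxn ML MR).
  have NM : (N < M)%N by rewrite leq_maxl.
  have GE (Y : nat -> {linear T -> T}) :
      (forall n, mulsp (Vn n.+1) (mulsp (J j.*2) V) (Y n u)) ->
      G N.+1 (\sum_(n < M) Y n u) = Y N u.
    move=> YV; rewrite linear_sum (bigD1 (Ordinal NM)) //= (GV _ N.+1) // eqxx.
    rewrite big1 ?addr0 // => n; rewrite -val_eqE /= => nN.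
    by rewrite (GV _ n.+1) // eqSS eq_sym (negbTE nN).
  rewrite -(GE XL); last by move=> n; move: (XLV n); apply: mulspS => // y /Jij[].
  rewrite -(GE XR) -?uML -?uMR ?leq_max ?leqnn ?orbT // => n.
  by have [] := XRV n.
have dL : exists M0, forall M, (M0 <= M)%N -> d i (Phi i.+1 1 0 u) =
    \sum_(N < M) \sum_(l < N.+1) Phi i l.+1 (N - l) (XL N u).
  have Sc := eventually_closed (f := fun M y => d i (Phi i.+1 1 0 y))
    (g := fun M y => \sum_(N < M) \sum_(l < N.+1) Phi i l.+1 (N - l) (XL N y))
    (fun M => lin_comp _ _) (fun M => lin_bigsum _ _ (fun N : 'I_M => lin_bigsum _ _
       (fun l : 'I_N.+1 => lin_comp _ _))).
  move: u uL {Ju uR XLV XRV XLR sumL sumR}.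
  apply: (@mulsp_ind _ _ _ _ (Subspace Sc)) => x c Vx Jc /=.
  have [cT [M0 cE]] := FJ c Jc; exists M0 => M /cE {}cE.
  have xV : Vn 1 x by rewrite (powsp1 fw).
  rewrite -{1}[x * c]mulr1 PhiE //; last exact: onesp1.
  rewrite (bt_act (fb _)) pi1 (ract1 (fb _)) (kdiff_bim kd i).1.
  rewrite (d_oddE Jc (wN := fun N => F N c) oi cE) => [|N l _]; last exact: cT.
  rewrite linear_sum; apply: eq_bigr => N _; rewrite linear_sum; apply: eq_bigr => l _.
  by rewrite XLE // -(Phi_lact xV) //; apply: cT; rewrite -ltnS.
have dR : exists M0, forall M, (M0 <= M)%N -> d i (Phi i.+1 0 1 u) =
    \sum_(N < M) \sum_(l < N.+1) Phi i l (N - l).+1 (XR N u).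
  have Sc := eventually_closed (f := fun M y => d i (Phi i.+1 0 1 y))
    (g := fun M y => \sum_(N < M) \sum_(l < N.+1) Phi i l (N - l).+1 (XR N y))
    (fun M => lin_comp _ _) (fun M => lin_bigsum _ _ (fun N : 'I_M => lin_bigsum _ _
       (fun l : 'I_N.+1 => lin_comp _ _))).
  move: u uR {Ju uL XLV XRV XLR sumL sumR dL}.
  apply: (@mulsp_ind _ _ _ _ (Subspace Sc)) => c z Jc Vz /=.
  have [cT [M0 cE]] := FJ c Jc; exists M0 => M /cE {}cE.
  have zV : Vn 1 z by rewrite (powsp1 fw).
  rewrite -{1}[c * z]mul1r mulrA PhiE //; last exact: onesp1.
  rewrite (bt_act (fb _)) pi1 (lact1 (fb _)) (kdiff_bim kd i).2.
  rewrite (d_oddE Jc (wN := fun N => F N c) oi cE) => [|N l _]; last exact: cT.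
  rewrite linear_sum; apply: eq_bigr => N _; rewrite linear_sum; apply: eq_bigr => l _.
  by rewrite XRE // -(Phi_ract zV) ?addn1 //; apply: cT; rewrite -ltnS.
rewrite d_evenE // linearB.
have [ML dML] := dL; have [MR dMR] := dR; have [M0 uM] := sumL.
pose M := maxn M0 (maxn ML MR).
rewrite (dML M) ?leq_max ?leqnn ?orbT // (dMR M) ?leq_max ?leqnn ?orbT //.
rewrite -sumrB -[RHS](Phi_ends Ju (uM M _) (fun N _ => XLV N)) ?leq_maxl //.
  apply: eq_bigr => N _; rewrite -telescope_Phi -sumrB.
  by apply: eq_bigr => l _; rewrite XLR.
by move=> N _; rewrite XLR; have [] := XRV N.
Qed.

Lemma dd0 i x : d i (d i.+1 x) = 0.
Proof.
move: x; apply: (bim_eqf (fb i.+2) (lin_comp _ _) (linearP \0)) => a w b.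
apply: dd_gen; case: (boolP (odd i)) => oi; last exact: dd_even.
have -> : w = mksub (incP w) by apply: inc_inj.
exact: dd_odd.
Qed.

End Given.
(** For odd [i] the prescribed value uses pieces [wN] that are not chosen linearly. The map is
    therefore defined on [T (x) J_i], by applying the sum of the [Phi l (n - l)] to the part with
    [n] letters in front; freeness of [J_i] carries it to [T J_i], which contains [J_{i+1}]. *)
Lemma d_gen_exists i : exists f : {linear subsp (J i.+1) -> B i},
  (~~ odd i -> forall w, f w = Phi i 1 0 (inc w) - Phi i 0 1 (inc w)) /\
  (odd i -> forall w M (wN : nat -> T), inc w = \sum_(N < M) wN N ->
    (forall N l, (N < M)%N -> (l <= N)%N -> trip l i (N - l) (wN N)) ->
    f w = \sum_(N < M) \sum_(l < N.+1) Phi i l (N - l) (wN N)).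
Proof.
have [oi|_] := boolP (odd i); last first.
  by exists ((Phi i 1 0 \- Phi i 0 1) \o @inc _ _ (J i.+1)).
have /choice[H HE] n := linear_sum_maps (index_enum 'I_n.+1) xpredT
  (fun l : 'I_n.+1 => Phi i l (n - l)).
have /choice[G GE] (c : subsp (J i)) : exists G : {linear T -> B i},
    forall n t, G (lenp fw n t) = H n (lenp fw n t * inc c).
  have [mc mcE] := linear_pack (mull_linear (inc c)).
  have [G GE] := wd_glue (lenp_dec fw) (fun n => H n \o mc).
  by exists G => n t; rewrite GE /= mcE.
have [||Psi PsiE] := lfree_lift (b := fun t c => G c t) (lfree_J fw ks i).
- by move=> c; apply: linearP.
- move=> t a c c'; have [F FE] := linear_pack (lin_comb a (linearP (G c)) (linearP (G c'))).
  rewrite -FE; move: t; apply: (wd_eq (lenp_dec fw)) => n x; rewrite FE !GE (linearP (@inc _ _ (J i))).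
  by rewrite (free_mulrP fw) linearP.
have PsiV N y : mulsp (Vn N) (J i) y -> Psi y = H N y.
  move: y; apply: mulsp_eq; try exact: linearP.
  by move=> t c /(VnP fw) <- Jc; rewrite -(incK Jc) PsiE GE.
exists (Psi \o @inc _ _ (J i.+1)); split=> // _ w M wN wE wT /=.
rewrite wE linear_sum; apply: eq_bigr => N _; rewrite (PsiV N) ?HE //.
by have := wT N N (ltn_ord N) (leqnn N); rewrite subnn (mulsp1 fw).
Qed.

Lemma kdifferential_exists : exists d, kdifferential d.
Proof.
pose H i := cid (bimodule_extend (fb i.+1) (fb i) (projT1 (cid (d_gen_exists i)))).
pose d i := projT1 (H i).
have dE i w : d i (bt 1 w 1) = projT1 (cid (d_gen_exists i)) w.
  exact: (projT2 (H i)).2.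
exists d; split=> [i|i oi w s s' sV sV' ws ws'|i oi w M wN s wE sP].
- exact: (projT2 (H i)).1.
- rewrite dE (projT2 (cid (d_gen_exists i))).1 // {1}ws ws'.
  by rewrite Phi_seql // Phi_seqr.
- rewrite dE ((projT2 (cid (d_gen_exists i))).2 oi w M wN) //.
    apply: eq_bigr => N _; apply: eq_bigr => l _.
    by have [sV ->] := sP N l (ltn_ord N) (ltn_ord l); rewrite Phi_seq.
  move=> N l NM lN; have [sV ->] := sP N l NM lN.
  rewrite big_seq; apply: sp_sum => p /sV[Vp Vp'].
  by do 2?[apply: mulspI => //]; apply: incP.
Qed.

Lemma aug_exists : exists m : {linear B 0 -> A},
  forall a w b, m (bt a w b) = a * pi (inc w) * b.
Proof.
apply: (bim_lift (fb 0)) => [w b c a a'|a b c w w'|a w c b b'].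
- by rewrite !mulrDl -!scalerAl.
- rewrite (linearP (@inc _ _ (J 0))) linearP mulrDr mulrDl.
  by rewrite -scalerAr -scalerAl.
- by rewrite mulrDr -scalerAr.
Qed.

(** The two terms of the differential of [w] have the same product in [A], namely [pi w]. *)
Lemma aug_d (d : forall i, {linear B i.+1 -> B i}) (m : {linear B 0 -> A}) x :
  kdifferential d -> (forall a w b, m (bt a w b) = a * pi (inc w) * b) ->
  m (d 0 x) = 0.
Proof.
move=> kd mE.
have mact a b y : m (lact (fb 0) a (ract (fb 0) b y)) = a * m y * b.
  have ll : linear (fun y => a * m y * b).
    by move=> c u v; rewrite linearP mulrDr mulrDl -scalerAr -scalerAl.
  move: y; apply: (bim_eqf (fb 0) _ ll) => [c u v|u w v]; first by rewrite !linearP.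
  by rewrite ractE lactE !mE !mulrA.
move: x; apply: (bim_eqf (fb 1) (lin_comp _ _) (linearP \0)) => a w b.
rewrite (bt_act (fb 1)) (kdiff_bim kd 0).1 (kdiff_bim kd 0).2 mact.
have -> : w = mksub (incP w) by apply: inc_inj.
rewrite (d_evenE kd) //; have [wL wR] := J_odd_cap (i := 0) isT (incP w).
rewrite linearB /=.
have -> : m (Phi 0 1 0 (inc w)) = pi (inc w).
  move: (inc w) wL {wR}; apply: mulsp_eq => [||x c Vx Jc]; [exact: lin_comp|exact: linearP|].
  rewrite -{1}[x * c]mulr1 PhiE ?(powsp1 fw) //; last exact: onesp1.
  by rewrite mE incK pi1 mulr1 piM.
have -> : m (Phi 0 0 1 (inc w)) = pi (inc w).
  move: (inc w) wR {wL}; apply: mulsp_eq => [||c x Jc Vx]; [exact: lin_comp|exact: linearP|].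
  rewrite -{1}[c * x]mul1r mulrA PhiE ?(powsp1 fw) //; last exact: onesp1.
  by rewrite mE incK pi1 mul1r piM.
by rewrite subrr mulr0 mul0r.
Qed.

End Differential.

(** * One-sided complexes *)

(* A complex of free one-sided modules [X i = Y i (x) A] over an algebra with
   product [op] (either the product of [A] or its opposite), compared with the
   complex [Y] obtained by killing the augmentation ideal of [A]. *)
Section OneSided.
Variables (k : fieldType) (A : lmodType k) (e1 : A) (op : A -> A -> A).
Variable eps : {linear A -> k^o}.
Hypothesis op_e1 : forall a, op a e1 = a.
Hypotheses (eps1 : eps e1 = 1) (eps_op : forall a b, eps (op a b) = eps a * eps b).
Variables (X Y : nat -> lmodType k) (xt : forall i, Y i -> A -> X i).
Hypothesis ft : forall i, free_tensor (@xt i).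
Variable act : forall i, A -> {linear X i -> X i}.
Hypothesis actE : forall i a y b, act i a (xt y b) = xt y (op a b).
Hypothesis act_mul : forall i a b x, act i a (act i b x) = act i (op a b) x.
Hypothesis act_linear : forall i x, linear (fun a => act i a x).
Variable dX : forall i, {linear X i.+1 -> X i}.
Hypothesis dX_act : forall i a x, dX i (act i.+1 a x) = act i a (dX i x).
Hypothesis dX_dX : forall i x, dX i (dX i.+1 x) = 0.

Lemma theta_exists i : exists F : {linear X i -> Y i},
  forall y a, F (xt y a) = eps a *: y.
Proof.
apply: (ft_lift (ft i)) => [a c y y'|y c a a'].
  by rewrite scalerDr !scalerA mulrC.
by rewrite linearP scalerDl scalerA.
Qed.

Definition theta i : {linear X i -> Y i} := projT1 (cid (theta_exists i)).

Lemma thetaE i y a : theta i (xt y a) = eps a *: y.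
Proof. exact: (projT2 (cid (theta_exists i))). Qed.

Fact dY_linear i : linear (fun y : Y i.+1 => theta i (dX i (xt y e1))).
Proof. by move=> a y y'; rewrite (ft_l (ft i.+1) e1) !linearP. Qed.

Definition dY i : {linear Y i.+1 -> Y i} := projT1 (cid (linear_pack (@dY_linear i))).

Lemma dYE i y : dY i y = theta i (dX i (xt y e1)).
Proof. exact: (projT2 (cid (linear_pack (@dY_linear i)))). Qed.

Definition aug_exact (Z : nat -> lmodType k) (d : forall i, {linear Z i.+1 -> Z i}) :=
  (forall z, exists y, z = d 0%N y) /\
  (forall i z, d i z = 0 -> exists y, z = d i.+1 y).

Lemma theta_e1 i (y : Y i) : theta i (xt y e1) = y.
Proof. by rewrite thetaE eps1 scale1r. Qed.

Lemma theta_act i a (x : X i) : theta i (act i a x) = eps a *: theta i x.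
Proof.
have l : linear (fun x => eps a *: theta i x).
  by move=> c u v; rewrite linearP scalerDr !scalerA mulrC.
move: x; apply: (ft_eqf (ft i) (lin_comp _ _) l) => y b.
by rewrite actE !thetaE eps_op scalerA.
Qed.

Definition augm i : subspace (X i) :=
  span (fun x => exists y a, eps a = 0 /\ x = xt y a).

Lemma augm_theta i (x : X i) : augm i (x - xt (theta i x) e1).
Proof.
have l : linear (fun x : X i => x - xt (theta i x) e1).
  by apply: lin_sub => [//|a u v]; rewrite linearP; apply: (ft_l (ft i)).
have [f fE] := linear_pack l; rewrite -fE.
apply: (ft_span (ft i) (S := presp f (augm i))) => y a /=; rewrite fE thetaE.
apply: span_sub; exists y, (a - eps a *: e1); split.
  by rewrite linearB linearZ eps1 /= [_ *: _]mulr1 subrr.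
by rewrite (linB (ft_r (ft i) y)) (linZ (ft_r (ft i) y)) (linZ (ft_l (ft i) e1)).
Qed.

Lemma augm_theta0 i x : theta i x = 0 -> augm i x.
Proof.
by move=> x0; have := augm_theta x; rewrite x0 (lin0 (ft_l (ft i) e1)) subr0.
Qed.

Lemma xt_act i (y : Y i) a : xt y a = act i a (xt y e1).
Proof. by rewrite actE op_e1. Qed.

Lemma dY_theta i x : dY i (theta i.+1 x) = theta i (dX i x).
Proof.
rewrite dYE; apply/esym/eqP; rewrite -subr_eq0 -!linearB; apply/eqP.
move: (augm_theta x); move: (x - _).
apply: (@span_min _ _ _ (kersp (theta i \o dX i))) => _ [y [a [ea ->]]] /=.
by rewrite xt_act dX_act theta_act ea scale0r.
Qed.

Lemma extend i j (f : {linear Y i -> X j}) : exists F : {linear X i -> X j},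
  (forall y, F (xt y e1) = act j e1 (f y)) /\
  (forall a x, F (act i a x) = act j a (F x)).
Proof.
have [||F FE] := ft_lift (ft i) (b := fun y a => act j a (f y)).
- by move=> a c y y'; rewrite !linearP.
- by move=> y; apply: act_linear.
exists F; split=> // a x; move: x; apply: (ft_eqf (ft i)); try exact: lin_comp.
by move=> y b; rewrite actE !FE act_mul.
Qed.

Section Quotient.
Hypothesis exX : aug_exact dX.
Hypothesis act1 : forall i x, act i e1 x = x.

(** An exact complex of free modules, bounded below, contracts [A]-linearly: [1 - s d] takes values
    in cycles, so it lifts through the next differential, the lift being chosen on generators. *)
Lemma homotopy i : exists s : {linear X i -> X i.+1},
  (forall a x, s (act i a x) = act i.+1 a (s x)) /\
  forall x, dX i (s (dX i x)) = dX i x.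
Proof.
have dsec j (e : {linear X j -> X j}) :
    (forall a x, e (act j a x) = act j a (e x)) ->
    (forall x, exists z, e x = dX j z) ->
    exists s : {linear X j -> X j.+1},
      (forall a x, s (act j a x) = act j.+1 a (s x)) /\ forall x, dX j (s x) = e x.
  move=> ea ez; have [sec secE] := linear_section (dX j).
  have lf : linear (fun y => sec (e (xt y e1))).
    by move=> a y y'; rewrite (ft_l (ft j) e1) !linearP.
  have [f fE] := linear_pack lf; have [s [sE sa]] := extend f.
  exists s; split=> //; apply: (ft_eqf (ft j)); [exact: lin_comp|exact: linearP|].
  move=> y a; rewrite xt_act sa dX_act ea sE act1 fE; congr (act j a _).
  by have [z ->] := ez (xt y e1); rewrite secE.
elim: i => [|i [s [sa sd]]].
  have [//|x|s [sa sd]] := @dsec 0%N idfun; first exact: exX.1.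
  by exists s; split=> // x; rewrite sd.
have [a x|x|s' [s'a s'd]] := @dsec i.+1 (idfun \- (s \o dX i)).
- by rewrite /= dX_act sa linearB.
- by apply: exX.2; rewrite /= linearB sd subrr.
by exists s'; split=> // x; rewrite s'd /= dX_dX linear0 subr0.
Qed.

(** The contraction is [A]-linear, so it respects the elements with factor in the augmentation ideal
    and survives the reduction to [Y]. *)
Lemma quotient_exact : aug_exact dY.
Proof.
split=> [y|i y dy].
  by have [x xE] := exX.1 (xt y e1); exists (theta 1 x); rewrite dY_theta -xE theta_e1.
have [s [sa sd]] := homotopy i; pose x := xt y e1.
have dx : augm i (dX i x) by apply: augm_theta0; rewrite -dY_theta theta_e1.
have sdx : theta i.+1 (s (dX i x)) = 0.
  have sub : forall z, augm i z -> theta i.+1 (s z) = 0; last exact: sub.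
  apply: (@span_min _ _ _ (kersp (theta i.+1 \o s))) => _ [u [a [ea ->]]] /=.
  by rewrite xt_act sa theta_act ea scale0r.
have [|z zE] := exX.2 i (x - s (dX i x)); first by rewrite linearB sd subrr.
by exists (theta i.+2 z); rewrite dY_theta -zE linearB sdx subr0 theta_e1.
Qed.

End Quotient.

Section Lifting.
Variables (prA : nat -> {linear A -> A}) (prY : forall i, nat -> {linear Y i -> Y i}).
Variable prX : forall i, nat -> {linear X i -> X i}.
Hypotheses (dA : wdecomp prA) (dYd : forall i, wdecomp (prY i)).
Hypothesis dXd : forall i, wdecomp (prX i).
Hypothesis prXE : forall i n m l y a, prX i n (xt (prY i m y) (prA l a)) =
  if n == (m + l)%N then xt (prY i m y) (prA l a) else 0.
Hypothesis dX_pr : forall i n x, dX i (prX i.+1 n x) = prX i n (dX i x).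
Hypotheses (eps_pr : forall n a, eps (prA n.+1 a) = 0) (prA_e1 : prA 0 e1 = e1).
Hypothesis op_aug : forall j p a b, (j <= p)%N -> eps b = 0 ->
  prA j (op (prA p a) b) = 0.
Hypothesis exY : aug_exact dY.

Lemma theta_pr i n x : theta i (prX i n x) = prY i n (theta i x).
Proof.
rewrite -[LHS]/((theta i \o prX i n) x) -[RHS]/((prY i n \o theta i) x); move: x.
apply: (ft_spanw (S := equalizer (theta i \o prX i n) (prY i n \o theta i))
  (ft i) (dYd i) dA) => m l y a /=.
rewrite prXE thetaE linearZ /= (dYd i).1; case: l => [|l]; last first.
  by case: ifP; rewrite ?linear0 ?thetaE eps_pr !scale0r.
rewrite addn0; case: eqP => _; first by rewrite thetaE.
by rewrite linear0 scaler0.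
Qed.

Lemma xt_pr i n (y : Y i) : xt (prY i n y) e1 = prX i n (xt y e1).
Proof.
have [f fE] := linear_pack (ft_l (ft i) e1); rewrite -!fE.
rewrite -[LHS]/((f \o prY i n) y) -[RHS]/((prX i n \o f) y); move: y.
apply: (wd_eq (dYd i)) => m y /=; rewrite !fE (dYd i).1 -{2}prA_e1 prXE addn0 prA_e1.
by case: (n =P m) => _ //; rewrite (lin0 (ft_l (ft i) e1)).
Qed.

Lemma dY_pr i n y : dY i (prY i.+1 n y) = prY i n (dY i y).
Proof. by rewrite !dYE xt_pr dX_pr theta_pr. Qed.

Definition right_part i p : {linear X i -> X i} :=
  projT1 (cid (ft_map (idfun : {linear Y i -> Y i}) (prA p) (ft i) (ft i))).

Lemma right_partE i p y a : right_part i p (xt y a) = xt y (prA p a).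
Proof. exact: (projT2 (cid (ft_map _ _ (ft i) (ft i)))). Qed.

Lemma right_partM i p q x :
  right_part i p (right_part i q x) = if p == q then right_part i q x else 0.
Proof.
have [Z ZE] : exists Z : {linear X i -> X i}, forall x, Z x =
    if p == q then right_part i q x else 0.
  by case: eqP; [exists (right_part i q)|exists \0].
rewrite -ZE; move: x; apply: (ft_eqf (ft i) (lin_comp _ _) (linearP Z)) => y a.
rewrite ZE !right_partE dA.1; case: eqP => // _.
exact: (lin0 (ft_r (ft i) y)).
Qed.

Lemma right_part_sum i x : exists N, forall M, (N <= M)%N -> x = \sum_(p < M) right_part i p x.
Proof.
have Sc := eventually_closed (f := fun M (y : X i) => y)
  (g := fun M y => \sum_(p < M) right_part i p y)
  (fun M => linearP idfun) (fun M => lin_bigsum _ _ (fun p : 'I_M => linearP (right_part i p))).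
apply: (ft_span (ft i) (S := Subspace Sc)) => y a /=.
have [N NP] := dA.2 a; exists N => M /NP {1}->.
by rewrite (lin_sum (ft_r (ft i) y)); apply: eq_bigr => p _; rewrite right_partE.
Qed.

Definition gr_d i : {linear X i.+1 -> X i} :=
  projT1 (cid (ft_map (dY i) (idfun : {linear A -> A}) (ft i.+1) (ft i))).

Lemma gr_dE i y a : gr_d i (xt y a) = xt (dY i y) a.
Proof. exact: (projT2 (cid (ft_map (dY i) _ (ft i.+1) (ft i)))). Qed.

(* [gr_d] is the part of [dX] which preserves the weight of the factor in [A];
   the other part raises it. *)
Lemma right_part_dX i q p x : (q <= p)%N ->
  right_part i q (dX i (right_part i.+1 p x)) =
    if q == p then gr_d i (right_part i.+1 p x) else 0.
Proof.
move=> qp; have [Z ZE] : exists Z : {linear X i.+1 -> X i}, forall x, Z x =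
    if q == p then gr_d i (right_part i.+1 p x) else 0.
  by case: eqP; [exists (gr_d i \o right_part i.+1 p)|exists \0].
have l : linear (fun x => right_part i q (dX i (right_part i.+1 p x))).
  by move=> c u v; rewrite !linearP.
rewrite -ZE; move: x; apply: (ft_eqf (ft i.+1) l (linearP Z)) => y a.
rewrite ZE right_partE gr_dE xt_act dX_act.
rewrite -[dX i (xt y e1)](subrK (xt (theta i (dX i (xt y e1))) e1)) -dY_theta theta_e1.
rewrite (linearD (act i (prA p a))) (linearD (right_part i q)) actE op_e1 right_partE dA.1.
have -> : right_part i q (act i (prA p a) (dX i (xt y e1) - xt (dY i y) e1)) = 0.
  have := augm_theta (dX i (xt y e1)); rewrite -dY_theta theta_e1.
  move: (_ - _); apply: (@span_min _ _ _ (kersp (right_part i q \o act i (prA p a)))).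
  move=> _ [z [b [eb ->]]] /=.
  by rewrite actE right_partE op_aug // (lin0 (ft_r (ft i) z)).
by rewrite add0r; case: eqP => // _; rewrite (lin0 (ft_r (ft i) _)).
Qed.

Lemma right_part_pr i p n x : right_part i p (prX i n x) = prX i n (right_part i p x).
Proof.
rewrite -[LHS]/((right_part i p \o prX i n) x) -[RHS]/((prX i n \o right_part i p) x).
move: x; apply: (ft_spanw (S := equalizer (right_part i p \o prX i n)
  (prX i n \o right_part i p)) (ft i) (dYd i) dA) => m l y a /=.
rewrite prXE right_partE dA.1; have [->|pl] := eqVneq p l.
  by rewrite prXE; case: ifP => // _; rewrite ?linear0 // right_partE (wd_id dA).
rewrite (lin0 (ft_r (ft i) _)) linear0; case: ifP => _; rewrite ?linear0 //.
by rewrite right_partE (wd_neq dA) // (lin0 (ft_r (ft i) _)).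
Qed.

Lemma gr_d_pr i n x : gr_d i (prX i.+1 n x) = prX i n (gr_d i x).
Proof.
rewrite -[LHS]/((gr_d i \o prX i.+1 n) x) -[RHS]/((prX i n \o gr_d i) x).
move: x; apply: (ft_spanw (S := equalizer (gr_d i \o prX i.+1 n) (prX i n \o gr_d i))
  (ft i.+1) (dYd i.+1) dA) => m l y a /=.
rewrite prXE gr_dE dY_pr prXE; case: ifP => _; last by rewrite linear0.
by rewrite gr_dE dY_pr.
Qed.

Lemma gr_d_right i p x : gr_d i (right_part i.+1 p x) = right_part i p (gr_d i x).
Proof.
move: x; apply: (ft_eqf (ft i.+1) (lin_comp _ _) (lin_comp _ _)) => y a.
by rewrite right_partE !gr_dE right_partE.
Qed.

Lemma right_part_gt i p n x : (n < p)%N -> right_part i p (prX i n x) = 0.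
Proof.
move=> np; rewrite -[LHS]/((right_part i p \o prX i n) x) -[RHS]/(\0 x); move: x.
apply: (ft_spanw (S := equalizer (right_part i p \o prX i n) \0) (ft i) (dYd i) dA).
move=> m l y a /=; rewrite prXE; case: eqP => [nml|_]; last by rewrite linear0.
rewrite right_partE (wd_neq dA) ?(lin0 (ft_r (ft i) _)) //.
by apply: contraTneq np => ->; rewrite nml -leqNgt leq_addl.
Qed.

Definition closed (Z : nat -> lmodType k) (d : forall i, {linear Z i.+1 -> Z i}) i :
    Z i -> Prop :=
  match i with 0 => fun=> True | j.+1 => fun z => d j z = 0 end.

Lemma gr_exact i x : closed gr_d x -> exists z, x = gr_d i z.
Proof.
case: i x => [|i] x cx.
  apply: (ft_surj (p := @xt 1%N) (f := dY 0) (g := idfun) (ft 0%N)) => [y a|v|v].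
  - by rewrite gr_dE.
  - exact: exY.1.
  - by exists v.
apply: (ft_exact (F := gr_d i.+1) (G := gr_d i) (ft i.+2) (ft i.+1) (ft i) (exY.2 i) _ _ cx).
  by move=> y a; rewrite gr_dE.
by move=> y a; rewrite gr_dE.
Qed.

Lemma closed_sub i (x : X i) z : closed dX x -> closed dX (x - dX i z).
Proof. by case: i x z => //= i x z dx0; rewrite linearB dx0 dX_dX subrr. Qed.

(** Successive approximation along the weight of the outer factor: the lowest part of [x] is a cycle
    for [gr_d], hence a [gr_d]-boundary, and subtracting the corresponding [dX]-boundary raises the
    lowest weight. The process stops because the outer weight cannot exceed the total weight [n]. *)
Lemma closed_lift i n p x : closed dX x -> prX i n x = x ->
  (forall q, (q < p)%N -> right_part i q x = 0) -> exists z, x = dX i z.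
Proof.
have [m] := ubnP (n.+1 - p); elim: m p x => // m IHm p x npm cx nx px.
case: (ltnP n p) => [np|pn].
  exists 0; rewrite linear0; have [N /(_ N (leqnn N)) ->] := right_part_sum x.
  rewrite (eq_bigr (fun=> 0)) => [|q _]; first by rewrite big1.
  case: (ltnP q p) => [/px//|pq].
  by rewrite -nx right_part_gt // (leq_trans np).
have cpx : closed gr_d (right_part i p x).
  clear IHm; case: i x cx nx px => // i x dx0 nx px /=.
  rewrite -[RHS](linear0 (right_part i p)) -[in RHS]dx0.
  have [N xN] := right_part_sum x; have pM : (p < maxn N p.+1)%N by rewrite leq_maxr.
  rewrite {2}(xN (maxn N p.+1)) ?leq_maxl // !linear_sum (bigD1 (Ordinal pM)) //=.
  rewrite right_part_dX // eqxx big1 ?addr0 // => q; rewrite -val_eqE /= => qp.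
  case: (ltngtP q p) => [/px ->|pq|/eqP]; last by rewrite (negbTE qp).
    by rewrite !linear0.
  by rewrite right_part_dX 1?ltnW // ltn_eqF.
(* The preimage is cut down to total weight [n] and outer weight [p], so that the correction keeps
   the weight and disturbs no lower part. *)
have [z0 z0E] := gr_exact cpx; pose z := prX i.+1 n (right_part i.+1 p z0).
have zp : right_part i.+1 p z = z by rewrite /z right_part_pr right_partM eqxx.
have dz : gr_d i z = right_part i p x.
  by rewrite /z gr_d_pr gr_d_right -z0E right_partM eqxx -right_part_pr nx.
have [|||q|z' z'E] := IHm p.+1 (x - dX i z).
- by rewrite subSS; rewrite subSn // ltnS in npm.
- exact: closed_sub.
- by rewrite linearB nx -dX_pr /z (wd_id (dXd _)).
- rewrite ltnS leq_eqVlt => /orP[/eqP ->|qp].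
    by rewrite linearB -{1}zp right_part_dX // eqxx zp dz subrr.
  rewrite linearB px // -zp right_part_dX ?ltn_eqF ?subrr //.
  exact: ltnW.
by exists (z + z'); rewrite linearD -z'E addrC subrK.
Qed.

Lemma lift_exact : aug_exact dX.
Proof.
have H i x : closed dX x -> exists z, x = dX i z.
  move=> cx; apply: (wd_span (dXd i) (S := imsp (dX i))) => n.
  apply: (closed_lift (n := n) (p := 0)) => //; last exact: (wd_id (dXd i)).
  by case: i x cx => //= i x dx0; rewrite dX_pr dx0 linear0.
by split=> [z|i z dz]; apply: H.
Qed.

End Lifting.
End OneSided.

Section FreeBimoduleSides.
Variables (k : fieldType) (A : algType k) (W B L R : lmodType k).
Variables (bt : A -> W -> A -> B) (lt : A -> W -> L) (rt : W -> A -> R).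
Hypotheses (fb : free_bimodule bt) (fl : free_tensor lt) (fr : free_tensor rt).

(** The bracketing [(A (x) W) (x) A], in which the right factor can be killed. *)
Lemma bimodule_left : exists xt : L -> A -> B,
  free_tensor xt /\ forall a w b, xt (lt a w) b = bt a w b.
Proof.
have /choice[F FE] b : exists F : {linear L -> B}, forall a w, F (lt a w) = bt a w b.
  by apply: (ft_lift fl (b := fun a w => bt a w b)) => [w|a];
    [apply: (bt_linl fb)|apply: (bt_linm fb)].
exists (fun y b => F b y); split=> //; split=> [b|y c b b'|S Sx|Z g gl gr].
- exact: linearP.
- have l := lin_comb c (linearP (F b)) (linearP (F b')).
  move: y; apply: (ft_eqf fl (linearP _) l) => a w.
  by rewrite !FE; apply: (bt_linr fb).
- by apply: (bim_span fb) => a w b; rewrite -FE.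
- have [|||G GE] := bim_lift fb (b := fun a w b => g (lt a w) b).
  + by move=> w b c a a'; rewrite (ft_l fl w); apply: gl.
  + by move=> a b c w w'; rewrite (ft_r fl a); apply: gl.
  + by move=> a w; apply: gr.
  exists G => y b; move: y; apply: (ft_eqf fl (lin_comp _ _) (gl b)) => a w.
  by rewrite FE GE.
Qed.

Lemma bimodule_right : exists xt : R -> A -> B,
  free_tensor xt /\ forall a w b, xt (rt w b) a = bt a w b.
Proof.
have /choice[F FE] a : exists F : {linear R -> B}, forall w b, F (rt w b) = bt a w b.
  by apply: (ft_lift fr (b := fun w b => bt a w b)) => [b|w];
    [apply: (bt_linm fb)|apply: (bt_linr fb)].
exists (fun y a => F a y); split=> //; split=> [a|y c a a'|S Sx|Z g gl gr].
- exact: linearP.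
- have l := lin_comb c (linearP (F a)) (linearP (F a')).
  move: y; apply: (ft_eqf fr (linearP _) l) => w b.
  by rewrite !FE; apply: (bt_linl fb).
- by apply: (bim_span fb) => a w b; rewrite -FE.
- have [|||G GE] := bim_lift fb (b := fun a w b => g (rt w b) a).
  + by move=> w b; apply: gr.
  + by move=> a b c w w'; rewrite (ft_l fr b); apply: gl.
  + by move=> a w c b b'; rewrite (ft_r fr w); apply: gl.
  exists G => y a; move: y; apply: (ft_eqf fr (lin_comp _ _) (gl a)) => w b.
  by rewrite FE GE.
Qed.

End FreeBimoduleSides.

(** * The bimodule complex and its two one-sided quotients *)

Section TwoSided.
Variables (k : fieldType) (A : algType k) (eps : {linear A -> k^o}).
Hypotheses (eps1 : eps 1 = 1) (epsM : forall a b, eps (a * b) = eps a * eps b).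
Variable prA : nat -> {linear A -> A}.
Hypotheses (dA : wdecomp prA) (prA_mul : forall n i j a b,
  prA n (prA i a * prA j b) = if n == (i + j)%N then prA i a * prA j b else 0).
Hypothesis prA_0 : forall a, prA 0 a = eps a *: 1.
Variables (W : nat -> lmodType k) (prW : forall i, nat -> {linear W i -> W i}).
Hypothesis dW : forall i, wdecomp (prW i).
Variables (B : nat -> lmodType k) (bt : forall i, A -> W i -> A -> B i).
Hypothesis fb : forall i, free_bimodule (@bt i).

Lemma eps_pr n a : eps (prA n.+1 a) = 0.
Proof.
have H := prA_0 (prA n.+1 a); rewrite (wd_neq dA) // in H.
have := congr1 eps H; rewrite linear0 linearZ eps1 /= => /esym.
by rewrite [_ *: _]mulr1.
Qed.

Lemma prA_1 : prA 0 1 = 1.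
Proof. by rewrite prA_0 eps1 scale1r. Qed.

Lemma prA_augl j p a b : (j <= p)%N -> eps b = 0 -> prA j (prA p a * b) = 0.
Proof.
move=> jp eb; have [N ->] := wd_sum dA b; rewrite mulr_sumr linear_sum big1 // => l _.
have [l0|l0] := eqVneq (nat_of_ord l) 0%N; last first.
  by rewrite prA_mul ltn_eqF // (leq_ltn_trans jp) // -[X in (X < _)%N]addn0 ltn_add2l lt0n.
by rewrite l0 prA_0 eb scale0r mulr0 linear0.
Qed.

Lemma prA_augr j p a b : (j <= p)%N -> eps b = 0 -> prA j (b * prA p a) = 0.
Proof.
move=> jp eb; have [N ->] := wd_sum dA b; rewrite mulr_suml linear_sum big1 // => l _.
have [l0|l0] := eqVneq (nat_of_ord l) 0%N; last first.
  by rewrite prA_mul ltn_eqF // (leq_ltn_trans jp) // -[X in (X < _)%N]add0n ltn_add2r lt0n.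
by rewrite l0 prA_0 eb scale0r mul0r linear0.
Qed.

Definition weighted i (pr : nat -> {linear B i -> B i}) := wdecomp pr /\
  forall n p q r a w b, pr n (bt (prA p a) (prW i q w) (prA r b)) =
    if n == (p + q + r)%N then bt (prA p a) (prW i q w) (prA r b) else 0.

Lemma weighted_exists i : exists pr, @weighted i pr.
Proof.
have [prL [dL prLE]] := wd_tens (free_tensor_tens A (W i)) dA (dW i).
have [xt [fx xtE]] := bimodule_left (fb i) (free_tensor_tens A (W i)).
have [pr [dp prE]] := wd_tens fx dL dA; exists pr; split=> // n p q r a w b.
have := prE n (p + q)%N r (tpair (prA p a) (prW i q w)) b.
by rewrite prLE eqxx xtE.
Qed.

Lemma bim_spanw i (S : subspace (B i)) :
  (forall p q r a w b, S (bt (prA p a) (prW i q w) (prA r b))) -> forall x, S x.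
Proof.
move=> Sb; apply: (bim_span (fb i)) => a w b.
have [N ->] := wd_sum dA a; rewrite (lin_sum (bt_linl (fb i) w b)); apply: sp_sum => p _.
have [N' ->] := wd_sum (dW i) w; rewrite (lin_sum (bt_linm (fb i) _ b)); apply: sp_sum => q _.
have [N'' ->] := wd_sum dA b; rewrite (lin_sum (bt_linr (fb i) _ _)); apply: sp_sum => r _.
exact: Sb.
Qed.

Variable prB : forall i, nat -> {linear B i -> B i}.
Hypothesis wB : forall i, weighted (prB i).
Variable d : forall i, {linear B i.+1 -> B i}.
Hypothesis d_bim : forall i, bimodule_map (fb i.+1) (fb i) (d i).
Hypothesis dd0 : forall i x, d i (d i.+1 x) = 0.
Hypothesis d_pr : forall i n w,
  d i (bt 1 (prW i.+1 n w) 1) = prB i n (d i (bt 1 w 1)).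
Variables (u : {linear W 0%N -> A}) (m : {linear B 0%N -> A}).
Hypothesis mE : forall a w b, m (bt a w b) = a * u w * b.
Hypothesis m_d : forall x, m (d 0%N x) = 0.
Hypothesis u_pr : forall n w, u (prW 0%N n w) = prA n (u w).

(** The target of the augmentation sits at index 0 and degree [i] at index [i.+1], so that exactness
    at the augmentation needs no separate treatment. *)
Definition aug_fam (Z0 : lmodType k) (Z : nat -> lmodType k) (i : nat) : lmodType k :=
  if i is j.+1 then Z j else Z0.

Notation X := (aug_fam A B).

Definition aug_dX i : {linear X i.+1 -> X i} := match i with 0 => m | j.+1 => d j end.

Definition aug_prX i : nat -> {linear X i -> X i} :=
  match i with 0 => prA | j.+1 => prB j end.

Lemma aug_dX_dX i x : aug_dX i (aug_dX i.+1 x) = 0.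
Proof. by case: i x => [|i] x; [apply: m_d|apply: dd0]. Qed.

Lemma aug_prX_dec i : wdecomp (aug_prX i).
Proof. by case: i => [//|i]; apply: (wB i).1. Qed.

Lemma prB_act i n p q r a x b :
  prB i n (lact (fb i) (prA p a) (ract (fb i) (prA r b) (prB i q x))) =
    if n == (p + q + r)%N then lact (fb i) (prA p a) (ract (fb i) (prA r b) (prB i q x))
    else 0.
Proof.
pose f : {linear B i -> B i} := lact (fb i) (prA p a) \o (ract (fb i) (prA r b) \o prB i q).
have [Z ZE] : exists Z : {linear B i -> B i}, forall x, Z x =
    if n == (p + q + r)%N then f x else 0.
  by case: eqP; [exists f|exists \0].
rewrite -[LHS]/((prB i n \o f) x) -[RHS]ZE; move: x.
apply: (bim_spanw (S := equalizer (prB i n \o f) Z)) => p' q' r' a' w b' /=.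
rewrite ZE /f /= (wB i).2; case: eqP => [->|_]; last by rewrite !linear0 if_same.
rewrite ractE lactE.
have [N aaE] : exists N, prA p a * prA p' a' = prA (p + p')%N N.
  by exists (prA p a * prA p' a'); rewrite prA_mul eqxx.
have [N' bbE] : exists N', prA r' b' * prA r b = prA (r' + r)%N N'.
  by exists (prA r' b' * prA r b); rewrite prA_mul eqxx.
rewrite aaE bbE (wB i).2; congr (if _ then _ else _); congr (_ == _).
by rewrite !addnA -!addnA (addnC r').
Qed.

Lemma aug_dX_pr i n x : aug_dX i (aug_prX i.+1 n x) = aug_prX i n (aug_dX i x).
Proof.
rewrite -[LHS]/((aug_dX i \o aug_prX i.+1 n) x) -[RHS]/((aug_prX i n \o aug_dX i) x).
case: i x => [|i] x; move: x.
  apply: (bim_spanw (S := equalizer (m \o prB 0%N n) (prA n \o m))) => p q r a w b /=.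
  rewrite (wB 0).2 mE u_pr.
  have [N aaE] : exists N, prA p a * prA q (u w) = prA (p + q)%N N.
    by exists (prA p a * prA q (u w)); rewrite prA_mul eqxx.
  by rewrite aaE prA_mul -aaE -u_pr; case: ifP => _; rewrite ?linear0 // mE.
apply: (bim_spanw (S := equalizer (d i \o prB i.+1 n) (prB i n \o d i))) => p q r a w b /=.
rewrite (wB i.+1).2 (bt_act (fb i.+1)) (d_bim i).1 (d_bim i).2 d_pr prB_act.
by case: ifP => _; rewrite ?linear0 // -d_pr -(d_bim i).2 -(d_bim i).1.
Qed.

Section Left.
Variables (L : nat -> lmodType k) (lt : forall i, A -> W i -> L i).
Hypothesis fl : forall i, free_tensor (@lt i).
Notation Y := (aug_fam k^o L).

Definition left_xt i : Y i -> A -> X i := match i with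
  | 0 => fun c a => (c : k) *: a
  | j.+1 => projT1 (cid (bimodule_left (fb j) (fl j))) end.

Lemma left_xtE i a w b : @left_xt i.+1 (lt a w) b = bt a w b.
Proof. exact: (projT2 (cid (bimodule_left (fb i) (fl i)))).2. Qed.

Lemma scale_free : @free_tensor k k^o A A (fun c a => (c : k) *: a).
Proof.
split=> [a c x y|c|S Sa a|Z b bl br].
- by rewrite scalerDl scalerA.
- by move=> e a b; rewrite scalerDr !scalerA mulrC.
- by rewrite -[a]scale1r; apply: Sa.
- have [F FE] := linear_pack (br 1); exists F => c a; rewrite linearZ FE /=.
  by rewrite -[in RHS](mulr1 c) -[c * 1]addr0 (bl a) (lin0 (bl a)) addr0.
Qed.

Lemma left_free i : free_tensor (@left_xt i).
Proof.
case: i => [|i]; first exact: scale_free.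
exact: (projT2 (cid (bimodule_left (fb i) (fl i)))).1.
Qed.

Lemma mulr_pack (a : A) : exists F : {linear A -> A}, forall x, F x = x * a.
Proof.
have [|F FE] := @linear_pack k A A (fun x => x * a); last by exists F.
by move=> c x y; rewrite mulrDl scalerAl.
Qed.

Lemma mull_pack (a : A) : exists F : {linear A -> A}, forall x, F x = a * x.
Proof.
have [|F FE] := @linear_pack k A A (fun x => a * x); last by exists F.
by move=> c x y; rewrite mulrDr scalerAr.
Qed.

Definition left_act i (a : A) : {linear X i -> X i} := match i with
  0 => projT1 (cid (mulr_pack a)) | j.+1 => ract (fb j) a end.

Lemma left_act0 a x : left_act 0 a x = x * a.
Proof. exact: (projT2 (cid (mulr_pack a))). Qed.

Lemma left_actE i a y b : left_act i a (left_xt y b) = left_xt y (b * a).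
Proof.
case: i y => [|i] y; first by rewrite left_act0 /= scalerAl.
have l1 : linear (fun y => left_act i.+1 a (@left_xt i.+1 y b)).
  by move=> c y1 y2; rewrite (ft_l (left_free i.+1) b) linearP.
move: y; apply: (ft_eqf (fl i) l1 (ft_l (left_free i.+1) (b * a))) => x w.
by rewrite !left_xtE /= ractE.
Qed.

Lemma left_act_mul i a b x : left_act i a (left_act i b x) = left_act i (b * a) x.
Proof. by case: i x => [|i] x; [rewrite !left_act0 mulrA|apply: ract_mul]. Qed.

Lemma left_act_linear i x : linear (fun a => left_act i a x).
Proof.
case: i x => [|i] x; last exact: ract_linear.
by move=> c a b; rewrite !left_act0 mulrDr scalerAr.
Qed.

Lemma left_dX_act i a x : aug_dX i (left_act i.+1 a x) = left_act i a (aug_dX i x).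
Proof.
case: i x => [|i] x; last exact: (d_bim i).2.
rewrite left_act0.
have l : linear (fun x => m x * a) by move=> c v w; rewrite linearP mulrDl scalerAl.
move: x; apply: (bim_eqf (fb 0) (lin_comp _ _) l) => x w b.
by rewrite ractE !mE mulrA.
Qed.

Lemma epsMC a b : eps (b * a) = eps a * eps b. Proof. by rewrite epsM mulrC. Qed.

Definition left_dY i : {linear Y i.+1 -> Y i} :=
  dY 1 eps left_free aug_dX i.

Lemma left_dY_theta i x : left_dY i (theta eps left_free i.+1 x) =
  theta eps left_free i (aug_dX i x).
Proof.
exact: (dY_theta (op := fun a b => b * a) (@mul1r A) eps1 epsMC left_free left_actE left_dX_act).
Qed.

Lemma left_dY_dY i x : left_dY i (left_dY i.+1 x) = 0.
Proof.
by rewrite [in left_dY i.+1 x]/left_dY dYE left_dY_theta aug_dX_dX linear0.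
Qed.

Definition bim_exact := aug_exact (Z := X) aug_dX.
Definition left_exact := aug_exact (Z := Y) left_dY.

Definition prk (n : nat) : {linear k^o -> k^o} := if n is 0%N then idfun else \0.

Lemma prk_dec : wdecomp prk.
Proof.
split; first by case=> [|n] [|l] x //=; rewrite if_same.
by move=> x; exists 1%N => -[] // M _; rewrite big_ord_recl /= big1 ?addr0.
Qed.

Lemma prk_scale n p q (c : k^o) a :
  prA n ((prk p c : k) *: prA q a) = if n == (p + q)%N then (prk p c : k) *: prA q a else 0.
Proof.
rewrite linearZ /= dA.1; case: p => [|p] /=; last by rewrite !scale0r if_same.
by case: eqP => _; rewrite ?scaler0.
Qed.

Section LeftWeights.
Variable prL : forall i, nat -> {linear L i -> L i}.
Hypothesis dL : forall i, wdecomp (prL i).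
Hypothesis prLE : forall i n p q a w, prL i n (lt (prA p a) (prW i q w)) =
  if n == (p + q)%N then lt (prA p a) (prW i q w) else 0.

Definition left_prY i : nat -> {linear Y i -> Y i} :=
  match i with 0 => prk | j.+1 => prL j end.

Lemma left_prY_dec i : wdecomp (left_prY i).
Proof. by case: i => [|i]; [apply: prk_dec|apply: dL]. Qed.

Lemma left_prXE i n p r y b : aug_prX i n (left_xt (left_prY i p y) (prA r b)) =
  if n == (p + r)%N then left_xt (left_prY i p y) (prA r b) else 0.
Proof.
case: i y => [|i] y; first exact: prk_scale.
have [f fE] := linear_pack (ft_l (left_free i.+1) (prA r b)).
have [Z ZE] : exists Z : {linear L i -> B i}, forall y, Z y =
    if n == (p + r)%N then f (prL i p y) else 0.
  by case: eqP; [exists (f \o prL i p)|exists \0].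
rewrite -fE -ZE -[LHS]/((prB i n \o (f \o prL i p)) y); move: y.
apply: (ft_spanw (S := equalizer (prB i n \o (f \o prL i p)) Z) (fl i) dA (dW i)).
move=> q q' a w /=; rewrite ZE fE prLE; case: (p =P _) => [->|_].
  by rewrite left_xtE (wB i).2.
by rewrite -fE !linear0 if_same.
Qed.

Lemma left_dY_pr i n y : left_dY i (left_prY i.+1 n y) = left_prY i n (left_dY i y).
Proof.
exact: (dY_pr (dX := aug_dX) left_free dA left_prY_dec left_prXE aug_dX_pr eps_pr prA_1).
Qed.

Lemma left_bim_exact_lift : left_exact -> bim_exact.
Proof.
exact: (lift_exact (op := fun a b => b * a) (act := left_act)
  (@mul1r A) eps1 epsMC left_actE left_dX_act aug_dX_dX dA left_prY_dec aug_prX_dec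
  left_prXE aug_dX_pr eps_pr prA_1 prA_augr).
Qed.

End LeftWeights.

Lemma left_weights i : exists prL : nat -> {linear L i -> L i},
  wdecomp prL /\ forall n p q a w, prL n (lt (prA p a) (prW i q w)) =
    if n == (p + q)%N then lt (prA p a) (prW i q w) else 0.
Proof. exact: (wd_tens (fl i) dA (dW i)). Qed.

(** The bimodule complex is the left complex tensored with [A], index 0 being [A = k (x) A], so the
    comparison of a complex [Y (x) A] with its reduction applies in both directions. The right
    action is an action of the opposite algebra, whence the reversed product as [op]. *)
Lemma left_bim_exact : left_exact <-> bim_exact.
Proof.
split; last first.
  move=> ex; apply: (quotient_exact (op := fun a b => b * a) (act := left_act)
    (@mul1r A) eps1 epsMC left_free left_actE left_act_mul left_act_linear left_dX_act
    aug_dX_dX ex).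
  by move=> i x; case: i x => [|i] x; [rewrite left_act0 mulr1|apply: ract1].
exact: (left_bim_exact_lift (fun i => (projT2 (cid (left_weights i))).1)
  (fun i => (projT2 (cid (left_weights i))).2)).
Qed.

End Left.

Section Right.
Variables (L : nat -> lmodType k) (rt : forall i, W i -> A -> L i).
Hypothesis fr : forall i, free_tensor (@rt i).
Notation Y := (aug_fam k^o L).

Definition right_xt i : Y i -> A -> X i := match i with
  | 0 => fun c a => (c : k) *: a
  | j.+1 => projT1 (cid (bimodule_right (fb j) (fr j))) end.

Lemma right_xtE i a w b : @right_xt i.+1 (rt w b) a = bt a w b.
Proof. exact: (projT2 (cid (bimodule_right (fb i) (fr i)))).2. Qed.

Lemma right_free i : free_tensor (@right_xt i).
Proof.
case: i => [|i]; first exact: scale_free.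
exact: (projT2 (cid (bimodule_right (fb i) (fr i)))).1.
Qed.

Definition right_act i (a : A) : {linear X i -> X i} := match i with
  0 => projT1 (cid (mull_pack a)) | j.+1 => lact (fb j) a end.

Lemma right_act0 a x : right_act 0 a x = a * x.
Proof. exact: (projT2 (cid (mull_pack a))). Qed.

Lemma right_actE i a y b : right_act i a (right_xt y b) = right_xt y (a * b).
Proof.
case: i y => [|i] y; first by rewrite right_act0 /= scalerAr.
have l1 : linear (fun y => right_act i.+1 a (@right_xt i.+1 y b)).
  by move=> c y1 y2; rewrite (ft_l (right_free i.+1) b) linearP.
move: y; apply: (ft_eqf (fr i) l1 (ft_l (right_free i.+1) (a * b))) => w x.
by rewrite !right_xtE /= lactE.
Qed.

Lemma right_act_mul i a b x : right_act i a (right_act i b x) = right_act i (a * b) x.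
Proof. by case: i x => [|i] x; [rewrite !right_act0 mulrA|apply: lact_mul]. Qed.

Lemma right_act_linear i x : linear (fun a => right_act i a x).
Proof.
case: i x => [|i] x; last exact: lact_linear.
by move=> c a b; rewrite !right_act0 mulrDl scalerAl.
Qed.

Lemma right_dX_act i a x : aug_dX i (right_act i.+1 a x) = right_act i a (aug_dX i x).
Proof.
case: i x => [|i] x; last exact: (d_bim i).1.
rewrite right_act0.
have l : linear (fun x => a * m x) by move=> c v w; rewrite linearP mulrDr scalerAr.
move: x; apply: (bim_eqf (fb 0) (lin_comp _ _) l) => x w b.
by rewrite lactE !mE !mulrA.
Qed.

Definition right_dY i : {linear Y i.+1 -> Y i} := dY 1 eps right_free aug_dX i.

Lemma right_dY_theta i x : right_dY i (theta eps right_free i.+1 x) =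
  theta eps right_free i (aug_dX i x).
Proof.
exact: (dY_theta (op := fun a b => a * b) (@mulr1 A) eps1 epsM right_free right_actE right_dX_act).
Qed.

Lemma right_dY_dY i x : right_dY i (right_dY i.+1 x) = 0.
Proof.
by rewrite [in right_dY i.+1 x]/right_dY dYE right_dY_theta aug_dX_dX linear0.
Qed.

Definition right_exact := aug_exact (Z := Y) right_dY.

Lemma right_bim_exact : right_exact <-> bim_exact.
Proof.
split; last first.
  move=> ex; apply: (quotient_exact (op := fun a b => a * b) (act := right_act)
    (@mulr1 A) eps1 epsM right_free right_actE right_act_mul right_act_linear
    right_dX_act aug_dX_dX ex).
  by move=> i x; case: i x => [|i] x; [rewrite right_act0 mul1r|apply: lact1].
have [prL prLE] : exists prL : forall i, nat -> {linear L i -> L i}, forall i,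
    wdecomp (prL i) /\ forall n p q w a, prL i n (rt (prW i p w) (prA q a)) =
      if n == (p + q)%N then rt (prW i p w) (prA q a) else 0.
  exists (fun i => projT1 (cid (wd_tens (fr i) (dW i) dA))) => i.
  exact: (projT2 (cid (wd_tens (fr i) (dW i) dA))).
pose prY i : nat -> {linear Y i -> Y i} := match i with 0 => prk | j.+1 => prL j end.
have dYd i : wdecomp (prY i) by case: i => [|i]; [apply: prk_dec|apply: (prLE i).1].
have prXE i n p r y b : aug_prX i n (right_xt (prY i p y) (prA r b)) =
    if n == (p + r)%N then right_xt (prY i p y) (prA r b) else 0.
  case: i y => [|i] y; first exact: prk_scale.
  have [f fE] := linear_pack (ft_l (right_free i.+1) (prA r b)).
  have [Z ZE] : exists Z : {linear L i -> B i}, forall y, Z y =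
      if n == (p + r)%N then f (prL i p y) else 0.
    by case: eqP; [exists (f \o prL i p)|exists \0].
  rewrite -fE -ZE -[LHS]/((prB i n \o (f \o prL i p)) y); move: y.
  apply: (ft_spanw (S := equalizer (prB i n \o (f \o prL i p)) Z) (fr i) (dW i) dA).
  move=> q q' w a /=; rewrite ZE fE (prLE i).2; case: (p =P _) => [->|_].
    by rewrite right_xtE (wB i).2 -addnA addnC.
  by rewrite -fE !linear0 if_same.
move=> ex; exact: (lift_exact (op := fun a b => a * b) (act := right_act)
  (@mulr1 A) eps1 epsM right_actE right_dX_act aug_dX_dX dA dYd aug_prX_dec prXE
  aug_dX_pr eps_pr prA_1 prA_augl ex).
Qed.

End Right.
End TwoSided.

(** * Comparison of complexes of modules *)

Section Chains.
Variables (k : fieldType) (A : algType k).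

(* Lifting property of projective modules, phrased without the image module. *)
Definition liftable (M : lmodType A) : Prop :=
  forall (N N' : lmodType A) (d : {linear N -> N'}) (f : {linear M -> N'}),
    (forall x, exists y, f x = d y) -> exists h : {linear M -> N}, forall x, d (h x) = f x.

Definition cycle (X : nat -> lmodType A) (d : forall i, {linear X i.+1 -> X i}) i :
    X i -> Prop :=
  match i with 0 => fun=> True | j.+1 => fun z => d j z = 0 end.

Definition exact_at (X : nat -> lmodType A) (d : forall i, {linear X i.+1 -> X i}) i :=
  forall z : X i, cycle d z -> exists y, z = d i y.

Lemma cycle_d (X : nat -> lmodType A) (d : forall i, {linear X i.+1 -> X i}) i x :
  (forall i x, d i (d i.+1 x) = 0) -> cycle d (d i x).
Proof. by case: i x => [|i] x dd //=; apply: dd. Qed.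

Lemma cycleB (X : nat -> lmodType A) (d : forall i, {linear X i.+1 -> X i}) i (x y : X i) :
  cycle d x -> cycle d y -> cycle d (x - y).
Proof. by case: i x y => //= i x y dx dy; rewrite linearB dx dy subrr. Qed.

Section ChainMap.
Variables (X X' : nat -> lmodType A).
Variables (d : forall i, {linear X i.+1 -> X i}) (d' : forall i, {linear X' i.+1 -> X' i}).
Hypotheses (dd : forall i x, d i (d i.+1 x) = 0).
Hypothesis lift : forall i, liftable (X i.+1).
Variable psi0 : {linear X 0%N -> X' 0%N}.

(** The default [\0] is taken when no lift exists. The target may be exact only below some degree,
    and up to there [chain_map] shows that a lift was found. *)
Fixpoint chain i : {linear X i -> X' i} := match i with
  | 0 => psi0
  | j.+1 => match pselect (exists h : {linear X j.+1 -> X' j.+1},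
                     forall x, d' j (h x) = chain j (d j x)) with
            | left ex => projT1 (cid ex)
            | right _ => \0
            end
  end.

Lemma chain_map i : (forall j, (j < i)%N -> exact_at d' j) ->
  forall j, (j < i)%N -> forall x, d' j (chain j.+1 x) = chain j (d j x).
Proof.
move=> ex; elim=> [|j IHj] ji; rewrite [chain _.+1]/=; case: pselect => [e|nex] x.
- exact: (projT2 (cid e)).
- case: nex; apply: (lift (d := d' 0%N) (f := chain 0 \o d 0%N)) => y.
  exact: (ex 0%N ji).
- exact: (projT2 (cid e)).
- case: nex; apply: (lift (d := d' j.+1) (f := chain j.+1 \o d j.+1)) => y.
  apply: (ex j.+1 ji) => /=.
  by rewrite (IHj (ltnW ji)) dd linear0.
Qed.

Lemma chain_cycle i : (forall j, (j < i)%N -> exact_at d' j) ->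
  forall x : X i, cycle d x -> cycle d' (chain i x).
Proof.
case: i => [//|i] ex x dx; rewrite /cycle (chain_map ex) //.
by rewrite [d i x]dx linear0.
Qed.

End ChainMap.

Section Homotopy.
Variables (X : nat -> lmodType A) (d : forall i, {linear X i.+1 -> X i}).
Hypotheses (dd : forall i x, d i (d i.+1 x) = 0).
Hypothesis lift : forall i, liftable (X i.+1).
Variable e : forall i, {linear X i -> X i}.
Hypothesis e0 : forall x, e 0%N x = x.

(* [t] factors through the cycles, as [e - 1] modulo boundaries does. *)
Lemma chain_homotopy i : (forall j, (j < i)%N -> exact_at d j) ->
  (forall j, (j < i)%N -> forall x, d j (e j.+1 x) = e j (d j x)) ->
  exists t : {linear X i -> X i}, [/\ forall x, cycle d (t x),
    forall z, cycle d z -> t z = e i z - z & i = 0%N -> forall x, t x = 0].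
Proof.
elim: i => [|i IHi] ex ed; first by exists \0; split=> // z _; rewrite e0 subrr.
have [j ji|j ji x|t [tc tz t0]] := IHi; first by apply: ex; apply: ltnW.
  by apply: ed; apply: ltnW.
(* At index 0, where no lifting property is assumed, [t] vanishes and [s = 0] works; this is why the
   conclusion records that case. *)
have [s sE] : exists s : {linear X i -> X i.+1}, forall x, d i (s x) = t x.
  move: t0 {IHi tz}; have: (i < i.+1)%N by [].
  case: i t tc ex ed => [|i] t tc ex ed ii t0.
    by exists \0 => x; rewrite t0 //= linear0.
  by apply: (@lift i) => x; apply: ex ii _ (tc x).
(* The map [e - 1 - s d] lands in cycles because [d s = t], and on cycles its last term vanishes. *)
exists ((e i.+1 \- idfun) \- (s \o d i)); split=> // [x|z dz] /=.
  rewrite !linearB sE ed // tz; last exact: cycle_d.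
  by rewrite subrr.
by move: dz => /= ->; rewrite linear0 subr0.
Qed.

End Homotopy.

Section AugmentationIdeal.
Variable eps : {linear A -> k^o}.

Definition augmul (M : lmodType A) (Z : M -> Prop) : subspace (restr M) :=
  span (fun x : restr M => exists (a : A) (z : M), [/\ eps a = 0, Z z & x = a *: z]).

Lemma augmul_map (M N : lmodType A) (f : {linear M -> N}) (Z : M -> Prop) (Z' : N -> Prop) :
  (forall z, Z z -> Z' (f z)) -> forall x, augmul Z x -> augmul Z' (f x).
Proof.
move=> ZZ'; apply: (@span_min _ _ _ (presp (restr_map f) (augmul Z'))).
move=> _ [a [z [ea Zz ->]]] /=.
apply: span_sub; exists a, (f z); split; [done|exact: ZZ'|exact: linearZ].
Qed.

Lemma augmulB (M : lmodType A) (Z : M -> Prop) (x y : M) :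
  augmul Z x -> augmul Z y -> augmul Z (x - y : M).
Proof. by move=> Zx Zy; apply: (spD (S := augmul Z)) => //; apply: (spN (S := augmul Z)). Qed.

Notation all M := (fun _ : M => True).

Section Comparison.
Variables (X X' : nat -> lmodType A).
Variables (d : forall i, {linear X i.+1 -> X i}) (d' : forall i, {linear X' i.+1 -> X' i}).
Hypotheses (dd : forall i x, d i (d i.+1 x) = 0) (dd' : forall i x, d' i (d' i.+1 x) = 0).
Hypotheses (lift : forall i, liftable (X i.+1)) (lift' : forall i, liftable (X' i.+1)).
Variables (phi : forall i, {linear X i -> X' i}) (psi0 : {linear X' 0%N -> X 0%N}).
Hypotheses (phi_psi0 : forall x, phi 0 (psi0 x) = x) (psi_phi0 : forall x, psi0 (phi 0 x) = x).
Hypothesis phi_map : forall i x, d' i (phi i.+1 x) = phi i (d i x).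
Hypothesis ex' : forall i, exact_at d' i.
Variables (W : nat -> lmodType k) (gen : forall i, {linear W i -> restr (X i.+1)}).
Hypothesis gen_span : forall i (x : X i.+1), exists w, augmul (all _) (x - gen i w : X i.+1).
Hypothesis gen_inj : forall i w, augmul (cycle d (i := i)) (d i (gen i w)) -> w = 0.

Notation psi := (chain d' d psi0).

Lemma phi_cycle i x : cycle d x -> cycle d' (phi i x).
Proof. by case: i x => //= i x dx; rewrite phi_map dx linear0. Qed.

(** Modulo [A_+ X] a cycle is some [gen w]; then [d (gen w)] lies in [A_+ im d], hence in
    [A_+ ker d], and minimality gives [w = 0]. *)
Lemma cycle_augmul i (x : X i.+1) : cycle d x -> augmul (all _) x.
Proof.
move=> dx; have [w xw] := gen_span x.
suff w0 : w = 0 by move: xw; rewrite w0 linear0 [_ - _]subr0.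
apply: gen_inj; have <- : - d i (x - gen i w : X i.+1) = d i (gen i w).
  by rewrite linearB dx sub0r opprK.
apply: (spN (S := augmul _)).
by apply: (augmul_map (Z := all _)) xw => z _; apply: cycle_d.
Qed.

(* [p] in [X' i.+1] gives a cycle, resp. a boundary, of the complex [X' / A+ X']
   without its term of index 0. *)
Definition tor_cycle i (p : X' i.+1) := i = 0%N \/ augmul (all _) (d' i p).

Definition tor_boundary i (p : X' i.+1) :=
  exists q, augmul (all _) (p - d' i.+1 q : X' i.+1).

Lemma gen_tor_cycle i w : tor_cycle (phi i.+1 (gen i w)).
Proof.
case: i w => [|i] w; [by left|right]; rewrite phi_map.
apply: (augmul_map (f := phi i.+1) (Z := all _)) => //.
by apply: cycle_augmul => /=; apply: dd.
Qed.

Lemma augmul_d' i (x : X' i.+1) : augmul (all _) x -> augmul (cycle d' (i := i)) (d' i x).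
Proof. by apply: augmul_map => z _; apply: cycle_d. Qed.

Section Below.
Variable i : nat.
Hypothesis ex : forall j, (j < i)%N -> exact_at d j.

Lemma psi_map j : (j < i)%N -> forall x, d j (psi j.+1 x) = psi j (d' j x).
Proof. exact: (chain_map dd' lift' psi0 ex). Qed.

Lemma psi_cycle x : cycle d' x -> cycle d (psi i x).
Proof. exact: (chain_cycle dd' lift' psi0 ex). Qed.

(** The homotopy supplies an [A]-linear map [t] with values in cycles that agrees with [psi phi - 1]
    on cycles. Such a map sends [A_+ X] into [A_+ ker d], and at index 0 it is zero. *)
Lemma psi_phi z : cycle d z -> i = 0%N \/ augmul (all _) z ->
  augmul (cycle d (i := i)) (psi i (phi i z) - z : X i).
Proof.
move=> dz iz.
have [|t [tc tz t0]] := @chain_homotopy X d dd lift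
    (fun j => psi j \o phi j) psi_phi0 i ex.
  by move=> j ji x /=; rewrite psi_map // phi_map.
rewrite -(tz z dz); case: iz => [/t0 ->|]; first exact: (sp0 (augmul _)).
by apply: augmul_map => y _; apply: tc.
Qed.

Lemma phi_psi z : cycle d' z -> i = 0%N \/ augmul (all _) z ->
  augmul (cycle d' (i := i)) (phi i (psi i z) - z : X' i).
Proof.
move=> dz iz.
have [|t [tc tz t0]] := @chain_homotopy X' d' dd' lift'
    (fun j => phi j \o psi j) phi_psi0 i (fun j _ => ex' (i := j)).
  by move=> j ji x /=; rewrite phi_map psi_map.
rewrite -(tz z dz); case: iz => [/t0 ->|]; first exact: (sp0 (augmul _)).
by apply: augmul_map => y _; apply: tc.
Qed.

Lemma gen_pos w : i = 0%N \/ augmul (all _) (d i (gen i w)).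
Proof.
case: i w => [|j] w; [by left|right].
by apply: cycle_augmul => /=; apply: dd.
Qed.

(** Applying [d'] to the bounding relation puts [phi (d (gen w))] in [A_+ ker d']. By [psi] this
    returns to [d (gen w)] in [A_+ ker d], and minimality concludes. *)
Lemma tor_injective w : tor_boundary (phi i.+1 (gen i w)) -> w = 0.
Proof.
move=> [q qE]; apply: gen_inj.
have /augmul_d' := qE; rewrite linearB dd' subr0 phi_map.
move=> /(augmul_map (f := psi i) psi_cycle) H.
have := augmulB H (psi_phi (cycle_d _ dd) (gen_pos w)).
by rewrite opprB addrC subrK.
Qed.

(** A cycle [z] has [phi z = d' p] with [p] a cycle for Tor. Comparing [p] with the class of some
    [gen w] and returning by [psi] gives [z] up to [A_+ ker d], the input of the Nakayama lemma. *)
Lemma tor_surjective_gen :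
  (forall p : X' i.+1, tor_cycle p ->
     exists w, tor_boundary (p - phi i.+1 (gen i w) : X' i.+1)) ->
  forall z : X i, cycle d z ->
    exists w, augmul (cycle d (i := i)) (z - d i (gen i w) : X i).
Proof.
move=> surj z dz.
have iz : i = 0%N \/ augmul (all _) z.
  by case: (i) z dz => [|j] z dz; [left|right; apply: cycle_augmul].
have [p pE] := ex' (phi_cycle dz).
have pc : tor_cycle p.
  case: iz => [i0|zA]; [by left|right]; rewrite -pE.
  exact: (augmul_map (f := phi i) (Z := all _)) zA.
have [w [q wq]] := surj p pc; exists w.
have /augmul_d' := wq; rewrite linearB dd' subr0 linearB -pE phi_map -linearB.
move=> /(augmul_map (f := psi i) psi_cycle) H.
have zw : cycle d (z - d i (gen i w)) by apply: cycleB => //; apply: cycle_d.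
have iw : i = 0%N \/ augmul (all _) (z - d i (gen i w) : X i).
  case: iz => [i0|zA]; [by left|]; case: (gen_pos w) => [i0|wA]; first by left.
  by right; apply: augmulB.
have := augmulB H (psi_phi zw iw).
by rewrite opprB addrC subrK.
Qed.

End Below.

(** Exactness gives [psi (d' p) = d l], and the generator part of [l] represents the class. The
    remaining error lies in [A_+ ker d']; as [ker d' = im d'], it is [d' q] with [q] in [A_+ X']. *)
Lemma tor_surjective i (p : X' i.+1) : (forall j, exact_at d j) -> tor_cycle p ->
  exists w, tor_boundary (p - phi i.+1 (gen i w) : X' i.+1).
Proof.
move=> ex pc; have dp : cycle d' (d' i p) by apply: cycle_d.
have exi j : (j < i)%N -> exact_at d j by [].
have [l lE] := ex i _ (psi_cycle exi dp).
have [w lw] := gen_span l; exists w.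
have H1 : augmul (cycle d' (i := i)) (phi i (psi i (d' i p)) - d' i p : X' i).
  exact: phi_psi.
have H2 : augmul (cycle d' (i := i)) (phi i (d i (l - gen i w : X i.+1))).
  rewrite -phi_map; apply: augmul_d'.
  exact: (augmul_map (f := phi i.+1) (Z := all _)) lw.
have H : augmul (cycle d' (i := i)) (d' i (p - phi i.+1 (gen i w) : X' i.+1)).
  have -> : d' i (p - phi i.+1 (gen i w) : X' i.+1) =
      phi i (d i (l - gen i w : X i.+1)) - (phi i (psi i (d' i p)) - d' i p).
    rewrite [LHS]linearB (linearB (d i)) (linearB (phi i)) -lE -phi_map.
    by rewrite opprB [RHS]addrC addrA subrK.
  exact: augmulB.
have [q qA qE] : exists2 q : X' i.+1, augmul (all _) q &
    d' i (p - phi i.+1 (gen i w) : X' i.+1) = d' i q.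
  have Sc : (exists2 q : X' i.+1, augmul (all _) q & (0 : restr (X' i)) = d' i q) /\
      forall (c : k) (x y : restr (X' i)),
      (exists2 q : X' i.+1, augmul (all _) q & x = d' i q) ->
      (exists2 q : X' i.+1, augmul (all _) q & y = d' i q) ->
      exists2 q : X' i.+1, augmul (all _) q & c *: x + y = d' i q.
    split; first by exists 0; [apply: (sp0 (augmul _))|rewrite linear0].
    move=> c _ _ [q qA ->] [q' qA' ->]; exists ((c *: (q : restr _) + q') : restr _).
      exact: (spP (S := augmul _)).
    by rewrite [RHS](linearP (restr_map (d' i)) c q q').
  move: H; apply: (@span_min _ _ _ (Subspace Sc)) => _ [a [z [ea zc ->]]] /=.
  have [q ->] := ex' zc; exists (a *: q); last by rewrite linearZ.
  by apply: span_sub; exists a, q.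
have [|r rE] := ex' (i := i.+1) (z := p - phi i.+1 (gen i w) - q).
  by rewrite /cycle linearB qE subrr.
by exists r; rewrite -rE opprB addrC subrK.
Qed.

End Comparison.

End AugmentationIdeal.
End Chains.

(** * Free modules, and lifting for projective modules *)

Section FreeModule.
Variables (k : fieldType) (A : algType k) (W Z : lmodType k) (lt : A -> W -> Z).
Hypothesis ft : free_tensor lt.

(** An alias of [Z]; the universal property stays among its arguments because the action of [A] is
    constructed from it. *)
Definition free_module of free_tensor lt : Type := Z.
Notation F := (free_module ft).
HB.instance Definition _ := GRing.Zmodule.on F.

Lemma free_act_exists (a : A) : exists f : {linear Z -> Z}, forall b w, f (lt b w) = lt (a * b) w.
Proof.
apply: (ft_lift ft (b := fun b w => lt (a * b) w)) => [w c b b'|b]; last exact: (ft_r ft).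
by rewrite mulrDr -scalerAr; apply: (ft_l ft).
Qed.

Definition free_act (a : A) : {linear Z -> Z} := projT1 (cid (free_act_exists a)).

Lemma free_actE a b w : free_act a (lt b w) = lt (a * b) w.
Proof. exact: (projT2 (cid (free_act_exists a))). Qed.

Definition free_scale (a : A) (x : F) : F := free_act a x.

Fact free_scaleA a b (x : F) : free_scale a (free_scale b x) = free_scale (a * b) x.
Proof.
move: x; apply: (ft_eqf ft (lin_comp (free_act a) (free_act b)) (linearP (free_act (a * b)))).
by move=> c w; rewrite !free_actE mulrA.
Qed.

Fact free_scale1 : left_id 1 free_scale.
Proof.
apply: (ft_eqf ft (linearP (free_act 1)) (linearP idfun)) => c w.
by rewrite free_actE mul1r.
Qed.

Fact free_scaleDr : right_distributive free_scale +%R.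
Proof. by move=> a x y; apply: (linearD (free_act a)). Qed.

Lemma free_act_linear x : linear (fun a => free_act a x).
Proof.
move=> c a b; have l := lin_comb c (linearP (free_act a)) (linearP (free_act b)).
move: x; apply: (ft_eqf ft (linearP _) l) => e w.
by rewrite !free_actE mulrDl -scalerAl; apply: (ft_l ft).
Qed.

Fact free_scaleDl (x : F) : {morph free_scale^~ x : a b / a + b}.
Proof. by move=> a b; apply: (linD (free_act_linear x)). Qed.

HB.instance Definition _ := GRing.Zmodule_isLmodule.Build A F
  free_scaleA free_scale1 free_scaleDr free_scaleDl.

Lemma free_restr_scale (c : k) (x : Z) : c *: (x : restr F) = c *: x.
Proof.
rewrite -[LHS]/(free_act (c%:A) x) (linZ (free_act_linear x)).
by rewrite -[free_act 1 x]/(free_scale 1 x) free_scale1.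
Qed.

Lemma free_restr_linear (N : lmodType k) (h : {linear restr F -> N}) : linear (h : Z -> N).
Proof. by move=> c x y; rewrite -free_restr_scale; apply: (linearP h). Qed.

Lemma free_lift (N : lmodType A) (h : {linear W -> restr N}) :
  exists H : {linear F -> N}, forall a w, H (lt a w) = a *: (h w : N).
Proof.
have [w c b b'|b c w w'|H HE] := ft_lift ft (b := fun a w => (a *: (h w : N) : restr N)).
- rewrite -[RHS]/(restr_scale c (b *: (h w : N)) + b' *: (h w : N)) /restr_scale.
  by rewrite scalerDl scalerA mulr_algl.
- rewrite linearP -[RHS]/(restr_scale c (b *: (h w : N)) + b *: (h w' : N)) /restr_scale.
  rewrite scalerA mulr_algl -[c *: h w]/(restr_scale c (h w)) /restr_scale.
  by rewrite scalerDr scalerA -scalerAr mulr1.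
have lH : linear (H : F -> N).
  move=> a x y; rewrite -[LHS]/(H (free_act a x + y)) linearD; congr (_ + _ : N).
  have l1 := lin_comp H (free_act a).
  have l2 : linear (fun x : Z => (a *: (H x : N) : restr N)).
    move=> c u v; rewrite linearP -[c *: H u]/(restr_scale c (H u)) /restr_scale.
    rewrite -[RHS]/(restr_scale c (a *: (H u : N)) + a *: (H v : N)) /restr_scale.
    by rewrite scalerDr !scalerA -scalerAr mulr1 mulr_algl.
  move: x; apply: (ft_eqf ft l1 l2) => b w.
  by rewrite free_actE !HE scalerA.
pose m := GRing.isLinear.Build A F N *:%R H lH.
by exists (HB.pack_for {linear F -> N} (H : F -> N) m) => a w; rewrite -HE.
Qed.

Lemma free_linear_eq (N : lmodType A) (f g : {linear F -> N}) :
  (forall w, f (lt 1 w) = g (lt 1 w)) -> f =1 g.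
Proof.
move=> fg.
apply: (ft_eqf ft (free_restr_linear (restr_map f)) (free_restr_linear (restr_map g))).
move=> a w; rewrite -[LHS]/(f (lt a w)) -[RHS]/(g (lt a w)).
rewrite -[a]mulr1 -free_actE -[free_act a _]/(a *: (lt 1 w : F)) !linearZ /=.
by rewrite fg.
Qed.

Lemma gen_linear : linear (lt 1 : W -> restr F).
Proof. by move=> c w w'; rewrite free_restr_scale; apply: (ft_r ft). Qed.

Lemma free_liftable : liftable (F : lmodType A).
Proof.
move=> N N' d f fd; have [s sP] := linear_section (restr_map d).
have [g gE] := linear_pack gen_linear.
have [H HE] := free_lift (s \o (restr_map f \o g)).
exists H => x; rewrite -[LHS]/((d \o H) x); move: x.
apply: free_linear_eq => w /=; rewrite HE scale1r /= gE.
by have [y yE] := fd (lt 1 w); rewrite /restr_map yE; apply: sP.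
Qed.

End FreeModule.

(** A projective [P] is a direct summand of the free module [A (x) P], where lifts can be chosen on
    generators. *)
Lemma projective_liftable (k : fieldType) (A : algType k) (P : lmodType A) :
  projective P -> liftable P.
Proof.
move=> pP N N' d f fd; have ft := free_tensor_tens A (restr P).
have [p pE] := free_lift ft (idfun : {linear restr P -> restr P}).
have [|s sP] := pP _ _ p idfun; first by move=> y; exists (tpair 1 (y : restr P)); rewrite pE scale1r.
have [|h hE] := @free_liftable _ _ _ _ _ ft _ _ d (f \o p); first by move=> x; apply: fd.
by exists (h \o s) => x; rewrite /= hE /= sP.
Qed.

(** * Graded complexes: Nakayama and homogeneous lifts *)

Section Graded.
Variables (k : fieldType) (A : algType k) (eps : {linear A -> k^o}).
Hypothesis eps1 : eps 1 = 1.
Variable prA : nat -> {linear A -> A}.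
Hypothesis dA : wdecomp prA.
Hypothesis prA_0 : forall a, prA 0 a = eps a *: 1.

Record gcomplex (X : nat -> lmodType A) (d : forall i, {linear X i.+1 -> X i})
    (prX : forall i, nat -> {linear restr (X i) -> restr (X i)}) : Prop := Gcomplex {
  gc_dd : forall i x, d i (d i.+1 x) = 0;
  gc_dec : forall i, wdecomp (prX i);
  gc_d : forall i n x, d i (prX i.+1 n x) = prX i n (d i x);
  gc_act : forall i n p q (a : A) (x : X i),
    prX i n (prA p a *: (prX i q x : X i)) =
      if n == (p + q)%N then prA p a *: (prX i q x : X i) else 0 }.

Notation all M := (fun _ : M => True).

Section Complex.
Variables (X : nat -> lmodType A) (d : forall i, {linear X i.+1 -> X i}).
Variable prX : forall i, nat -> {linear restr (X i) -> restr (X i)}.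
Hypothesis gX : gcomplex d prX.

Lemma gc_act_sum i n (a : A) (x : X i) : exists N N',
  prX i n (a *: x) =
    \sum_(p < N) \sum_(q < N')
      (if n == (p + q)%N then prA p a *: (prX i q x : X i) else 0 : restr (X i)).
Proof.
have [N aE] := wd_sum dA a; have [N' xE] := wd_sum (gc_dec gX i) x; exists N, N'.
rewrite {1}aE scaler_suml (linear_sum (prX i n)) /=; apply: eq_bigr => p _.
rewrite {1}xE scaler_sumr (linear_sum (prX i n)) /=; apply: eq_bigr => q _.
exact: (gc_act gX).
Qed.

Lemma augm_weight a : eps a = 0 -> prA 0 a = 0.
Proof. by rewrite prA_0 => ->; rewrite scale0r. Qed.

Lemma augmul_pr i n (x : X i) : augmul eps (all _) x -> augmul eps (all _) (prX i n x).
Proof.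
apply: (@span_min _ _ _ (presp (prX i n) (augmul eps (all _)))) => _ [a [z [ea _ ->]]] /=.
have [N [N' ->]] := gc_act_sum n a z.
apply: (sp_sum (S := augmul _ _)) => p _; apply: (sp_sum (S := augmul _ _)) => q _.
case: ifP => _; last exact: (sp0 (augmul _ _)).
apply: span_sub; exists (prA p a), (prX i q z); split=> //.
case: (nat_of_ord p) => [|p']; first by rewrite augm_weight ?linear0.
have H := prA_0 (prA p'.+1 a); rewrite (wd_neq dA) // in H.
have := congr1 eps H; rewrite linear0 linearZ eps1 /= => /esym.
by rewrite [_ *: _]mulr1.
Qed.

(** Induction on the weight: in weight [n], a product [a x] with [a] in [A_+] involves only
    components of [x] of weight below [n], and these are boundaries already. *)
Lemma nakayama i (W : lmodType k) (gen : W -> X i.+1) :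
  (forall z : X i, cycle d z ->
     exists w, augmul eps (cycle d (i := i)) (z - d i (gen w) : X i)) ->
  exact_at d i.
Proof.
move=> H; have key n : forall z : X i, cycle d z -> exists y, prX i n z = d i y.
  have [m] := ubnP n; elim: m n => // m IHm n nm z cz.
  have [w zw] := H z cz.
  suff [y yE] : exists y, prX i n (z - d i (gen w) : X i) = d i y.
    exists (y + prX i.+1 n (gen w)); rewrite linearD (gc_d gX) -yE.
    by rewrite (linearB (prX i n)) subrK.
  move: zw; move: (z - _ : X i).
  apply: (@span_min _ _ _ (presp (prX i n) (imsp (restr_map (d i))))).
  move=> _ [a [x [ea cx ->]]] /=; have [N [N' ->]] := gc_act_sum n a x.
  apply: (sp_sum (S := imsp (restr_map (d i)))) => p _.
  apply: (sp_sum (S := imsp (restr_map (d i)))) => q _.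
  case: eqP => [npq|_]; last exact: (sp0 (imsp _)).
  have [p0|p0] := eqVneq (nat_of_ord p) 0%N.
    by rewrite p0 augm_weight // scale0r; apply: (sp0 (imsp _)).
  have [|y yE] := IHm q _ x cx.
    rewrite -ltnS (leq_trans _ nm) // npq ltnS -[X in (X < _)%N]add0n ltn_add2r lt0n //.
  by exists (prA p a *: y); rewrite yE; apply/esym; apply: (linearZ_LR (d i)).
move=> z cz; have /choice[y yE] n := key n z cz.
have [N zN] := wd_sum (gc_dec gX i) z; exists (\sum_(n < N) y n).
by rewrite zN linear_sum; apply: eq_bigr => n _.
Qed.

End Complex.

Section GradedChain.
Variables (W Z : nat -> lmodType k) (lt : forall i, A -> W i -> Z i).
Hypothesis fl : forall i, free_tensor (@lt i).
Variable prW : forall i, nat -> {linear W i -> W i}.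
Hypothesis dW : forall i, wdecomp (prW i).
Variable X0 : lmodType A.

Definition free_fam (i : nat) : lmodType A :=
  if i is j.+1 then free_module (fl j) else X0.

Variables (d : forall i, {linear free_fam i.+1 -> free_fam i}).
Variable prX : forall i, nat -> {linear restr (free_fam i) -> restr (free_fam i)}.
Hypothesis gX : gcomplex d prX.
Hypothesis prXE : forall i n p q a w,
  prX i.+1 n (lt (prA p a) (prW i q w)) =
    if n == (p + q)%N then lt (prA p a) (prW i q w) else 0.
Variables (X' : nat -> lmodType A) (d' : forall i, {linear X' i.+1 -> X' i}).
Variable prX' : forall i, nat -> {linear restr (X' i) -> restr (X' i)}.
Hypothesis gX' : gcomplex d' prX'.
Hypothesis ex' : forall i, exact_at d' i.
Variable phi0 : {linear X0 -> X' 0%N}.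
Hypothesis phi0_pr : forall n x, phi0 (prX 0 n x) = prX' 0 n (phi0 x).

Definition graded_map i (f : {linear free_fam i -> X' i}) :=
  forall n x, f (prX i n x) = prX' i n (f x).

Lemma graded_lift i (f : {linear free_fam i -> X' i}) : graded_map f ->
  (forall x, cycle d x -> cycle d' (f x)) ->
  exists g : {linear free_fam i.+1 -> X' i.+1},
    graded_map g /\ forall x, d' i (g x) = f (d i x).
Proof.
move=> fpr fc; have [s sP] := linear_section (restr_map (d' i)).
have [gn gnE] := linear_pack (gen_linear (fl i)).
pose h0 : {linear W i -> restr (X' i.+1)} := s \o (restr_map f \o (restr_map (d i) \o gn)).
have h0E w : d' i (h0 w) = f (d i (lt 1 w)).
  have [y yE] := ex' (fc _ (cycle_d (lt 1 w : free_fam i.+1) (gc_dd gX))).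
  by rewrite /h0 /= gnE /restr_map yE; apply: (sP y).
(* The lift [h0] ignores weights. On generators of weight [n] it is replaced by its part of weight
   [n], which is still a lift because [d'] preserves weights. *)
have [h hE] := wd_glue (dW i) (fun n => prX' i.+1 n \o h0).
have prW1 n w : prX i.+1 n (lt 1 (prW i n w)) = lt 1 (prW i n w).
  have <- : prA 0 1 = 1 by rewrite prA_0 eps1 scale1r.
  by rewrite prXE eqxx.
have hd w : d' i (h w) = f (d i (lt 1 w)).
  have [N ->] := wd_sum (dW i) w.
  rewrite linear_sum /= (linear_sum (d' i)) (lin_sum (ft_r (fl i) 1)).
  rewrite (linear_sum (d i)) (linear_sum f); apply: eq_bigr => n _.
  by rewrite hE /= (gc_d gX') h0E -{2}prW1 (gc_d gX) fpr.
have [g gE] := free_lift (fl i) h; exists g; split=> [n x|]; last first.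
  have H : (d' i \o g) =1 (f \o d i) by apply: free_linear_eq => w /=; rewrite gE scale1r hd.
  exact: H.
have [l1 l1E] := linear_pack (free_restr_linear (restr_map g \o prX i.+1 n)).
have [l2 l2E] := linear_pack (free_restr_linear (prX' i.+1 n \o restr_map g)).
rewrite -[LHS]/((restr_map g \o prX i.+1 n) x) -[RHS]/((prX' i.+1 n \o restr_map g) x).
rewrite -l1E -l2E; move: x.
apply: (ft_spanw (S := equalizer l1 l2) (fl i) dA (dW i)) => p q a w.
change (l1 (lt (prA p a) (prW i q w)) = l2 (lt (prA p a) (prW i q w))).
rewrite l1E l2E /= /restr_map.
set y := lt _ _.
have -> : prX i.+1 n y = if n == (p + q)%N then y else 0 by apply: prXE.
rewrite {}/y gE hE /= (gc_act gX').
by case: ifP => _; [rewrite gE hE|rewrite linear0].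
Qed.

Fixpoint gchain i : {linear free_fam i -> X' i} := match i with
  | 0 => phi0
  | j.+1 => match pselect (exists h : {linear free_fam j.+1 -> X' j.+1},
                     graded_map h /\ forall x, d' j (h x) = gchain j (d j x)) with
            | left ex => projT1 (cid ex)
            | right _ => \0
            end
  end.

Lemma gchainP i : graded_map (gchain i) /\
  forall x, d' i (gchain i.+1 x) = gchain i (d i x).
Proof.
suff H : graded_map (gchain i) /\ forall x, cycle d x -> cycle d' (gchain i x).
  split; first exact: H.1.
  rewrite [gchain _.+1]/=; case: pselect => [e|nex].
    exact: (projT2 (cid e)).2.
  by case: nex; apply: graded_lift H.1 H.2.
elim: i => [//|i [gi ci]]; have [g gP] := graded_lift gi ci.
have H : graded_map (gchain i.+1) /\ forall x, d' i (gchain i.+1 x) = gchain i (d i x).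
  rewrite [gchain _.+1]/=; case: pselect => [e|nex]; first exact: (projT2 (cid e)).
  by case: nex; exists g.
by split=> [|x dx]; [exact: H.1|rewrite /cycle H.2 [d i x]dx linear0].
Qed.

End GradedChain.
End Graded.

(** * Tensor products over [A] and reduction modulo [A_+] *)

Section BalancedTensor.
Variables (k : fieldType) (A : Type) (M N : lmodType k).
Variables (r : M -> A -> M) (l : A -> N -> N).

Lemma tApairl_linear n : linear (fun m => tApair r l m n).
Proof.
by move=> c m m'; rewrite /tApair (tpairl_linear n) class_linear.
Qed.

Lemma tApairr_linear m : linear (tApair r l m).
Proof. by move=> c n n'; rewrite /tApair (tpairr_linear m) class_linear. Qed.

Lemma tApairA m a n : tApair r l (r m a) n = tApair r l m (l a n).
Proof. by apply/class_eq/span_sub; exists m, a, n. Qed.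

Lemma tensA_span (S : subspace (tensA r l)) :
  (forall m n, S (tApair r l m n)) -> forall z, S z.
Proof.
move=> Sp z; rewrite -[z]class_repr.
pose f := class (span (balanced_rel r l)).
have H t : presp f S t by apply: tens_span t => m n; apply: Sp.
exact: H.
Qed.

Lemma tensA_lift (Z : lmodType k) (b : M -> N -> Z) :
  (forall n, linear (b^~ n)) -> (forall m, linear (b m)) ->
  (forall m a n, b (r m a) n = b m (l a n)) ->
  exists F : {linear tensA r l -> Z}, forall m n, F (tApair r l m n) = b m n.
Proof.
move=> bl br ba; have [f fE] := tens_lift bl br.
have fS x : span (balanced_rel r l) x -> f x = 0.
  move: x; apply: (@span_min _ _ _ (kersp f)) => _ [m [a [n ->]]] /=.
  by rewrite linearB !fE ba subrr.
pose F (q : tensA r l) : Z := f (repr q).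
have FE t : F (class _ t) = f t.
  apply/eqP; rewrite -subr_eq0 -linearB; apply/eqP/fS/class_eq.
  exact: class_repr.
have lF : linear F.
  move=> c x y; rewrite -[x]class_repr -[y]class_repr -class_linear !FE.
  exact: linearP.
have [G GE] := linear_pack lF; exists G => m n.
by rewrite GE /tApair FE fE.
Qed.

End BalancedTensor.

Section TensTriv.
Variables (k : fieldType) (A : algType k) (E : presentation A) (M : lmodType A).

Definition eps : {linear A -> k^o} := aug E.

Definition cl (p : restr M) : tensA (triv_r E) (@restr_lact k A M) :=
  tApair (triv_r E) (@restr_lact k A M) 1 p.

Lemma cl_linear : linear cl.
Proof. exact: tApairr_linear. Qed.

Lemma cl_scale c p : tApair (triv_r E) (@restr_lact k A M) c p = cl (c *: p).
Proof.
rewrite (linZ cl_linear) -(linZ (tApairl_linear (M := k^o) _ _ p)) /=.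
by rewrite [_ *: _]mulr1.
Qed.

Lemma cl_surj z : exists p, z = cl p.
Proof.
have [f fE] := linear_pack cl_linear.
have H x : imsp f x.
  by apply: tensA_span x => c p; exists (c *: p); rewrite fE cl_scale.
by have [p ->] := H z; exists p; rewrite fE.
Qed.

(** Together with [cl_surj] this identifies [k (x)_A M] with [M / A_+ M]. The inverse map is well
    defined because [a] acts on the quotient by the scalar [eps a]. *)
Lemma cl_eq0 p : cl p = 0 <-> augmul eps (fun _ : M => True) p.
Proof.
split=> [p0|]; last first.
  have [f fE] := linear_pack cl_linear; rewrite -fE.
  apply: (@span_min _ _ _ (kersp f)) => _ [a [x [ea _ ->]]] /=; rewrite fE.
  rewrite -[a *: x]/(restr_lact a x) -[LHS]tApairA /triv_r.
  rewrite -[aug E a]/(eps a) ea mulr0; exact: (lin0 (tApairl_linear (M := k^o) _ _ _)).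
pose Q := augmul eps (fun _ : M => True).
have [n c u v|m c u v|c a x|F FE] := @tensA_lift k A k^o (restr M) (triv_r E)
    (@restr_lact k A M) (quotsp Q) (fun c p => class Q (c *: p)).
- by rewrite scalerDl -linearP scalerA.
- by rewrite scalerDr -linearP !scalerA mulrC.
- apply/class_eq.
  have -> : (triv_r E c a : k) *: x - (c : k) *: restr_lact a x =
      - ((c : k) *: ((a - (eps a : k) *: 1) *: (x : M) : restr M)).
    rewrite scalerBl -[_%:A *: (x : M)]/((eps a : k) *: x) scalerBr opprB.
    by rewrite scalerA.
  apply: spN; apply: spZ; apply: span_sub; exists (a - (eps a : k) *: 1), x; split=> //.
  by rewrite linearB linearZ /= /eps rmorph1 [_ *: _]mulr1 subrr.
by move: p0; rewrite /cl => /(congr1 F); rewrite FE scale1r linear0 => /class_eq0.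
Qed.

End TensTriv.

(** * Tor *)

Lemma wd_morph (k : fieldType) (V W : lmodType k) (prV : nat -> {linear V -> V})
    (prW : nat -> {linear W -> W}) (f : {linear V -> W}) :
  wdecomp prV -> wdecomp prW -> (forall n x, prV n x = x -> prW n (f x) = f x) ->
  forall n x, f (prV n x) = prW n (f x).
Proof.
move=> dV dW fP n x; move: x.
apply: (wd_eq dV (f := f \o prV n) (g := prW n \o f)) => m x /=.
rewrite dV.1 -(fP m (prV m x)) ?(wd_id dV) // dW.1.
by case: eqP => _; rewrite ?linear0 // fP ?(wd_id dV).
Qed.

Section ResolutionFamily.
Variables (k : fieldType) (A : algType k) (E : presentation A) (P : graded_resolution E).
Variable prA : nat -> {linear A -> A}.
Hypothesis dA : wdecomp prA.
Hypothesis prA_0 : forall a, prA 0 a = eps E a *: 1.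
Hypothesis prA_gr : forall n a, Agr E n (prA n a).

Lemma eps1 : eps E 1 = 1.
Proof. exact: rmorph1. Qed.

Lemma epsM a b : eps E (a * b) = eps E a * eps E b.
Proof. exact: rmorphM. Qed.

(* Index 0 is [k] and index [i.+1] is [P_i], as in [free_fam] and [aug_fam]. *)
Definition res_fam (i : nat) : lmodType A := if i is j.+1 then res P j else triv E.

Definition res_fd (i : nat) : {linear res_fam i.+1 -> res_fam i} :=
  match i with 0 => res_aug P | j.+1 => res_d P j end.

Lemma res_fdd i x : res_fd i (res_fd i.+1 x) = 0.
Proof.
by case: i x => [|i] x /=; [apply/res_exact0|apply/res_exact]; exists x.
Qed.

Lemma res_fam_exact i : exact_at res_fd i.
Proof.
case: i => [|[|i]] z /=; last 2 first.
- by move=> /res_exact0.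
- by move=> /res_exact.
by move=> _; have [x <-] := res_aug_surj P z; exists x.
Qed.

Lemma res_fam_liftable i : liftable (res_fam i.+1).
Proof. exact/projective_liftable/res_proj. Qed.

Definition triv_pr (n : nat) : {linear restr (triv E) -> restr (triv E)} :=
  if n is 0 then idfun else \0.

Lemma triv_pr_dec : wdecomp triv_pr.
Proof.
split=> [[|m] [|n] x //|x]; first by rewrite /=; case: ifP.
exists 1%N => -[//|M] _.
by rewrite big_ord_recl big1 ?addr0.
Qed.

Lemma eps_prA a n : eps E (prA n a) = if n is 0 then eps E a else 0.
Proof.
have H m : eps E (prA 0 (prA m a)) = eps E (prA m a).
  by rewrite prA_0 linearZ /= eps1 [_ *: _]mulr1.
case: n => [|n]; first by rewrite prA_0 linearZ /= eps1 [_ *: _]mulr1.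
by rewrite -H (wd_neq dA) ?linear0.
Qed.

Lemma triv_pr_act n p q a (x : triv E) :
  triv_pr n (prA p a *: (triv_pr q x : triv E)) =
    if n == (p + q)%N then prA p a *: (triv_pr q x : triv E) else 0.
Proof.
have E1 (b : A) (y : triv E) : b *: y = eps E b * y by [].
rewrite !E1 eps_prA; case: n p q => [|n] [|p] [|q] //=; rewrite ?mul0r ?mulr0 //.
all: by case: ifP.
Qed.

Lemma res_weights : exists prX : forall i, nat -> {linear restr (res_fam i) -> restr (res_fam i)},
  [/\ gcomplex prA res_fd prX, forall n x, prX 0 n x = triv_pr n x &
      forall i n x, res_gr P i n x <-> prX i.+1 n x = x].
Proof.
pose pr i := projT1 (cid (wd_grading (res_grading P i))).
have prP i : wdecomp (pr i) /\ forall n x, res_gr P i n x <-> pr i n x = x.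
  exact: (projT2 (cid (wd_grading (res_grading P i)))).
pose prX i : nat -> {linear restr (res_fam i) -> restr (res_fam i)} :=
  match i with 0 => triv_pr | j.+1 => pr j end.
have dX i : wdecomp (prX i) by case: i => [|i]; [exact: triv_pr_dec|exact: (prP i).1].
exists prX; split=> //; last by move=> i; apply: (prP i).2.
split=> [||i n x|i n p q a x]; [exact: res_fdd|exact: dX| |].
  apply: (wd_morph (f := restr_map (res_fd i)) (dX i.+1) (dX i)) => {n x} n x xn.
  have {xn} := ((prP i).2 n (x : restr (res P i))).2 xn.
  case: i x => [|i] x xn; last exact: ((prP i).2 n _).1 (res_d_gr xn).
  by case: n xn => [//|n] xn /=; rewrite /restr_map /= (res_aug_gr _ xn).
case: i x => [|i] x; first exact: triv_pr_act.
have H : res_gr P i (p + q)%N (prA p a *: (prX i.+1 q x : res P i)).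
  by apply: res_gr_act; [exact: prA_gr|apply: ((prP i).2 _ _).2; apply: (wd_id (dX i.+1))].
have {}H := ((prP i).2 _ _).1 H.
case: eqP => [-> //|/eqP npq]; rewrite -[X in prX _ _ X]H.
exact: (wd_neq (dX i.+1)).
Qed.

End ResolutionFamily.

Section TorClasses.
Variables (k : fieldType) (A : algType k) (E : presentation A) (P : graded_resolution E).
Notation C := (tor_complex P).

Lemma cplx_cl i (q : res P i.+1) : cplx_d C i (cl E q) = cl E (res_d P i q).
Proof. exact: tAmap_pair. Qed.

Lemma cl_sub i (p q : res P i) : cl E (p - q) = cl E p - cl E q.
Proof. exact: (linB (@cl_linear _ _ E (res P i))). Qed.

Lemma cycles_cl i (p : res_fam P i.+1) :
  cycles C i (cl E p) <-> tor_cycle (eps E) (res_fd P) p.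
Proof.
case: i p => [|i] p; first by split=> // _; left.
rewrite /cycles /tor_cycle /= cplx_cl; split=> [/cl_eq0|[//|]]; first by right.
by move/cl_eq0.
Qed.

Lemma boundary_cl i (p : res_fam P i.+1) :
  imsp (cplx_d C i) (cl E p) <-> tor_boundary (eps E) (res_fd P) p.
Proof.
split=> [[z]|[q /cl_eq0 qE]].
  have [q ->] := cl_surj z; rewrite cplx_cl => /eqP; rewrite -subr_eq0 -cl_sub => /eqP/cl_eq0.
  by move=> H; exists q.
exists (cl E q); rewrite cplx_cl; apply/eqP; rewrite -subr_eq0 -cl_sub; exact/eqP.
Qed.

(** Every class of Tor has such a representative, by [tor_classP], so the comparison can stay with
    elements of the resolution. *)
Definition tor_class i (p : res P i) (c : cycles C i (cl E p)) : Tor P i :=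
  class (boundaries C i) (mksub c).

Lemma tor_class_eq i (p p' : res P i) (c : cycles C i (cl E p)) (c' : cycles C i (cl E p')) :
  tor_class c = tor_class c' <-> tor_boundary (eps E) (res_fd P) (p - p' : res_fam P i.+1).
Proof.
rewrite -boundary_cl cl_sub /tor_class; split=> [/class_eq|H]; last by apply/class_eq.
by [].
Qed.

Lemma tor_class_ext i (p p' : res P i) (c : cycles C i (cl E p)) (c' : cycles C i (cl E p')) :
  p = p' -> tor_class c = tor_class c'.
Proof. by move=> pp'; congr (class _ _); apply: inc_inj; rewrite !incK pp'. Qed.

Lemma tor_classP i (h : Tor P i) : exists p (c : cycles C i (cl E p)), h = tor_class c.
Proof.
rewrite -[h]class_repr; set z := repr h.
have [p zp] := cl_surj (inc z).
have c : cycles C i (cl E p) by rewrite -zp; apply: incP.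
by exists p, c; congr (class _ _); apply: inc_inj.
Qed.

Lemma tor_class_linear (W : lmodType k) i (f : {linear W -> restr (res P i)})
    (c : forall w, cycles C i (cl E (f w))) :
  exists g : {linear W -> Tor P i}, forall w, g w = tor_class (c w).
Proof.
apply: linear_pack => a u v; rewrite /tor_class -linearP; congr (class _ _).
apply: inc_inj; rewrite inc_linear !incK linearP; exact: cl_linear.
Qed.

Lemma Tor_grP i n (h : Tor P i) : Tor_gr n h <->
  exists (x : res P i) (c : cycles C i (cl E x)), res_gr P i n x /\ h = tor_class c.
Proof.
split=> [[z zn ->]|[x [c [xn ->]]]]; last first.
  exists (mksub c) => //; apply: span_sub; exists 1, x; split=> //.
have [x xn zx] : exists2 x, res_gr P i n x & inc z = cl E x.
  have [f fE] := linear_pack (@cl_linear _ _ E (res P i)).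
  have Sc : (exists2 x, res_gr P i n x & (0 : C i) = f x) /\ forall (a : k) (u v : C i),
      (exists2 x, res_gr P i n x & u = f x) -> (exists2 x, res_gr P i n x & v = f x) ->
      exists2 x, res_gr P i n x & a *: u + v = f x.
    split; first by exists 0; [exact: sp0|rewrite linear0].
    move=> a _ _ [x xn ->] [y yn ->]; exists (a *: x + y); first exact: spP.
    by rewrite linearP.
  have [|x xn xE] := @span_min _ _ _ (Subspace Sc) _ _ zn.
    move=> _ [c [x [xn ->]]]; exists ((c : k) *: x); first exact: spZ.
    by rewrite fE cl_scale.
  by exists x => //; rewrite -fE.
have c : cycles C i (cl E x) by rewrite -zx; apply: incP.
by exists x, c; split=> //; congr (class _ _); apply: inc_inj.
Qed.

End TorClasses.

Section TorComparison.
Variables (k : fieldType) (A : algType k) (E : presentation A) (P : graded_resolution E).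
Variable prA : nat -> {linear A -> A}.
Hypothesis dA : wdecomp prA.
Hypothesis prA_0 : forall a, prA 0 a = eps E a *: 1.
Hypothesis prA_gr : forall n a, Agr E n (prA n a).
Variables (W Z : nat -> lmodType k) (lt : forall i, A -> W i -> Z i).
Hypothesis fl : forall i, free_tensor (@lt i).
Variable prW : forall i, nat -> {linear W i -> W i}.
Hypothesis dW : forall i, wdecomp (prW i).
Notation X := (free_fam fl (triv E)).
Variables (d : forall i, {linear X i.+1 -> X i}).
Variable prX : forall i, nat -> {linear restr (X i) -> restr (X i)}.
Hypothesis gX : gcomplex prA d prX.
Hypothesis prX_0 : forall n x, prX 0 n x = triv_pr E n x.
Hypothesis prXE : forall i n p q a w,
  prX i.+1 n (lt (prA p a) (prW i q w)) =
    if n == (p + q)%N then lt (prA p a) (prW i q w) else 0.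
Hypothesis gen_inj : forall i (w : W i),
  augmul (eps E) (cycle d (i := i)) (d i (lt 1 w)) -> w = 0.
Hypothesis fin : forall i n, exists s : seq (W i),
  forall w, prW i n w = w -> span (fun y => y \in s) w.

Notation all M := (fun _ : M => True).
Notation boundary p := (tor_boundary (eps E) (res_fd P) p).

(** Modulo [A_+] the tensor [a (x) w] equals [eps a] times [1 (x) w]. *)
Lemma free_gen_span i (x : X i.+1) : exists w : W i,
  augmul (eps E) (all (X i.+1)) (x - (lt 1 w : X i.+1) : X i.+1).
Proof.
have Qc : (exists w : W i, augmul (eps E) (all (X i.+1)) ((0 : X i.+1) - (lt 1 w : X i.+1) : X i.+1)) /\
    forall (c : k) (u v : Z i),
    (exists w : W i, augmul (eps E) (all (X i.+1)) ((u : X i.+1) - (lt 1 w : X i.+1) : X i.+1)) ->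
    (exists w : W i, augmul (eps E) (all (X i.+1)) ((v : X i.+1) - (lt 1 w : X i.+1) : X i.+1)) ->
    exists w : W i, augmul (eps E) (all (X i.+1))
      ((c *: u + v : Z i) - (lt 1 w : Z i)).
  split.
    exists 0; rewrite (lin0 (ft_r (fl i) 1)) [_ - _]subrr; exact: (sp0 (augmul _ _)).
  move=> c u v [w uw] [w' vw]; exists (c *: w + w').
  rewrite (ft_r (fl i) 1) opprD addrACA -scalerBr.
  have := spP (S := augmul (eps E) (all (X i.+1))) c uw vw.
  by rewrite [X in augmul _ _ (X + _)](free_restr_scale (fl i)).
have H t : @Subspace k (Z i) (fun u => exists w : W i,
    augmul (eps E) (all (X i.+1)) ((u : X i.+1) - (lt 1 w : X i.+1) : X i.+1)) Qc t.
  apply: (ft_span (fl i)) => a w /=; exists (eps E a *: w).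
  apply: span_sub; exists (a - (eps E a : k) *: 1), (lt 1 w : X i.+1); split=> //.
    by rewrite linearB linearZ /= eps1 [_ *: _]mulr1 subrr.
  rewrite -[RHS]/(free_act (fl i) (a - (eps E a : k) *: 1) (lt 1 w)) free_actE mulr1.
  by rewrite (linB (ft_l (fl i) w)) (linZ (ft_l (fl i) w)) (linZ (ft_r (fl i) 1)).
exact: H.
Qed.

Lemma graded_comparison : exists
    (prX' : forall i, nat -> {linear restr (res_fam P i) -> restr (res_fam P i)})
    (phi : forall i, {linear X i -> res_fam P i}),
  [/\ gcomplex prA (res_fd P) prX', forall i n x, res_gr P i n x <-> prX' i.+1 n x = x,
      forall x, phi 0 x = x, forall i n x, phi i (prX i n x) = prX' i n (phi i x) &
      forall i x, res_fd P i (phi i.+1 x) = phi i (d i x)].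
Proof.
have [prX' [gX' prX'_0 prX'_gr]] := res_weights P dA prA_0 prA_gr.
pose phi0 : {linear triv E -> res_fam P 0} := idfun.
have phi0P n x : phi0 (prX 0 n x) = prX' 0 n (phi0 x) by rewrite prX'_0 prX_0.
have H := gchainP (eps1 E) dA prA_0 dW gX prXE gX' (@res_fam_exact _ _ _ P) phi0P.
exists prX', (gchain d prX (res_fd P) prX' phi0); split=> // i; first exact: (H i).1.
exact: (H i).2.
Qed.

Section Phi.
Variable prX' : forall i, nat -> {linear restr (res_fam P i) -> restr (res_fam P i)}.
Variable phi : forall i, {linear X i -> res_fam P i}.
Hypothesis gX' : gcomplex prA (res_fd P) prX'.
Hypothesis prX'_gr : forall i n x, res_gr P i n x <-> prX' i.+1 n x = x.
Hypothesis phi_0 : forall x, phi 0 x = x.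
Hypothesis phi_pr : forall i n x, phi i (prX i n x) = prX' i n (phi i x).
Hypothesis phi_map : forall i x, res_fd P i (phi i.+1 x) = phi i (d i x).
Variable gen : forall i, {linear W i -> restr (X i.+1)}.
Hypothesis genE : forall i w, gen i w = lt 1 w.

Lemma gen_inj' i w : augmul (eps E) (cycle d (i := i)) (d i (gen i w)) -> w = 0.
Proof. by rewrite genE => /gen_inj. Qed.

Lemma gen_span' i (x : X i.+1) :
  exists w, augmul (eps E) (all (X i.+1)) (x - gen i w : X i.+1).
Proof. by have [w H] := free_gen_span x; exists w; rewrite genE. Qed.

(** A representative of the image of [w] under the map called [g_i] in the overview. *)
Definition class_rep i w : res P i := phi i.+1 (gen i w).

Lemma class_rep_linear i : linear (class_rep (i := i) : W i -> restr (res P i)).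
Proof.
exact: (lin_comp (restr_map (phi i.+1)) (gen i)).
Qed.

Lemma class_rep_cycle i w : tor_cycle (eps E) (res_fd P) (class_rep w : res_fam P i.+1).
Proof. exact: (gen_tor_cycle (gc_dd gX) phi_map gen_span' gen_inj'). Qed.

Lemma free_fam_liftable i : liftable (X i.+1).
Proof. exact: free_liftable. Qed.

Let psi0 : {linear res_fam P 0 -> X 0} := idfun.

Lemma class_rep_injective i w : (forall j, (j < i)%N -> exact_at d j) ->
  boundary (class_rep w : res_fam P i.+1) -> w = 0.
Proof.
move=> ex; apply: (tor_injective (gc_dd gX) (@res_fdd _ _ _ P) free_fam_liftable
  (@res_fam_liftable _ _ _ P) (psi0 := psi0) _ phi_map gen_span' gen_inj' ex).
exact: phi_0.
Qed.

Lemma class_rep_surjective_exact i : (forall j, (j < i)%N -> exact_at d j) ->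
  (forall p : res_fam P i.+1, tor_cycle (eps E) (res_fd P) p ->
     exists w, boundary (p - class_rep w : res_fam P i.+1)) -> exact_at d i.
Proof.
move=> ex surj; apply: (nakayama dA prA_0 gX (gen := gen i)).
apply: (tor_surjective_gen (gc_dd gX) (@res_fdd _ _ _ P) free_fam_liftable
  (@res_fam_liftable _ _ _ P) (psi0 := psi0) _ phi_map (@res_fam_exact _ _ _ P)
  gen_span' gen_inj' ex surj).
exact: phi_0.
Qed.

Lemma class_rep_surjective i (p : res_fam P i.+1) : (forall j, exact_at d j) ->
  tor_cycle (eps E) (res_fd P) p -> exists w, boundary (p - class_rep w : res_fam P i.+1).
Proof.
apply: (tor_surjective (@res_fdd _ _ _ P) (@res_fam_liftable _ _ _ P)
  (psi0 := psi0) _ phi_map (@res_fam_exact _ _ _ P) gen_span').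
exact: phi_0.
Qed.

Lemma class_rep_pr i n w : prX' i.+1 n (class_rep w) = class_rep (prW i n w).
Proof.
have h m v : prX i.+1 n (gen i (prW i m v)) = gen i (prW i n (prW i m v)).
  rewrite (dW i).1 !genE; have H := prXE n 0 m 1 v.
  have e : prA 0 1 = 1 by rewrite prA_0 eps1 scale1r.
  rewrite e in H; rewrite [LHS]H add0n; by case: eqP => _; rewrite ?(lin0 (ft_r (fl i) 1)).
rewrite /class_rep -phi_pr; congr (phi _ _); move: w.
exact: (wd_eq (dW i) (f := prX i.+1 n \o gen i) (g := gen i \o prW i n)).
Qed.

Lemma boundary_pr i n (p : res_fam P i.+1) : boundary p -> boundary (prX' i.+1 n p : res_fam P i.+1).
Proof.
move=> [q H]; exists (prX' i.+2 n q); rewrite (gc_d gX') -(linearB (prX' i.+1 n)).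
exact: (augmul_pr (eps1 E) dA prA_0 gX').
Qed.

(** The components of [w] of other weights represent zero classes, hence vanish by injectivity. *)
Lemma class_rep_weight i n w (x : res P i) : (forall j, (j < i)%N -> exact_at d j) ->
  res_gr P i n x -> boundary (class_rep w - x : res_fam P i.+1) -> prW i n w = w.
Proof.
move=> ex /prX'_gr xn bx; apply: (wd_ext (dW i)) => m; rewrite (dW i).1.
case: eqP => [-> //|/eqP mn]; apply/esym/(class_rep_injective ex).
have := boundary_pr m bx; rewrite (linearB (prX' i.+1 m)) class_rep_pr.
by rewrite -xn (wd_neq (gc_dec gX' i.+1)) // subr0.
Qed.

Lemma class_map i : exists g : {linear W i -> Tor P i},
  forall w (c : cycles (tor_complex P) i (cl E (class_rep w))), g w = tor_class c.
Proof.
have [f fE] := linear_pack (@class_rep_linear i).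
have c w : cycles (tor_complex P) i (cl E (f w)).
  by rewrite fE; apply/cycles_cl; apply: class_rep_cycle.
have [g gE] := tor_class_linear c; exists g => w c'.
by rewrite gE; apply: tor_class_ext; rewrite fE.
Qed.

(** In the converse direction the given isomorphisms need not be related to [g_i]; they serve to
    match the weight spaces of both sides. Injectivity of [g_i] requires exactness below [i], hence
    the strong induction on the degree. *)
Lemma tor_iff_exact : (forall j, exact_at d j) <->
  forall i, exists f : {linear Tor P i -> W i}, bijective f /\
    forall n h, Tor_gr n h <-> prW i n (f h) = f h.
Proof.
pose cw i w : cycles (tor_complex P) i (cl E (@class_rep i w)) :=
  (cycles_cl _).2 (class_rep_cycle w).
have gr0 i n : res_gr P i n 0 by apply: sp0.
have gr_class i n w (g : {linear W i -> Tor P i}) :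
    (forall w c, g w = @tor_class _ _ _ P i (class_rep w) c) ->
    prW i n w = w -> Tor_gr n (g w).
  move=> gE wn; apply/Tor_grP; exists (class_rep w), (cw i w); split; last exact: gE.
  by apply/prX'_gr; rewrite class_rep_pr wn.
have class_inj i w (g : {linear W i -> Tor P i}) :
    (forall w c, g w = @tor_class _ _ _ P i (class_rep w) c) ->
    (forall j, (j < i)%N -> exact_at d j) -> g w = 0 -> w = 0.
  move=> gE ex; rewrite -(linear0 g) (gE _ (cw i w)) (gE _ (cw i 0)) => /tor_class_eq.
  have -> : class_rep (0 : W i) = 0 by exact: (lin0 (@class_rep_linear i)).
  by rewrite subr0; apply: class_rep_injective.
split=> [ex i|iso j].
  have [g gE] := class_map i.
  have gi w : g w = 0 -> w = 0 by apply: class_inj.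
  have gs h : exists w, g w = h.
    have [p [c ->]] := tor_classP h; have pc := (cycles_cl p).1 c.
    have [w bw] := class_rep_surjective ex pc; exists w; rewrite (gE _ (cw i w)).
    by apply/esym/tor_class_eq.
  have [f fg] := linear_left_inverse gi.
  have gf : cancel f g by move=> h; have [w <-] := gs h; rewrite fg.
  exists f; split=> [|n h]; first by exists g.
  split=> [/Tor_grP[x [c [xn hx]]]|fhn]; last by rewrite -(gf h); apply: gr_class.
  apply: (class_rep_weight (fun j _ => ex j) xn); apply/tor_class_eq.
  by rewrite -hx -(gE _ (cw i _)) gf.
have [m] := ubnP j; elim: m j => // m IHm i im.
have ex j : (j < i)%N -> exact_at d j.
  by move=> ji; apply: IHm; apply: leq_trans ji _; rewrite -ltnS.
have [g gE] := class_map i; have [f [[f' fK f'K] fgr]] := iso i.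
(* [f \o g] is an injective endomorphism of [W i] that preserves weights, and finite dimension of
   each weight space makes it surjective. *)
have gs h : exists w, g w = h.
  have sn n y : prW i n y = y -> exists x, f (g x) = y.
    move=> yn; have [s sP] := fin i n.
    pose S := equalizer (prW i n) idfun.
    have [x Sx|x Sx x0|x _ <-] := @injective_surjective _ _ S s (f \o g) sP _ _ y yn.
    - by apply/fgr; apply: gr_class.
    - by apply: (class_inj i x g gE ex); apply: (can_inj fK); rewrite linear0.
    - by exists x.
  have /choice[x xE] n := sn n _ (wd_id (dW i) n (f h)).
  have [N hN] := wd_sum (dW i) (f h); exists (\sum_(n < N) x n).
  apply: (can_inj fK); rewrite hN linear_sum (linear_sum f).
  by apply: eq_bigr => n _; apply: xE.
apply: (class_rep_surjective_exact ex) => p pc.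
have c := (cycles_cl p).2 pc; have [w gw] := gs (tor_class c).
by exists w; apply/(tor_class_eq c (cw i w)); rewrite -gE.
Qed.

End Phi.

Theorem tor_iso_iff_exact : (forall j, exact_at d j) <->
  forall i, exists f : {linear Tor P i -> W i}, bijective f /\
    forall n h, Tor_gr n h <-> prW i n (f h) = f h.
Proof.
have [prX' [phi [gX' gr' phi0 phi_pr phi_map]]] := graded_comparison.
pose gen i := projT1 (cid (linear_pack (gen_linear (fl i)))).
have genE i w : gen i w = lt 1 w := projT2 (cid (linear_pack (gen_linear (fl i)))) w.
exact: (tor_iff_exact gX' gr' phi0 phi_pr phi_map genE).
Qed.

End TorComparison.

(** * Minimality of the left complex *)

Section LeftMinimal.
Variables (k : fieldType) (T : lalgType k) (X : Type) (word : seq X -> T).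
Hypothesis fw : free_words word.
Variables (R : subspace T) (J : nat -> subspace T).
Hypothesis ks : koszul_spaces word R J.
Variables (A : algType k) (E : presentation A) (pi : {linear T -> A}).
Hypotheses (piM : forall x y, pi (x * y) = pi x * pi y) (pi1 : pi 1 = 1).
Notation V := (letters word).
Notation Vn := (powsp V).
Notation Tp := (wordge word 1).
Notation full := (fullsp T).
Notation I := (mulsp (mulsp full R) full).
Hypothesis pi_ker : forall t, pi t = 0 <-> I t.
Hypothesis pi_surj : forall a, exists t, pi t = a.
Hypothesis eps_V : forall v, V v -> eps E (pi v) = 0.
Variables (L : nat -> lmodType k) (lt : forall i, A -> subsp (J i) -> L i).
Hypothesis fl : forall i, free_tensor (@lt i).
Notation C := (free_fam fl (triv E)).
Notation TJ i := (mulsp full (J i)).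

Lemma Lam_exists i : exists F : {linear T -> L i},
  forall t (c : subsp (J i)), F (t * inc c) = lt (pi t) c.
Proof.
apply: (lfree_lift (lfree_J fw ks i) (b := fun t c => lt (pi t) c)) => [c a x y|t].
  by rewrite linearP (ft_l (fl i)).
exact: (ft_r (fl i)).
Qed.

(** Here [t c] goes to [pi t (x) c]. It presents [A (x) J_i] as a quotient of [T J_i], with kernel
    [I J_i]. *)
Definition Lam i : {linear T -> L i} := projT1 (cid (Lam_exists i)).

Lemma LamE i t c (Jc : J i c) : Lam i (t * c) = lt (pi t) (mksub Jc).
Proof. by rewrite -{1}(incK Jc); apply: (projT2 (cid (Lam_exists i))). Qed.

Lemma Lam_mul i t y : TJ i y -> Lam i (t * y) = free_act (fl i) (pi t) (Lam i y).
Proof.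
move: y; apply: mulsp_eq; [|exact: lin_comp|].
  by move=> a x y; rewrite (free_mulrP fw) linearP.
by move=> s c _ Jc; rewrite mulrA !(LamE _ Jc) free_actE piM.
Qed.

Lemma Lam_surj i z : exists2 y, TJ i y & z = Lam i y.
Proof.
have Sc : (exists2 y, TJ i y & 0 = Lam i y) /\ forall (a : k) u v,
    (exists2 y, TJ i y & u = Lam i y) -> (exists2 y, TJ i y & v = Lam i y) ->
    exists2 y, TJ i y & a *: u + v = Lam i y.
  split; first by exists 0; [exact: sp0|rewrite linear0].
  move=> a _ _ [y Ty ->] [y' Ty' ->]; exists (a *: y + y'); first exact: spP.
  by rewrite linearP.
apply: (ft_span (fl i) (S := Subspace Sc)) => a c.
have [t <-] := pi_surj a; exists (t * inc c); first by apply: mulspI => //; apply: incP.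
by rewrite (LamE _ (incP c)); congr (lt _ _); apply: inc_inj.
Qed.

Lemma Lam_ker i y : TJ i y -> Lam i y = 0 -> mulsp I (J i) y.
Proof.
have [s sP] := linear_section pi.
have [a c x x'|a c x x'|G GE] := ft_lift (fl i) (b := fun a c => s a * inc c).
- by rewrite linearP mulrDl scalerAl.
- by rewrite (linearP (@inc _ _ (J i))) (free_mulrP fw).
move=> Ty y0; suff : mulsp I (J i) (y - (G \o Lam i) y) by rewrite /= y0 linear0 subr0.
rewrite -[y - _]/((idfun \- (G \o Lam i)) y); move: y Ty {y0}; apply: mulsp_indf => t c _ Jc.
change (mulsp I (J i) (t * c - G (Lam i (t * c)))).
rewrite (LamE _ Jc) GE incK -mulrBl; apply: mulspI => //.
by apply/pi_ker; rewrite linearB sP subrr.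
Qed.

Lemma J_TJ i c : J i.+1 c -> TJ i c.
Proof.
have [[j ->]|[j ->]] := parityP i; last by move/(Jeven_sub fw ks).
by move=> /(J_oddP ks)[Vc _]; apply: mulspS Vc.
Qed.

Lemma TJ_step i y : TJ i.+1 y -> TJ i y.
Proof.
move=> Ty; apply: (mulsp_fullA fw); apply: (mulspS _ _ Ty) => // c; apply: J_TJ.
Qed.

Lemma eps_scalar (a : k) : eps E (pi a%:A) = a.
Proof. by rewrite !linearZ pi1 eps1; apply: mulr1. Qed.

Lemma eps_Tp t : Tp t -> eps E (pi t) = 0.
Proof.
have [f fE] : exists f : {linear T -> k^o}, forall x, f x = eps E (pi x).
  by exists (eps E \o pi).
rewrite -fE; apply: (@span_min _ _ _ (kersp f)) => {}t [[//|n] _ Vt] /=.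
move: t Vt; apply: (@mulsp_indf _ _ _ _ _ idfun (kersp f)) => v y Vv _ /=.
by rewrite fE piM epsM eps_V // mul0r.
Qed.

Lemma aug_lift a : eps E a = 0 -> exists2 t, Tp t & a = pi t.
Proof.
move=> a0; have [t tE] := pi_surj a; have [c [y [Ty ty]]] := Tp_split fw t.
exists y => //; rewrite -tE ty linearD; move: a0; rewrite -tE ty linearD linearZ pi1.
rewrite linearD linearZ eps1 (eps_Tp Ty) addr0 /= [_ *: _]mulr1 => ->.
by rewrite scale0r add0r.
Qed.

Variable d : forall i, {linear C i.+1 -> C i}.
Hypothesis d_0 : forall a c, d 0%N (lt a c) = eps E (a * pi (inc c)).
Hypothesis d_gen : forall i w, d i.+1 (lt 1 w) = Lam i (inc w).

Lemma free_fam_klinear i : linear (d i.+1 : L i.+1 -> L i).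
Proof.
move=> c x y; rewrite -(free_restr_scale (fl i.+1)) [LHS](linearP (restr_map (d i.+1))).
exact: (congr1 (fun z : L i => z + d i.+1 y) (free_restr_scale (fl i) c (d i.+1 x))).
Qed.

(** On representatives in [T] the left differential is the inclusion of [T J_{i+1}] in [T J_i], so
    cycles can be computed inside the free algebra. *)
Lemma d_Lam i y : TJ i.+1 y -> d i.+1 (Lam i.+1 y) = Lam i y.
Proof.
move: y; apply: mulsp_eq; [|exact: linearP|].
  by move=> c u v; rewrite linearP; apply: free_fam_klinear.
move=> t c _ Jc; rewrite (LamE _ Jc) -[pi t]mulr1 -free_actE.
rewrite -[free_act _ _ _]/(pi t *: (lt 1 (mksub Jc) : C i.+2)) linearZ /= d_gen incK.
by rewrite (Lam_mul _ (J_TJ Jc)).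
Qed.

Lemma TJ_split i y : TJ i y -> exists c t, [/\ J i c, mulsp Tp (J i) t & y = c + t].
Proof.
have Sc : (exists c t, [/\ J i c, mulsp Tp (J i) t & 0 = c + t]) /\ forall (a : k) u v,
    (exists c t, [/\ J i c, mulsp Tp (J i) t & u = c + t]) ->
    (exists c t, [/\ J i c, mulsp Tp (J i) t & v = c + t]) ->
    exists c t, [/\ J i c, mulsp Tp (J i) t & a *: u + v = c + t].
  split; first by exists 0, 0; split; [exact: sp0|exact: sp0|rewrite addr0].
  move=> a _ _ [c [t [Jc Tt ->]]] [c' [t' [Jc' Tt' ->]]].
  exists (a *: c + c'), (a *: t + t'); split; try exact: spP.
  by rewrite scalerDr addrACA.
apply: (@mulsp_ind _ _ _ _ (Subspace Sc)) => s c _ Jc.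
have [a [t [Tt ->]]] := Tp_split fw s.
exists (a *: c), (t * c); split; [exact: spZ|exact: mulspI|].
by rewrite mulrDl -scalerAl mul1r.
Qed.

Lemma ideal_J_odd j y : mulsp I (J j.*2.+1) y -> mulsp (mulsp I V) (J j.*2) y.
Proof.
by rewrite (mulspA fw I); apply: mulspS => // c /(J_oddP ks)[].
Qed.

Lemma cycle_odd j (z : L j.*2.+1) : d j.*2.+1 z = 0 ->
  exists2 y, TJ j.*2.+1 y /\ mulsp I (J j.*2) y & z = Lam j.*2.+1 y.
Proof.
have [y Ty ->] := Lam_surj z; rewrite d_Lam // => y0; exists y => //; split=> //.
exact: Lam_ker (TJ_step Ty) y0.
Qed.

(** The generator part [c] of a cycle vanishes. For [j >= 1] it lies in [T_+ J_{2j} + I J_{2j-1}],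
    which [min_even] excludes since [J_{2j}] lies in [R J_{2j-2}] and [J_{2j-1}] in [V J_{2j-2}].
    For [j = 0] the augmentation reads off [c]. *)
Lemma cycle_even j (z : L j.*2) : d j.*2 z = 0 ->
  exists2 y, mulsp Tp (J j.*2) y & z = Lam j.*2 y.
Proof.
have [y Ty ->] := Lam_surj z; have [c [t [Jc Tt yE]]] := TJ_split Ty.
suff c0 : d j.*2 (Lam j.*2 y) = 0 -> c = 0.
  by move=> /c0 {c0} c0; exists t => //; rewrite yE c0 add0r.
case: j y z Ty c t Jc Tt yE => [|j] y z Ty c t Jc Tt yE.
  move: Jc; rewrite (ks_0 ks) => /onespP[a cE].
  have Ja : J 0%N a%:A by rewrite (ks_0 ks); apply/onespP; exists a.
  rewrite -[y]mulr1.
  have J1 : J 0%N 1 by rewrite (ks_0 ks); apply: onesp1.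
  rewrite (LamE _ J1) d_0 incK pi1 mulr1 yE cE !linearD eps_scalar.
  have -> : eps E (pi t) = 0.
    apply: eps_Tp; move: Tt; rewrite double0 (ks_0 ks) (mulsp1 fw); exact.
  by rewrite addr0 => ->; rewrite scale0r.
rewrite doubleS in y z Ty c t Jc Tt yE *; rewrite d_Lam // => y0.
apply: (min_even fw ks Jc); have -> : c = - t + y by rewrite yE addrC addrK.
apply: sumspI; last exact/ideal_J_odd/(Lam_ker (TJ_step Ty)).
apply: spN; apply: mulspS Tt => // x /(J_step fw ks); apply: mulspS => // r.
exact: ideal_R.
Qed.

Lemma augmul_Lam i (U : subspace T) (Z : L i -> Prop) (x : L i) :
  (forall y, U y -> TJ i y) -> (forall z, Z z -> exists2 y, U y & z = Lam i y) ->
  augmul (eps E) (Z : C i.+1 -> Prop) (x : C i.+1) -> exists2 y, mulsp Tp U y & x = Lam i y.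
Proof.
move=> UT ZU.
have Sc : (exists2 y, mulsp Tp U y & (0 : restr (C i.+1)) = Lam i y) /\
    forall (a : k) (u v : restr (C i.+1)),
    (exists2 y, mulsp Tp U y & u = Lam i y) -> (exists2 y, mulsp Tp U y & v = Lam i y) ->
    exists2 y, mulsp Tp U y & a *: u + v = Lam i y.
  split; first by exists 0; [exact: sp0|rewrite linear0].
  move=> a _ _ [y Ty ->] [y' Ty' ->]; exists (a *: y + y'); first exact: spP.
  rewrite linearP.
  exact: (congr1 (fun z : L i => z + Lam i y') (free_restr_scale (fl i) a (Lam i y))).
apply: (@span_min _ _ _ (Subspace Sc)) => _ [a [z [a0 Zz ->]]].
have [t Tt ->] := aug_lift a0; have [y Uy ->] := ZU z Zz.
exists (t * y); first exact: mulspI.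
by rewrite Lam_mul //; apply: UT.
Qed.

(** This is the strong minimality of the complex. If [U] represents the cycles of degree [j], then
    [w] lies in [T_+ U + I J_j], and the description of the cycles turns this into the sums excluded
    by [min_odd] and [min_even]. *)
Lemma gen_injective i (w : subsp (J i)) :
  augmul (eps E) (cycle d (i := i)) (d i (lt 1 w)) -> w = 0.
Proof.
case: i w => [|j] w.
  have [a wa] : exists a : k, inc w = a%:A by apply/onespP; rewrite -(ks_0 ks); apply: incP.
  rewrite d_0 mul1r wa eps_scalar => aA.
  suff a0 : a = 0 by apply: inc_inj; rewrite wa a0 scale0r linear0.
  move: aA; apply: (@span_min _ _ _ (@Subspace k (restr (triv E)) (fun x => x = 0) _)).
    split=> // c _ _ -> ->; by rewrite scaler0 addr0.
  move=> scl _ [b [z [b0 _ ->]]] /=; by rewrite -[LHS]/(eps E b * z) b0 mul0r.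
rewrite d_gen; suff H (U : subspace T) : (forall y, U y -> TJ j y) ->
    (forall z, cycle d (z : C j.+1) -> exists2 y, U y & z = Lam j y) ->
    augmul (eps E) (cycle d (i := j.+1)) (Lam j (inc w) : C j.+1) ->
    sumsp (mulsp Tp U) (mulsp I (J j)) (inc w).
  have [[m jm]|[m jm]] := parityP j; move: w H; rewrite jm => w H aw.
    have {}H := H (mulsp Tp (J m.*2)) _ _ aw.
    apply: inc_inj; rewrite linear0; apply: (min_odd fw ks (incP w)); apply: H.
      by move=> y; apply: mulspS.
    exact: cycle_even.
  have {}H := H (capsp (TJ m.*2.+1) (mulsp I (J m.*2))) _ _ aw.
  apply: inc_inj; rewrite linear0; apply: (min_even fw ks (j := m)); first exact: (incP w).
  apply: sumspS (H _ _) => [y|y|y|z cz]; last 2 first.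
  - by move=> /capspE[].
  - by have [y [Ty Iy] ->] := cycle_odd cz; exists y => //; apply/capspE.
  - by apply: mulspS => // u /capspE[].
  - exact: ideal_J_odd.
move=> UT ZU /(augmul_Lam UT ZU)[y Ty wy].
have TUJ : TJ j y by apply: (mulsp_fullA fw); apply: mulspS Ty.
have wT := J_TJ (incP w); apply/sumspP; exists y, (inc w - y); split=> //.
  apply: Lam_ker; first by apply: spD => //; apply: spN.
  by rewrite linearB wy subrr.
by rewrite addrCA subrr addr0.
Qed.

End LeftMinimal.

(** * Weights on the bimodule complex *)

Lemma wd_eq_at (k : fieldType) (V W : lmodType k) (pr : nat -> {linear V -> V}) :
  wdecomp pr -> forall (f g : V -> W) x, linear f -> linear g ->
  (forall n, f (pr n x) = g (pr n x)) -> f x = g x.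
Proof.
move=> dec f g x lf lg fg; have [N ->] := wd_sum dec x.
by rewrite (lin_sum lf) (lin_sum lg); apply: eq_bigr => n _.
Qed.

Section WeightedAlgebra.
Variables (k : fieldType) (T : lalgType k) (X : Type) (word : seq X -> T).
Hypothesis fw : free_words word.
Variable prT : nat -> {linear T -> T}.
Hypothesis dT : wdecomp prT.
Hypothesis prT_mul : forall n i j x y,
  prT n (prT i x * prT j y) = if n == (i + j)%N then prT i x * prT j y else 0.

Lemma wstable_mul (U W : subspace T) : wstable prT U -> wstable prT W ->
  wstable prT (mulsp U W).
Proof.
move=> sU sW n; apply: mulsp_indf => x y Ux Wy.
have [N ->] := wd_sum dT x; have [M ->] := wd_sum dT y.
rewrite mulr_suml linear_sum; apply: sp_sum => i _.
rewrite (lin_sum (mulr_linear fw _)) linear_sum; apply: sp_sum => j _.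
rewrite prT_mul; case: ifP => _; last exact: sp0.
by apply: mulspI; [apply: sU|apply: sW].
Qed.

Lemma wstable_cap (U W : subspace T) : wstable prT U -> wstable prT W ->
  wstable prT (capsp U W).
Proof. by move=> sU sW n x /capspE[Ux Wx]; apply/capspE; split; [apply: sU|apply: sW]. Qed.

Hypothesis prT_1 : forall n, prT n 1 = if n == 0%N then 1 else 0.

Lemma wstable_one : wstable prT (onesp T).
Proof.
move=> n x /onespP[a ->]; rewrite linearZ prT_1; apply: spZ.
by case: ifP => _; [apply: onesp1|apply: sp0].
Qed.

Lemma wstable_pow (U : subspace T) n : wstable prT U -> wstable prT (powsp U n).
Proof. by move=> sU; elim: n => [|n IHn]; [apply: wstable_one|apply: wstable_mul]. Qed.

Hypothesis prT_V : wstable prT (letters word).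
Notation V := (letters word).
Notation Vn := (powsp V).
Variables (R : subspace T) (J : nat -> subspace T).
Hypothesis ks : koszul_spaces word R J.
Variable prJ : forall i, nat -> {linear subsp (J i) -> subsp (J i)}.
Hypothesis prJE : forall i n w, inc (prJ i n w) = prT n (inc w).
Hypothesis dJ : forall i, wdecomp (prJ i).
Variables (A : algType k) (pi : {linear T -> A}).
Hypotheses (piM : forall x y, pi (x * y) = pi x * pi y) (pi1 : pi 1 = 1).
Variable prA : nat -> {linear A -> A}.
Hypothesis dA : wdecomp prA.
Hypothesis pi_pr : forall n t, pi (prT n t) = prA n (pi t).
Variables (B : nat -> lmodType k) (bt : forall i, A -> subsp (J i) -> A -> B i).
Hypothesis fb : forall i, free_bimodule (@bt i).
Variable prB : forall i, nat -> {linear B i -> B i}.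
Hypothesis wB : forall i, weighted prA prJ (@bt) (prB i).
Variable d : forall i, {linear B i.+1 -> B i}.
Hypothesis kd : kdifferential word pi fb d.
Notation trip l i m := (mulsp (mulsp (Vn l) (J i)) (Vn m)).

Lemma wstable_J i : wstable prT (J i).
Proof. by move=> n x Jx; rewrite -(incK Jx) -prJE; apply: incP. Qed.

Lemma wstable_trip l i m : wstable prT (trip l i m).
Proof. by do 2?apply: wstable_mul; do ?apply: wstable_pow => //; apply: wstable_J. Qed.

(** Checked on products of homogeneous elements: the three factors are replaced one after the other
    by their weight components. *)
Lemma Phi_pr i l m n y : trip l i m y ->
  Phi fw pi fb i l m (prT n y) = prB i n (Phi fw pi fb i l m y).
Proof.
set F := Phi fw pi fb i l m; move: y; apply: trip_eq; [exact: lin_comp|exact: lin_comp|].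
move=> x c z Vx Jc Vz.
have lmul (y1 y2 : T) : linear (fun t : T => F (prT n (y1 * t * y2))) /\
    linear (fun t : T => prB i n (F (y1 * t * y2))).
  by split=> a t t'; rewrite (free_mulrP fw) free_mullP !linearP.
apply: (wd_eq_at dT (f := fun x => F (prT n (x * c * z)))
  (g := fun x => prB i n (F (x * c * z)))) => [a t t'|a t t'|p].
- by rewrite !free_mullP !linearP.
- by rewrite !free_mullP !linearP.
apply: (wd_eq_at dT (lmul (prT p x) z).1 (lmul (prT p x) z).2) => q.
apply: (wd_eq_at dT (f := fun z => F (prT n (prT p x * prT q c * z)))
  (g := fun z => prB i n (F (prT p x * prT q c * z)))) => [a t t'|a t t'|r].
- by rewrite (free_mulrP fw) !linearP.
- by rewrite (free_mulrP fw) !linearP.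
have Vp : Vn l (prT p x) by apply: wstable_pow.
have Vr : Vn m (prT r z) by apply: wstable_pow.
have cq : prT q c = inc (prJ i q (mksub Jc)) by rewrite prJE incK.
have FE : F (prT p x * prT q c * prT r z) =
    bt (prA p (pi x)) (prJ i q (mksub Jc)) (prA r (pi z)).
  rewrite cq (PhiE fw pi fb (incP _) Vp Vr) !pi_pr.
  by congr (bt _ _ _); apply: inc_inj.
have [t tE] : exists t, prT p x * prT q c = prT (p + q)%N t.
  by exists (prT p x * prT q c); rewrite prT_mul eqxx.
rewrite FE (wB i).2 -FE tE prT_mul; case: ifP => _; by rewrite ?linear0.
Qed.

Lemma kdifferential_pr i n w : d i (bt 1 (prJ i.+1 n w) 1) = prB i n (d i (bt 1 w 1)).
Proof.
have wE (c : subsp (J i.+1)) : c = mksub (incP c) by apply: inc_inj.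
have [oi|oi] := boolP (odd i); last first.
  rewrite [prJ _ _ _]wE [in RHS](wE w) !(d_evenE fw ks pi1 kd) // linearB prJE.
  have [wl wr] := J_odd_cap ks oi (incP w).
  rewrite !Phi_pr //; first by rewrite (powsp1 fw) (mul1sp (J i)).
  by rewrite (powsp1 fw) (mulsp1 fw).
have [M [wN [wS wT]]] := J_even_dec ks oi (incP w).
rewrite [prJ _ _ _]wE [in RHS](wE w) (d_oddE fw kd (incP w) oi wS) => [|N l _]; last exact: wT.
rewrite (d_oddE fw kd (M := M) (wN := fun N => prT n (wN N)) _ oi).
- rewrite linear_sum; apply: eq_bigr => N _; rewrite linear_sum; apply: eq_bigr => l _.
  by rewrite Phi_pr //; apply: wT; rewrite -ltnS.
- by rewrite prJE {1}wS linear_sum.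
- by move=> N l _ lN; apply: wstable_trip; apply: wT.
Qed.

End WeightedAlgebra.

(** * Exactness of the left complex in terms of Tor *)

Section KoszulTor.
Variables (k : fieldType) (T : lalgType k) (X : Type) (word : seq X -> T).
Hypothesis fw : free_words word.
Variable prT : nat -> {linear T -> T}.
Hypothesis dT : wdecomp prT.
Hypothesis prT_mul : forall n i j x y,
  prT n (prT i x * prT j y) = if n == (i + j)%N then prT i x * prT j y else 0.
Hypothesis prT_1 : forall n, prT n 1 = if n == 0%N then 1 else 0.
Hypothesis prT_V : wstable prT (letters word).
Notation V := (letters word).
Notation Vn := (powsp V).
Notation full := (fullsp T).
Variables (R : subspace T) (J : nat -> subspace T).
Hypothesis ks : koszul_spaces word R J.
Notation I := (mulsp (mulsp full R) full).
Variable prJ : forall i, nat -> {linear subsp (J i) -> subsp (J i)}.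
Hypothesis prJE : forall i n w, inc (prJ i n w) = prT n (inc w).
Hypothesis dJ : forall i, wdecomp (prJ i).
Hypothesis finJ : forall i n, exists s : seq (subsp (J i)),
  forall w, prJ i n w = w -> span (fun y => y \in s) w.
Variables (A : algType k) (E : presentation A) (pi : {linear T -> A}).
Hypotheses (piM : forall x y, pi (x * y) = pi x * pi y) (pi1 : pi 1 = 1).
Hypothesis pi_ker : forall t, pi t = 0 <-> I t.
Hypothesis pi_surj : forall a, exists t, pi t = a.
Hypothesis eps_V : forall v, V v -> eps E (pi v) = 0.
Variable prA : nat -> {linear A -> A}.
Hypothesis dA : wdecomp prA.
Hypothesis prA_mul : forall n i j a b,
  prA n (prA i a * prA j b) = if n == (i + j)%N then prA i a * prA j b else 0.
Hypothesis prA_0 : forall a, prA 0 a = eps E a *: 1.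
Hypothesis prA_gr : forall n a, Agr E n (prA n a).
Hypothesis pi_pr : forall n t, pi (prT n t) = prA n (pi t).
Variables (B : nat -> lmodType k) (bt : forall i, A -> subsp (J i) -> A -> B i).
Hypothesis fb : forall i, free_bimodule (@bt i).
Variable d : forall i, {linear B i.+1 -> B i}.
Hypothesis kd : kdifferential word pi fb d.
Variables (u : {linear subsp (J 0) -> A}) (m : {linear B 0%N -> A}).
Hypothesis uE : forall w, u w = pi (inc w).
Hypothesis mE : forall a w b, m (bt a w b) = a * u w * b.
Variables (L : nat -> lmodType k) (lt : forall i, A -> subsp (J i) -> L i).
Hypothesis fl : forall i, free_tensor (@lt i).
Notation C := (free_fam fl (triv E)).
Notation dY := (left_dY (eps E) fb d m fl).
Notation Y := (aug_fam k^o L).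

Definition left_th i : {linear B i -> L i} := theta (eps E) (left_free fb fl) i.+1.
Notation th := left_th.

Lemma left_thE i a w b : th i (bt a w b) = eps E b *: lt a w.
Proof. by rewrite -(left_xtE fb fl) [LHS]thetaE. Qed.

Lemma left_th_lact i a x : th i (lact (fb i) a x) = free_act (fl i) a (th i x).
Proof.
move: x; apply: (bim_eqf (fb i) (lin_comp _ _) (lin_comp _ _)) => x w b.
by rewrite lactE !left_thE linearZ free_actE.
Qed.

Lemma left_dY0E a w : dY 0 (lt a w) = eps E (a * pi (inc w)).
Proof.
rewrite /left_dY dYE left_xtE [aug_dX _ _ _ _]mE mulr1 uE.
rewrite -[a * _ in LHS]scale1r [LHS](thetaE _ (left_free fb fl) (i := 0)).
exact: mulr1.
Qed.

Lemma left_dYE i a w : dY i.+1 (lt a w) = free_act (fl i) a (th i (d i (bt 1 w 1))).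
Proof.
by rewrite /left_dY dYE left_xtE -left_th_lact -(kdiff_bim kd i).1 lactE mulr1.
Qed.

Lemma th_LK i y : mulsp full (J i) y -> th i (LK fw ks pi fb i y) = Lam fw ks pi fl i y.
Proof.
move: y; apply: mulsp_eq; [exact: lin_comp|exact: linearP|] => t c _ Jc.
by rewrite (LKE fw ks pi fb _ Jc) left_thE (LamE _ _ _ _ _ Jc) eps1 scale1r.
Qed.

Lemma th_Phi_aug i l n y : mulsp (mulsp (Vn l) (J i)) (Vn n.+1) y ->
  th i (Phi fw pi fb i l n.+1 y) = 0.
Proof.
move: y; apply: (trip_eq (g := fun=> 0)); [exact: lin_comp| |].
  by move=> a x y; rewrite scaler0 addr0.
move=> x c z Vx Jc Vz; rewrite (PhiE fw pi fb Jc Vx Vz) left_thE.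
rewrite (eps_Tp piM eps_V) ?scale0r //.
by apply: span_sub; exists n.+1.
Qed.

(** The right factor is augmented, so of the terms in [V^l J_i V^(N - l)] only [l = N] survives, and
    the pieces [wN N] add up again to [w]. *)
Lemma left_dY_gen i w : dY i.+1 (lt 1 w) = Lam fw ks pi fl i (inc w).
Proof.
have one x : free_act (fl i) 1 x = x by exact: (@free_scale1 _ _ _ _ _ (fl i) x).
rewrite left_dYE one.
have wE : w = mksub (incP w) by apply: inc_inj.
have [oi|oi] := boolP (odd i); last first.
  rewrite [in LHS]wE (d_evenE fw ks pi1 kd) // linearB.
  have [wl wr] := J_odd_cap ks oi (incP w).
  rewrite (th_Phi_aug (l := 0) (n := 0)); last by rewrite (powsp1 fw) (mul1sp (J i)).
  rewrite subr0 (LK_Phi fw ks pi1 fb) ?(powsp1 fw) //; apply: th_LK.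
  exact: (J_TJ fw ks (incP w)).
have [M [wN [wS wT]]] := J_even_dec ks oi (incP w).
rewrite [in LHS]wE (d_oddE fw kd (incP w) oi wS) => [|N l _]; last exact: wT.
rewrite [in RHS]wS !linear_sum; apply: eq_bigr => N _.
rewrite linear_sum big_ord_recr /= big1 ?add0r => [|l _].
  have Vw : mulsp (Vn N) (J i) (wN N).
    by have := wT N N (leqnn N); rewrite subnn (mulsp1 fw).
  rewrite subnn (LK_Phi fw ks pi1 fb) //; apply: th_LK.
  by apply: mulspS Vw.
have lN : (N - l = (N - l).-1.+1)%N by rewrite prednK // subn_gt0.
rewrite lN; apply: th_Phi_aug; rewrite -lN; apply: wT; exact: ltnW.
Qed.

(** The differential [dY] was built as a [k]-linear map; the comparison with a projective resolution
    requires it as a map of left [A]-modules. *)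
Lemma left_d_exists : exists d' : forall i, {linear C i.+1 -> C i},
  (forall x, d' 0%N x = dY 0 x) /\ (forall i x, d' i.+1 x = dY i.+1 x).
Proof.
have [d0 d0E] : exists f : {linear C 1%N -> C 0%N}, forall x, f x = dY 0 x.
  have lH : linear ((dY 0 : L 0%N -> k) : C 1%N -> C 0%N).
    move=> a x y; rewrite -[LHS]/(dY 0 (free_act (fl 0%N) a x + y)) linearD; congr (_ + _ : k).
    have l2 : linear (fun x : L 0%N => eps E a * dY 0 x : k^o).
      by move=> c v w; rewrite linearP mulrDr -scalerAr.
    move: x; apply: (ft_eqf (fl 0%N) (lin_comp _ _) l2) => b w.
    by rewrite free_actE !left_dY0E -mulrA epsM.
  pose mx := GRing.isLinear.Build A (C 1%N) (C 0%N) *:%R (dY 0 : L 0%N -> k) lH.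
  by exists (HB.pack_for {linear C 1%N -> C 0%N} ((dY 0 : L 0%N -> k) : C 1%N -> C 0%N) mx).
have H i : exists f : {linear C i.+2 -> C i.+1}, forall x, f x = dY i.+1 x.
  have lH : linear ((dY i.+1 : L i.+1 -> L i) : C i.+2 -> C i.+1).
    move=> a x y; rewrite -[LHS]/(dY i.+1 (free_act (fl i.+1) a x + y)) linearD.
    congr (_ + _ : L i); rewrite -[RHS]/(free_act (fl i) a (dY i.+1 x)).
    move: x; apply: (ft_eqf (fl i.+1) (lin_comp _ _) (lin_comp _ _)) => b w.
    by rewrite free_actE !left_dYE [RHS](@free_scaleA _ _ _ _ _ (fl i)).
  pose mx := GRing.isLinear.Build A (C i.+2) (C i.+1) *:%R (dY i.+1 : L i.+1 -> L i) lH.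
  by exists (HB.pack_for {linear C i.+2 -> C i.+1} ((dY i.+1 : L i.+1 -> L i) : C i.+2 -> C i.+1) mx).
pose d' i : {linear C i.+1 -> C i} := match i with
  | 0 => d0 | j.+1 => projT1 (cid (H j)) end.
exists d'; split=> // i x; exact: (projT2 (cid (H i)) x).
Qed.

Lemma free_restr_pack (W Z : lmodType k) (l : A -> W -> Z) (f : free_tensor l) (g : {linear Z -> Z}) :
  exists h : {linear restr (free_module f) -> restr (free_module f)}, forall x, h x = g x.
Proof.
have [|h hE] := @linear_pack _ (restr (free_module f)) (restr (free_module f)) g; last by exists h.
move=> c x y; rewrite (free_restr_scale f) linearP.
exact: (congr1 (fun z : Z => z + g y) (esym (free_restr_scale f c (g x)))).
Qed.

Variable prB : forall i, nat -> {linear B i -> B i}.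
Hypothesis wB : forall i, weighted prA prJ (@bt) (prB i).
Variable P : graded_resolution E.

Lemma u_pr n w : u (prJ 0%N n w) = prA n (u w).
Proof. by rewrite !uE prJE pi_pr. Qed.

Lemma m_d x : m (d 0%N x) = 0.
Proof. by apply: (aug_d fw ks piM pi1 x kd) => a w b; rewrite mE uE. Qed.

Lemma koszul_dd i x : d i (d i.+1 x) = 0.
Proof. exact: (dd0 fw ks piM pi1 pi_ker kd). Qed.

Let eps_1 := eps1 E.
Let eps_M := @epsM _ _ E.

Lemma free_act_pr i (pr : nat -> {linear L i -> L i}) n p q a x :
  (forall n p q a w, pr n (lt (prA p a) (prJ i q w)) =
    if n == (p + q)%N then lt (prA p a) (prJ i q w) else 0) ->
  pr n (free_act (fl i) (prA p a) (pr q x)) =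
    if n == (p + q)%N then free_act (fl i) (prA p a) (pr q x) else 0.
Proof.
move=> prE; pose f : {linear L i -> L i} := free_act (fl i) (prA p a) \o pr q.
have [Z ZE] : exists Z : {linear L i -> L i}, forall x, Z x =
    if n == (p + q)%N then f x else 0.
  by case: eqP; [exists f|exists \0].
rewrite -[LHS]/((pr n \o f) x) -[RHS]ZE; move: x.
apply: (ft_spanw (S := equalizer (pr n \o f) Z) (fl i) dA (dJ i)) => p' q' a' w.
change (pr n (f (lt (prA p' a') (prJ i q' w))) = Z (lt (prA p' a') (prJ i q' w))).
rewrite ZE /f /= prE; case: eqP => [->|_]; last by rewrite !linear0 if_same.
rewrite free_actE; have [N aaE] : exists N, prA p a * prA p' a' = prA (p + p')%N N.
  by exists (prA p a * prA p' a'); rewrite prA_mul eqxx.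
by rewrite aaE prE addnA.
Qed.

Theorem left_exact_tor : left_exact (eps E) fb d m fl <->
  forall i, exists f : {linear Tor P i -> subsp (J i)}, bijective f /\
    forall n h, Tor_gr n h <-> prJ i n (f h) = f h.
Proof.
have [d' [d'0 d'S]] := left_d_exists.
have exE : left_exact (eps E) fb d m fl <-> forall j, exact_at d' j.
  split=> [[H0 H] [|j] z cz|H].
  - by have [y ->] := H0 z; exists y; rewrite d'0.
  - have [|y ->] := H j z; first by case: j z cz => [|j] z; rewrite /cycle ?d'0 ?d'S.
    by exists y; rewrite d'S.
  split=> [z|i z z0].
    by have [//|y ->] := H 0%N z; exists y; rewrite d'0.
  have [|y ->] := H i.+1 z; first by case: i z z0 => [|i] z; rewrite /cycle ?d'0 ?d'S.
  by exists y; rewrite d'S.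
pose prL i := projT1 (cid (left_weights dA dJ fl i)).
have dL i : wdecomp (prL i) := (projT2 (cid (left_weights dA dJ fl i))).1.
have prLE i : forall n p q a w, prL i n (lt (prA p a) (prJ i q w)) =
    if n == (p + q)%N then lt (prA p a) (prJ i q w) else 0 :=
  (projT2 (cid (left_weights dA dJ fl i))).2.
pose prC i : nat -> {linear restr (C i) -> restr (C i)} := match i with
  | 0 => triv_pr E
  | j.+1 => fun n => projT1 (cid (free_restr_pack (fl j) (prL j n))) end.
have prCE i n x : prC i.+1 n x = prL i n x :=
  projT2 (cid (free_restr_pack (fl i) (prL i n))) x.
have d_bim := kdiff_bim kd.
have d_pr := kdifferential_pr fw dT prT_mul prT_1 prT_V ks prJE pi1 pi_pr wB kd.
have dYdY i x : dY i (dY i.+1 x) = 0.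
  exact: (left_dY_dY eps_1 eps_M d_bim koszul_dd mE m_d fl).
have gX : gcomplex prA d' prC.
  split=> [i x|i|i n x|i n p q a x].
  - case: i x => [|i] x; rewrite ?d'0 !d'S; first exact: (dYdY 0%N x).
    exact: (dYdY i.+1 x).
  - case: i => [|i]; first exact: triv_pr_dec.
    split=> [n l x|x]; first by rewrite !prCE (dL i).1; case: ifP => _; rewrite ?prCE.
    have [N NP] := (dL i).2 x; exists N => M NM; rewrite [LHS](NP M NM).
    by apply: eq_bigr => n _; rewrite prCE.
  - rewrite prCE.
    have H := left_dY_pr eps_1 dA prA_mul prA_0 dJ wB d_bim d_pr mE u_pr fl dL prLE (i := i) n x.
    case: i x H => [|i] x H; last by rewrite !d'S [LHS]H prCE.
    by rewrite !d'0 [LHS]H; case: (n).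
  - case: i x => [|i] x; first exact: triv_pr_act.
    rewrite !prCE; exact: free_act_pr.
apply: (iff_trans exE).
apply: (tor_iso_iff_exact P dA prA_0 prA_gr dJ gX) => //.
  by move=> i n p q a w; rewrite prCE prLE.
apply: (gen_injective piM pi1 pi_ker pi_surj eps_V) => [a c|i w].
  by rewrite d'0 left_dY0E.
by rewrite d'S left_dY_gen.
Qed.

End KoszulTor.

(** * Weights and finiteness for presentations *)

Lemma sumsp_fam_split (k : fieldType) (V : lmodType k) (F : nat -> subspace V) x :
  sumsp_fam setT F x -> exists f : nat -> V, (forall n, F n (f n)) /\
    exists N, forall M, (N <= M)%N -> x = \sum_(n < M) f n.
Proof.
have Sc : (exists f : nat -> V, (forall n, F n (f n)) /\
      exists N, forall M, (N <= M)%N -> 0 = \sum_(n < M) f n) /\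
    forall (a : k) x y, (exists f : nat -> V, (forall n, F n (f n)) /\
      exists N, forall M, (N <= M)%N -> x = \sum_(n < M) f n) ->
    (exists f : nat -> V, (forall n, F n (f n)) /\
      exists N, forall M, (N <= M)%N -> y = \sum_(n < M) f n) ->
    exists f : nat -> V, (forall n, F n (f n)) /\
      exists N, forall M, (N <= M)%N -> a *: x + y = \sum_(n < M) f n.
  split; first by exists (fun=> 0); split=> [n|]; [exact: sp0|exists 0%N => M _; rewrite big1].
  move=> a u v [f [Ff [N fN]]] [g [Fg [N' gN]]].
  exists (fun n => a *: f n + g n); split=> [n|]; first exact: spP.
  exists (maxn N N') => M; rewrite geq_max => /andP[/fN {1}-> /gN {1}->].
  by rewrite scaler_sumr big_split.
apply: (@span_min _ _ _ (Subspace Sc)) => {}x [n _ Fx].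
exists (fun m => if m == n then x else 0); split=> [m|].
  by case: eqP => [->|_] //; apply: sp0.
exists n.+1 => M nM; rewrite (bigD1 (Ordinal nM)) //= eqxx big1 ?addr0 // => i ni.
by case: eqP => // e; case/eqP: ni; apply: val_inj.
Qed.

(* [interlace] and [Jstep] over an arbitrary algebra. *)
Section Interlace.
Variables (k : fieldType) (T : lalgType k) (V R : subspace T).

Fixpoint winterlace (Je : nat -> subspace T) (ms ns : seq nat) : subspace T :=
  match ms, ns with
  | m :: ms', n :: ns' => mulsp (mulsp (powsp V m) (Je n)) (winterlace Je ms' ns')
  | m :: _, [::] => powsp V m
  | [::], _ => onesp T
  end.

Definition wJstep (Je : nat -> subspace T) (i : nat) : subspace T :=
  capsp
    (sumsp_fam (fun N => (1 <= N)%N) (fun N =>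
       capsp_fam
         (fun nm : i.-tuple nat * i.+1.-tuple nat => sumn nm.1 = i /\ sumn nm.2 = N)
         (fun nm => winterlace Je nm.2 nm.1)))
    (powsp R i.+1).

End Interlace.

Section Spaces.
Variables (k : fieldType) (T : lalgType k) (X : Type) (word : seq X -> T).
Hypothesis fw : free_words word.
Notation V := (letters word).
Notation Vn := (powsp V).
Notation Tp := (wordge word 1).
Notation full := (fullsp T).
Variables (R : subspace T) (J : nat -> subspace T).
Hypothesis J_0 : J 0%N = onesp T.
Hypothesis J_2 : J 2%N = R.
Hypothesis J_odd : forall j, J j.*2.+1 = capsp (mulsp V (J j.*2)) (mulsp (J j.*2) V).
Hypothesis J_even : forall j, (1 <= j)%N -> J j.+1.*2 = wJstep V R (fun n => J n.*2) j.

Lemma interlace_zero (Je : nat -> subspace T) m : Je 0%N = onesp T ->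
  forall n, winterlace V Je (m :: nseq n 0%N) (nseq n 0%N) = powsp V m.
Proof.
move=> Je0 n; elim: n m => [//|n IHn] m.
rewrite -[LHS]/(mulsp (mulsp (Vn m) (Je 0%N)) (winterlace V Je (0%N :: nseq n 0%N) (nseq n 0%N))).
by rewrite IHn Je0 !(mulsp1 fw).
Qed.

Lemma Jeven_interlace j w : J j.+2.*2 w ->
  powsp R j.+2 w /\ exists M (wN : nat -> T), w = \sum_(N < M) wN N /\
  forall N l, (l <= N.+1)%N ->
    mulsp (mulsp (Vn l) (J j.+1.*2)) (Vn (N.+1 - l)) (wN N).
Proof.
rewrite (J_even (j := j.+1)) // => /capspE[wS Rw]; split=> //.
(* The exponent sum starts at 1 in the definition, so the piece of index [N] has exponent sum
   [N.+1]. *)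
pose F N := capsp_fam
  (fun nm : j.+1.-tuple nat * j.+2.-tuple nat => sumn nm.1 = j.+1 /\ sumn nm.2 = N.+1)
  (fun nm => winterlace V (fun n => J n.*2) nm.2 nm.1).
have [|f [Ff [M fM]]] := @sumsp_fam_split _ _ F w.
  move: wS; apply: span_min => x [[//|N] _ FN]; apply: span_sub; exists N => //.
exists M, f; split=> [|N l lN]; first exact: fM.
(* The first block is [V^l J_{2(j+1)}]. The remaining blocks contain only [J_0 = k], and the rest of
   the exponent sum stands right after the first block. *)
have := Ff N ([tuple of j.+1 :: nseq j 0%N], [tuple of l :: (N.+1 - l)%N :: nseq j 0%N]).
have sz n : sumn (nseq n 0%N) = 0%N by rewrite sumn_nseq mul0n.
have h1 : sumn (j.+1 :: nseq j 0%N) = j.+1 by rewrite /= sz addn0.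
have h2 : sumn (l :: (N.+1 - l)%N :: nseq j 0%N) = N.+1 by rewrite /= sz addn0 subnKC.
move=> /(_ (conj h1 h2)).
rewrite -[sp_set _ _]/(mulsp (mulsp (Vn l) (J j.+1.*2)) (winterlace V (fun n => J n.*2)
  ((N.+1 - l)%N :: nseq j 0%N) (nseq j 0%N)) (f N)).
by rewrite interlace_zero.
Qed.

(** The map of [cap_projection], applied to the middle factor, fixes [V^l U V^m] and sends
    [V^l U' V^m] into the triple product with the intersection. *)
Lemma trip_cap l m (U U' : subspace T) w :
  mulsp (mulsp (Vn l) U) (Vn m) w -> mulsp (mulsp (Vn l) U') (Vn m) w ->
  mulsp (mulsp (Vn l) (capsp U U')) (Vn m) w.
Proof.
have [f [fU fU']] := cap_projection U U'.
have [|||F FE] := @mid_lift _ _ _ _ fw _ (fun x y z => x * f y * z) l m.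
- by move=> y z a x x'; rewrite !free_mullP.
- by move=> x z a y y'; rewrite linearP (free_mulrP fw) free_mullP.
- by move=> x y; apply: (mulr_linear fw).
move=> wU wU'; have <- : F w = w.
  move: w wU {wU'}; apply: (@mulsp_indf _ _ _ _ _ idfun (equalizer F idfun)) => y z + Vz.
  have [g gE] := linear_pack (mull_linear z); rewrite -gE.
  apply: (@mulsp_indf _ _ _ _ _ g (equalizer F idfun)) => x u Vx Uu /=.
  by rewrite gE FE // fU.
move: w wU' {wU}; apply: mulsp_indf => y z + Vz.
have [g gE] := linear_pack (mull_linear z); rewrite -gE.
rewrite -[F _]/((F \o g) y); apply: mulsp_indf => x u Vx Uu.
change (mulsp (mulsp (Vn l) (capsp U U')) (Vn m) (F (g (x * u)))); rewrite gE FE //.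
by apply: mulspI => //; apply: mulspI => //; apply: fU'.
Qed.

Hypothesis R_ge2 : forall x, R x -> wordge word 2 x.
Hypothesis R_min : forall x, R x ->
  sumsp (mulsp (mulsp Tp R) full) (mulsp (mulsp full R) Tp) x -> x = 0.

(** [J_{2j+3}] is the intersection of [V J_{2j+2}] and [J_{2j+2} V], so membership in
    [V^l J_{2j+3} V^(N-l)] follows from the defining condition of the next even space at [l + 1] and
    at [l]. *)
Lemma koszul_spacesP : koszul_spaces word R J.
Proof.
split=> //.
- case=> [|[|j]] x; first by rewrite double0 J_0.
    by rewrite -[1.*2]/2%N J_2 (powsp1 fw).
  by move=> /Jeven_interlace[].
- case=> [|j] w.
    (* For [R] itself [J_1 = V], and an element of [V^(N+1)] can be cut anywhere. The component of
       length 0 is absent, whence the shift by one. *)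
    rewrite -[1.*2]/2%N J_2 => /R_ge2 /(TgeP fw) w2.
    have [M wM] := (lenp_dec fw).2 w; exists M, (fun N => lenp fw N.+1 w); split.
      by rewrite {1}(wM M.+1) // big_ord_recl w2 // add0r.
    move=> N l lN; have -> : J 0.*2.+1 = V.
      apply: subspace_eq => x; rewrite J_odd capspE J_0 (mulsp1 fw) (mul1sp V).
      by split=> [[]|].
    rewrite -(powspSr fw) -(powsp_add fw) addSn subnKC //; apply/VnP; exact: (wd_id (lenp_dec fw)).
  move=> /Jeven_interlace[_ [M [wN [-> wP]]]]; exists M, wN; split=> // N l lN.
  rewrite (J_odd j.+1); apply: trip_cap.
    have := wP N l.+1 lN; rewrite (powspSr fw) subSS.
    by rewrite (mulspA fw (Vn l)).
  have := wP N l (leqW lN); rewrite subSn // powspSl.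
  by rewrite -[in X in X -> _](mulspA fw _ V) (mulspA fw (Vn l)).
Qed.

Section Weights.
Variable prT : nat -> {linear T -> T}.
Hypothesis dT : wdecomp prT.
Hypothesis prT_mul : forall n i j x y,
  prT n (prT i x * prT j y) = if n == (i + j)%N then prT i x * prT j y else 0.
Hypothesis prT_1 : forall n, prT n 1 = if n == 0%N then 1 else 0.
Hypothesis prT_V : wstable prT V.
Hypothesis prT_R : wstable prT R.

Lemma wstable_interlace Je ms ns : (forall n, n \in ns -> wstable prT (Je n)) ->
  wstable prT (winterlace V Je ms ns).
Proof.
elim: ms ns => [|m ms IHms] [|n ns] sJ /=; try exact: (wstable_one prT_1).
  exact: (wstable_pow fw dT prT_mul prT_1).
apply: (wstable_mul fw dT prT_mul); last first.
  by apply: IHms => i ni; apply: sJ; rewrite inE ni orbT.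
apply: (wstable_mul fw dT prT_mul); first exact: (wstable_pow fw dT prT_mul prT_1).
by apply: sJ; rewrite mem_head.
Qed.

Lemma wstable_Jeven j : wstable prT (J j.*2).
Proof.
have [m] := ubnP j; elim: m j => // m IHm [|[|j]] jm.
- by rewrite double0 J_0; apply: (wstable_one prT_1).
- by rewrite -[1.*2]/2%N J_2.
rewrite (J_even (j := j.+1)) //; apply: wstable_cap; last exact: (wstable_pow fw dT prT_mul prT_1).
move=> n x; set S := sumsp_fam _ _; apply: (@span_min _ _ _ (presp (prT n) S)) => y [N N1 Fy].
apply: span_sub; exists N => // nm nmP; apply: wstable_interlace (Fy nm nmP) => i ni.
have jm' : (j.+1 < m)%N by []; apply: IHm; apply: leq_ltn_trans jm'.
by rewrite -nmP.1 sumnE (big_rem i ni) leq_addr.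
Qed.

Lemma wstable_Jspace i : wstable prT (J i).
Proof.
have [[j ->]|[j ->]] := parityP i; first exact: wstable_Jeven.
rewrite J_odd; apply: wstable_cap; apply: (wstable_mul fw dT prT_mul) => //.
all: exact: wstable_Jeven.
Qed.

End Weights.
End Spaces.

(** Positivity of the degrees bounds both the length of a word and the degrees of its letters by its
    weight. *)
Lemma words_finite (X : eqType) (deg : X -> nat) :
  (forall x, (0 < deg x)%N) -> (forall n, exists s : seq X, forall x, deg x = n -> x \in s) ->
  forall n, exists l : seq (seq X), forall w, (\sum_(x <- w) deg x)%N = n -> w \in l.
Proof.
move=> deg0 fin n; have /choice[f fE] := fin.
pose S := flatten [seq f m | m <- iota 0 n.+1].
pose lists := fix lists m := if m is m'.+1 then
  [::] :: [seq x :: w | x <- S, w <- lists m'] else [:: [::]].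
exists (lists n) => w wn.
have wS : {subset w <= S}.
  move=> x xw; apply/flattenP; exists (f (deg x)); last exact: fE.
  apply/mapP; exists (deg x) => //; rewrite mem_iota /= add0n ltnS -wn.
  by rewrite (big_rem x xw) leq_addr.
have : (size w <= n)%N.
  rewrite -wn -sum1_size; apply: leq_sum => x _; exact: deg0.
elim: w (n) wS {wn} => [|x w IHw] [|m] //= wS wm.
rewrite inE /=; apply/allpairsP; exists (x, w); split=> //=.
  by apply: wS; rewrite mem_head.
by apply: IHw => // y yw; apply: wS; rewrite inE yw orbT.
Qed.

Section WordWeights.
Variables (k : fieldType) (T : lalgType k) (X : choiceType) (word : seq X -> T).
Hypothesis fw : free_words word.
Variable deg : X -> nat.
Hypothesis deg_gt0 : forall x, (0 < deg x)%N.
Hypothesis deg_fin : forall n, exists s : seq X, forall x, deg x = n -> x \in s.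
Notation wt := (fun s : seq X => \sum_(x <- s) deg x)%N.
Notation V := (letters word).

Definition word_pr : nat -> {linear T -> T} := projT1 (cid (word_wd fw wt)).

Lemma word_pr_dec : wdecomp word_pr.
Proof. exact: (projT2 (cid (word_wd fw wt))).1. Qed.

Lemma word_prE n s : word_pr n (word s) = if n == wt s then word s else 0.
Proof. exact: (projT2 (cid (word_wd fw wt))).2. Qed.

Lemma word_pr_mul n i j x y : word_pr n (word_pr i x * word_pr j y) =
  if n == (i + j)%N then word_pr i x * word_pr j y else 0.
Proof.
have [Z ZE] : exists Z : {linear T -> T}, forall z, Z z = if n == (i + j)%N then z else 0.
  by case: eqP; [exists idfun|exists \0].
rewrite -ZE; have [f fE] := linear_pack (mull_linear (word_pr j y)).
rewrite -fE; move: x.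
apply: (@word_span _ _ _ _ fw (equalizer (word_pr n \o (f \o word_pr i)) (Z \o (f \o word_pr i)))).
move=> s; change (word_pr n (f (word_pr i (word s))) = Z (f (word_pr i (word s)))).
rewrite word_prE; case: eqP => [is_|_]; last by rewrite !linear0.
rewrite !fE; have [g gE] := linear_pack (mulr_linear fw (word s)); rewrite -gE; move: y {f fE}.
apply: (@word_span _ _ _ _ fw (equalizer (word_pr n \o (g \o word_pr j)) (Z \o (g \o word_pr j)))).
move=> t; change (word_pr n (g (word_pr j (word t))) = Z (g (word_pr j (word t)))).
rewrite word_prE; case: eqP => [jt|_]; last by rewrite !linear0.
by rewrite gE -(wordM fw) word_prE ZE is_ jt big_cat.
Qed.

Lemma word_pr_1 n : word_pr n 1 = if n == 0%N then 1 else 0.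
Proof. by rewrite -(word_nil fw) word_prE big_nil. Qed.

Lemma word_pr_V : wstable word_pr V.
Proof.
move=> n; apply: (@span_min _ _ _ (presp (word_pr n) V)) => _ [x ->] /=.
rewrite word_prE; case: ifP => _; last exact: (sp0 V).
by apply: (span_sub (x := word [:: x])); exists x.
Qed.

Definition word_gr n : subspace T := span (fun t => exists2 s, wt s = n & t = word s).

Lemma word_grP n x : word_gr n x <-> word_pr n x = x.
Proof.
split=> [|<-].
  apply: (@span_min _ _ _ (equalizer (word_pr n) idfun)) => _ [s <- ->] /=.
  by rewrite word_prE eqxx.
move: x; apply: (@word_span _ _ _ _ fw (presp (word_pr n) (word_gr n))) => s.
change (word_gr n (word_pr n (word s))); rewrite word_prE.
by case: eqP => [->|_]; [apply: span_sub; exists s|apply: sp0].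
Qed.

Lemma graded_wstable (R : subspace T) : graded_sub word_gr R -> wstable word_pr R.
Proof.
move=> gR n x /gR; apply: (@span_min _ _ _ (presp (word_pr n) R)) => y [m _ /capspE[Ry ym]].
change (R (word_pr n y)); have /word_grP ym' := ym.
by rewrite -ym' word_pr_dec.1; case: ifP => _; rewrite ?ym'//; apply: sp0.
Qed.

Lemma word_gr_fin n : exists s : seq T, forall x, word_pr n x = x -> span (fun y => y \in s) x.
Proof.
have [l lP] := words_finite deg_gt0 deg_fin n; exists [seq word w | w <- l] => x /word_grP.
apply: span_min => _ [w wn ->]; apply: span_sub.
by apply/mapP; exists w => //; apply: lP.
Qed.

Lemma sub_fin (S : subspace T) (prS : nat -> {linear subsp S -> subsp S}) n :
  (forall n w, inc (prS n w) = word_pr n (inc w)) ->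
  exists s : seq (subsp S), forall w, prS n w = w -> span (fun y => y \in s) w.
Proof.
move=> prSE; have [s sP] := word_gr_fin n; have [g gK] := retraction S.
exists [seq g x | x <- s] => w wn; rewrite -(gK w).
have /sP : word_pr n (inc w) = inc w by rewrite -prSE wn.
apply: (@span_min _ _ _ (presp g (span (fun y => y \in [seq g x | x <- s])))) => x xs.
by apply: span_sub; apply/mapP; exists x.
Qed.

Variables (A : algType k) (E : presentation A) (pi : {linear T -> A}).
Hypotheses (piM : forall x y, pi (x * y) = pi x * pi y) (pi1 : pi 1 = 1).
Variable R : subspace T.
Hypothesis prT_R : wstable word_pr R.
Hypothesis pi_ker : forall t, pi t = 0 <-> mulsp (mulsp (fullsp T) R) (fullsp T) t.
Hypothesis pi_surj : forall a, exists t, pi t = a.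
Hypothesis eps_V : forall v, V v -> eps E (pi v) = 0.

Lemma quotient_weights : exists prA : nat -> {linear A -> A}, wdecomp prA /\
  forall n t, prA n (pi t) = pi (word_pr n t).
Proof.
apply: (wd_quot word_pr_dec pi_surj) => n x /pi_ker xI; apply/pi_ker.
have full : wstable word_pr (fullsp T) by [].
have st := wstable_mul fw word_pr_dec word_pr_mul.
exact: st (st _ _ full prT_R) full _ _ xI.
Qed.

Variable prA : nat -> {linear A -> A}.
Hypothesis pi_pr : forall n t, prA n (pi t) = pi (word_pr n t).

Lemma quotient_pr_mul n i j a b : prA n (prA i a * prA j b) =
  if n == (i + j)%N then prA i a * prA j b else 0.
Proof.
have [x <-] := pi_surj a; have [y <-] := pi_surj b.
by rewrite !pi_pr -piM pi_pr word_pr_mul; case: ifP; rewrite ?linear0.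
Qed.

(** A nonempty word has positive weight and augmentation 0, so both sides vanish on it. *)
Lemma quotient_pr_0 a : prA 0 a = eps E a *: 1.
Proof.
have [t <-] := pi_surj a.
have [f fE] : exists f : {linear T -> A}, forall t, f t = eps E (pi t) *: 1.
  have [|f fE] := @linear_pack _ T A (fun t => eps E (pi t) *: 1); last by exists f.
  by move=> c x y; rewrite !linearP scalerDl scalerA.
rewrite pi_pr -fE; move: t.
apply: (@word_span _ _ _ _ fw (equalizer (pi \o word_pr 0) f)) => s /=.
rewrite fE word_prE; case: s => [|x s].
  by rewrite big_nil eqxx (word_nil fw) pi1 eps1 scale1r.
rewrite big_cons -cat1s (wordM fw) piM epsM eps_V ?mul0r ?scale0r.
  by have := deg_gt0 x; case: (deg x) => // m _; rewrite linear0.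
by apply: span_sub; exists x.
Qed.

End WordWeights.

(** * The tensor algebra *)

Section FreeAlgebra.
Variables (k : fieldType) (X : choiceType).
Notation T := (tensor_alg k X).

Definition malg_word (s : seq X) : T := << FMonom s >>.

Lemma fmonom_cat (s t : seq X) : FMonom (s ++ t) = mmul (FMonom s) (FMonom t).
Proof. by apply: val_inj; rewrite /= [RHS]fmM. Qed.

Lemma malg_wordM s t : malg_word (s ++ t) = malg_word s * malg_word t.
Proof. by rewrite /malg_word fmonom_cat malgM_def fgmulUU mulr1. Qed.

Lemma malg_word_nil : malg_word [::] = 1.
Proof. by rewrite /malg_word; congr (<< _ >>); apply: val_inj; rewrite /= [RHS]fm1. Qed.

Lemma malg_scalerAr (a : k) (s t : T) : s * (a *: t) = a *: (s * t).
Proof.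
rewrite (malgMEw (fsubset_refl _) (msuppZ_le a t)) malgME scaler_sumr.
apply: eq_bigr => u _; rewrite scaler_sumr; apply: eq_bigr => v _.
by rewrite mcoeffZ mulrCA malgZU.
Qed.

Lemma malg_free_words : @free_words k T X malg_word.
Proof.
split; [exact: malg_scalerAr|exact: malg_wordM|exact: malg_word_nil| |].
- by move=> S Sw t; apply: malg_span => w; have := Sw w; rewrite /malg_word fmK.
move=> Z h; have [f fE] := malg_lin (fun w : {fmonom X} => h w).
by exists f => s; rewrite /malg_word fE.
Qed.

End FreeAlgebra.

Section PresentationSpaces.
Variables (k : fieldType) (A : algType k) (E : presentation A).
Notation X := (gen E).
Notation T := (tensor_alg k X).
Notation word := (@malg_word k X).

Lemma letters_Vsp : @letters k T X word = Vsp k X.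
Proof.
by apply: subspace_eq => t; split; apply: span_min => {}t [x ->];
  apply: span_sub; exists x; rewrite fmuE.
Qed.

Lemma wordge_Tge m : @wordge k T X word m = Tge k X m.
Proof. by rewrite /wordge letters_Vsp. Qed.

Lemma word_gr_Tgr n : @word_gr k T X word (@gdeg _ _ E) n = Tgr k (@gdeg _ _ E) n.
Proof.
apply: subspace_eq => t; split; apply: span_min => _ [w wn ->]; apply: span_sub.
  by exists (FMonom w).
by exists w => //; rewrite /malg_word fmK.
Qed.

Lemma Jstep_wJstep Je i : @Jstep k A E Je i = wJstep (T := T) (Vsp k X) (rels E) Je i.
Proof. by rewrite /Jstep /wJstep; congr (capsp (sumsp_fam _ _) _); apply/funext => N. Qed.

Lemma J_weven j : (1 <= j)%N ->
  J E j.+1.*2 = wJstep (T := T) (letters word) (rels E) (fun n => J E n.*2) j.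
Proof.
move=> j1; apply: (etrans (J_even E j1)); apply: (etrans (Jstep_wJstep _ _)).
by rewrite letters_Vsp.
Qed.

Lemma J_wodd j : J E j.*2.+1 =
  capsp (mulsp (T := T) (letters word) (J E j.*2)) (mulsp (T := T) (J E j.*2) (letters word)).
Proof. by rewrite J_odd letters_Vsp. Qed.

Lemma J_koszul : koszul_spaces (T := T) word (rels E) (J E).
Proof.
apply: (koszul_spacesP (malg_free_words k X) (J_0 E) (J_2 E) J_wodd J_weven) => x.
  by rewrite wordge_Tge; apply: rels_ge2.
rewrite !wordge_Tge; exact: rels_min.
Qed.

Lemma rels_wstable : wstable (@word_pr k T X word (malg_free_words k X) (@gdeg _ _ E)) (rels E).
Proof.
apply: graded_wstable => x /(rels_graded (p := E)); congr (sp_set _ x).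
by congr (sumsp_fam _ _); apply/funext => n; rewrite word_gr_Tgr.
Qed.

End PresentationSpaces.

Section TensorActions.
Variables (k : fieldType) (A : algType k) (W : lmodType k).
Notation B := (tens (tens A W) A).
Notation fb := (free_bimodule_tens A W).

Definition tens_lact (a : A) (x : B) : B :=
  tlift (fun y b => tpair (tlift (fun a' w => tpair (a * a') w) y) b) x.

Definition tens_ract (x : B) (b : A) : B := tlift (fun y b' => tpair y (b' * b)) x.

Lemma tens_lact_linear a : linear (tens_lact a).
Proof.
have l c u u' (w' : W) : tpair (a * (c *: u + u')) w'
    = c *: tpair (a * u) w' + tpair (a * u') w'.
  by rewrite mulrDr -scalerAr tpairPl.
have r c u (w' w'' : W) : tpair (a * u) (c *: w' + w'')
    = c *: tpair (a * u) w' + tpair (a * u) w'' by rewrite tpairPr.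
have l1 c (u u' : tens A W) (b : A) :
    tpair (tlift (fun a' w => tpair (a * a') w) (c *: u + u')) b =
    c *: tpair (tlift (fun a' w => tpair (a * a') w) u) b +
    tpair (tlift (fun a' w => tpair (a * a') w) u') b.
  by rewrite (tlift_linear l r); apply: tpairPl.
apply: (tlift_linear l1) => c u b b'; exact: tpairPr.
Qed.

Lemma tens_ract_linear b : linear (tens_ract ^~ b).
Proof.
apply: tlift_linear => c u.
  by move=> u' b'; apply: tpairPl.
by move=> b' b''; rewrite mulrDl -scalerAl; apply: tpairPr.
Qed.

End TensorActions.

(** * From abstract free bimodules to the complex of the presentation *)

Section Bridge.
Variables (k : fieldType) (A : algType k) (E : presentation A).
Notation X := (gen E).
Notation T := (tensor_alg k X).
Notation word := (@malg_word k X).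

(* The product spaces of [T] use its algebra structure, while [J E i] and [K E i]
   refer to its module structure; these aliases convert once and for all. *)
Definition TL : lalgType k := T.
Definition JL (i : nat) : subspace TL := J E i.
Definition KL (i : nat) : lmodType k := K E i.
Definition kt (i : nat) : A -> subsp (JL i) -> A -> KL i := @ktens k A E i.
Definition Kl i (a : A) (x : KL i) : KL i := K_lact a x.
Definition Kr i (x : KL i) (b : A) : KL i := K_ract x b.

Lemma K_free i : @free_bimodule k A (subsp (JL i)) (KL i) (@kt i).
Proof. exact: free_bimodule_tens. Qed.

Lemma Kl_linear i a : linear (Kl a : KL i -> KL i).
Proof. exact: (@tens_lact_linear k A (subsp (JL i)) a). Qed.

Lemma Kr_linear i b : linear (fun x : KL i => Kr x b).
Proof. exact: (@tens_ract_linear k A (subsp (JL i)) b). Qed.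

Lemma KlE i a a' (w : subsp (JL i)) b : Kl a (kt a' w b) = kt (a * a') w b.
Proof. exact: (@K_lactE k A E i a a' w b). Qed.

Lemma KrE i a (w : subsp (JL i)) b b' : Kr (kt a w b) b' = kt a w (b * b').
Proof. exact: (@K_ractE k A E i a w b b'). Qed.

Lemma Kl_lact i a (x : KL i) : Kl a x = lact (K_free i) a x.
Proof.
move: x; apply: (bim_eqf (K_free i) (@Kl_linear i a) (linearP (lact (K_free i) a))) => c w b.
by rewrite lactE KlE.
Qed.

Lemma Kr_ract i b (x : KL i) : Kr x b = ract (K_free i) b x.
Proof.
move: x; apply: (bim_eqf (K_free i) (@Kr_linear i b) (linearP (ract (K_free i) b))) => c w b'.
by rewrite ractE KrE.
Qed.

Notation wordL := (word : seq X -> TL).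
Definition projL : {linear TL -> A} := proj E.
Notation V := (Vsp k X : subspace TL).

Record kdiffL (d : forall i, {linear KL i.+1 -> KL i}) : Prop := KdiffL {
  kL_lact : forall i a x, d i (Kl a x) = Kl a (d i x);
  kL_ract : forall i x b, d i (Kr x b) = Kr (d i x) b;
  kL_odd : forall i, ~~ odd i ->
    forall (w : subsp (JL i.+1)) (s : seq (TL * subsp (JL i))) (s' : seq (subsp (JL i) * TL)),
    {in s, forall p, V p.1} -> {in s', forall p, V p.2} ->
    inc w = \sum_(p <- s) p.1 * inc p.2 -> inc w = \sum_(p <- s') inc p.1 * p.2 ->
    d i (kt 1 w 1) = \sum_(p <- s) kt (projL p.1) p.2 1 - \sum_(p <- s') kt 1 p.1 (projL p.2);
  kL_even : forall i, odd i ->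
    forall (w : subsp (JL i.+1)) (M : nat) (wN : nat -> TL)
           (s : nat -> nat -> seq (TL * subsp (JL i) * TL)),
    inc w = \sum_(N < M) wN N ->
    (forall N l, (N < M)%N -> (l <= N)%N ->
       {in s N l, forall p, powsp V l p.1.1 /\ powsp V (N - l) p.2} /\
       wN N = \sum_(p <- s N l) p.1.1 * inc p.1.2 * p.2) ->
    d i (kt 1 w 1) =
      \sum_(N < M) \sum_(l < N.+1) \sum_(p <- s N l) kt (projL p.1.1) p.1.2 (projL p.2) }.

Lemma kdiffL_kdifferential (d : forall i, {linear KL i.+1 -> KL i}) :
  kdiffL d <-> @kdifferential k TL X wordL JL A projL _ _ K_free d.
Proof.
have LV t : letters wordL t <-> V t by rewrite letters_Vsp.
have LVn n t : powsp (letters wordL) n t <-> powsp V n t by rewrite letters_Vsp.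
split=> [[h1 h2 h3 h4]|kd].
  split=> [i|i oi w s s' sV sV' ws ws'|i oi w M wN s wS sP].
  - by split=> a x; [rewrite -!Kl_lact; apply: h1|rewrite -!Kr_ract; apply: h2].
  - apply: (h3 i oi w s s' _ _ ws ws') => p ps; apply/LV; [exact: sV|exact: sV'].
  - apply: (h4 i oi w M wN s wS) => N l NM lN; have [sV wE] := sP N l NM lN.
    split; last exact: wE.
    move=> p ps; exact: (conj ((LVn l _).1 (sV p ps).1) ((LVn (N - l)%N _).1 (sV p ps).2)).
split=> [i a x|i x b|i oi w s s' sV sV' ws ws'|i oi w M wN s wS sP].
- by rewrite !Kl_lact; apply: (kdiff_bim kd i).1.
- by rewrite !Kr_ract; apply: (kdiff_bim kd i).2.
- apply: (kdiff_odd kd oi _ _ ws ws') => p ps; apply/LV; [exact: sV|exact: sV'].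
- apply: (kdiff_even kd oi wS) => N l NM lN; have [sV wE] := sP N l NM lN.
  split; last exact: wE.
  move=> p ps; exact: (conj ((LVn l _).2 (sV p ps).1) ((LVn (N - l)%N _).2 (sV p ps).2)).
Qed.

Definition kd_mapL (D : k_differential E) i : {linear KL i.+1 -> KL i} := kd_map D i.

Lemma kdiffL_kd_map (D : k_differential E) : kdiffL (kd_mapL D).
Proof.
exact: (KdiffL (d := kd_mapL D) (@kd_lact _ _ _ D) (@kd_ract _ _ _ D)
  (@kd_odd _ _ _ D) (@kd_even _ _ _ D)).
Qed.

Lemma k_differential_exists (d : forall i, {linear KL i.+1 -> KL i}) : kdiffL d ->
  exists D : k_differential E, forall i, kd_mapL D i = d i.
Proof.
move=> [h1 h2 h3 h4].
unshelve refine (ex_intro _ (@KDifferential k A E d _ _ _ _) _).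
(* [h1] ... [h4] are the required statements up to the unfolding of the aliases. *)
- exact_no_check h1.
- exact_no_check h2.
- exact_no_check h3.
- exact_no_check h4.
- by [].
Qed.

End Bridge.

(** * The left and right complexes *)

Section Resolves.
Variables (k : fieldType) (C : complex k) (e : C 0%N -> k) (L : nat -> lmodType k).
Notation Y := (aug_fam k^o L).
Variables (dY : forall i, {linear Y i.+1 -> Y i}) (F : forall i, {linear C i -> L i}).
Hypothesis dY_dY : forall i x, dY i (dY i.+1 x) = 0.
Hypothesis F_inj : forall i z, F i z = 0 -> z = 0.
Hypothesis F_surj : forall i y, exists z, F i z = y.
Hypothesis F_d : forall i z, F i (cplx_d C i z) = dY i.+1 (F i.+1 z).
Hypothesis e_d : forall z, e z = dY 0 (F 0%N z).

(** Exactness is carried along the isomorphisms [F] from the tensor products over [A] to the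
    concrete complex with [k] at index 0. *)
Lemma resolves_aug_exact : resolves e <-> aug_exact (Z := Y) dY.
Proof.
have injF i z z' : F i z = F i z' -> z = z'.
  by move=> zz'; apply/eqP; rewrite -subr_eq0; apply/eqP/F_inj; rewrite linearB zz' subrr.
split=> [[e_s e_0 ex]|[d_s ex]].
  split=> [c|[|i] y y0]; first by have [z <-] := e_s c; exists (F 0%N z); apply: e_d.
    have [z zy] := F_surj y; rewrite -{}zy in y0 *.
    have /e_0[w ->] : e z = 0 by rewrite e_d.
    by exists (F 1%N w); apply: F_d.
  have [z zy] := F_surj y; rewrite -{}zy in y0 *.
  have /ex[w ->] : cplx_d C i z = 0 by apply: F_inj; rewrite F_d.
  by exists (F i.+2 w); apply: F_d.
split=> [c|z|i z].
- have [y ->] := d_s c; have [z <-] := F_surj y; by exists z; rewrite e_d.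
- rewrite e_d; split=> [/(ex 0%N)[y zy]|[w ->]]; last by rewrite F_d; exact: (@dY_dY 0 (F 1%N w)).
  by have [w wy] := F_surj y; exists w; apply: injF; rewrite zy -wy F_d.
split=> [z0|[w ->]]; last by apply: F_inj; rewrite !F_d; exact: (@dY_dY i.+1 (F i.+2 w)).
have [|y zy] := ex i.+1 (F i.+1 z); first by rewrite -F_d z0 linear0.
by have [w wy] := F_surj y; exists w; apply: injF; rewrite zy -wy F_d.
Qed.

End Resolves.

Section TrivialTensor.
Variables (k : fieldType) (A : algType k) (E : presentation A).
Variables (op : A -> A -> A) (op_e1 : forall a, op a 1 = a).
Hypothesis eps_op : forall a b, eps E (op a b) = eps E a * eps E b.
Variables (X Y : nat -> lmodType k) (xt : forall i, Y i -> A -> X i).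
Hypothesis ft : forall i, free_tensor (@xt i).
Variable act : forall i, A -> {linear X i -> X i}.
Hypothesis actE : forall i a y b, act i a (xt y b) = xt y (op a b).
Notation th i := (theta (eps E) ft i).

(** As [X] is [Y (x) A], tensoring with [k] over [A] leaves [Y]. For injectivity, an element killed
    by [theta] is a sum of tensors with factor in [A_+], and [A_+] acts on [k] by 0. *)
Lemma left_triv_iso i (r : X i -> A -> X i) : (forall x a, r x a = act i a x) ->
  exists F : {linear tensA r (@triv_l k A E) -> Y i},
    [/\ forall x c, F (tApair r (@triv_l k A E) x c) = (c : k) *: th i x,
        forall z, F z = 0 -> z = 0 & forall y, exists z, F z = y].
Proof.
move=> rE; have [c a x y|x a c c'|x a c|F FE] := @tensA_lift k A (X i) k^o r (@triv_l k A E)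
    (Y i) (fun x c => (c : k) *: th i x).
- by rewrite linearP scalerDr !scalerA mulrC.
- by rewrite scalerDl scalerA.
- by rewrite rE (theta_act eps_op) // scalerA mulrC.
exists F; split=> // [z|y]; last by exists (tApair r _ (xt y 1) 1); rewrite FE scale1r theta_e1 ?eps1.
have [f fE] := linear_pack (tApairl_linear r (@triv_l k A E) (1 : k^o)).
have H t : imsp f t.
  apply: tensA_span t => x c; exists ((c : k) *: x); rewrite fE.
  rewrite (linZ (tApairl_linear r (@triv_l k A E) (1 : k^o))).
  rewrite -(linZ (tApairr_linear r (@triv_l k A E) x)); congr (tApair _ _ _ _).
  exact/esym/mulr1.
have [x ->] := H z; rewrite fE FE scale1r => /(augm_theta0 (eps1 E)).
rewrite -fE; apply: (@span_min _ _ _ (kersp f)) => _ [y [a [a0 ->]]] /=.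
rewrite fE (xt_act op_e1 actE) -rE tApairA /triv_l -[aug E a]/(eps E a) a0 mul0r.
exact: (lin0 (tApairr_linear _ _ _)).
Qed.

Lemma right_triv_iso i (l : A -> X i -> X i) : (forall x a, l a x = act i a x) ->
  exists F : {linear tensA (@triv_r k A E) l -> Y i},
    [/\ forall c x, F (tApair (@triv_r k A E) l c x) = (c : k) *: th i x,
        forall z, F z = 0 -> z = 0 & forall y, exists z, F z = y].
Proof.
move=> lE; have [x a c c'|c a x y|c a x|F FE] := @tensA_lift k A k^o (X i) (@triv_r k A E) l
    (Y i) (fun c x => (c : k) *: th i x).
- by rewrite scalerDl scalerA.
- by rewrite linearP scalerDr !scalerA mulrC.
- by rewrite lE (theta_act eps_op) // scalerA.
exists F; split=> // [z|y]; last by exists (tApair _ l 1 (xt y 1)); rewrite FE scale1r theta_e1 ?eps1.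
have [f fE] := linear_pack (tApairr_linear (@triv_r k A E) l (1 : k^o)).
have H t : imsp f t.
  apply: tensA_span t => c x; exists ((c : k) *: x); rewrite fE.
  rewrite (linZ (tApairr_linear (@triv_r k A E) l (1 : k^o))).
  rewrite -(linZ (tApairl_linear (@triv_r k A E) l x)); congr (tApair _ _ _ _).
  exact/esym/mulr1.
have [x ->] := H z; rewrite fE FE scale1r => /(augm_theta0 (eps1 E)).
rewrite -fE; apply: (@span_min _ _ _ (kersp f)) => _ [y [a [a0 ->]]] /=.
rewrite fE (xt_act op_e1 actE) -lE -tApairA /triv_r -[aug E a]/(eps E a) a0 mulr0.
exact: (lin0 (tApairl_linear _ _ _)).
Qed.

End TrivialTensor.

Section OneSidedComplexes.
Variables (k : fieldType) (A : algType k) (E : presentation A).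
Variables (W : nat -> lmodType k) (B : nat -> lmodType k).
Variable bt : forall i, A -> W i -> A -> B i.
Hypothesis fb : forall i, free_bimodule (@bt i).
Variable d : forall i, {linear B i.+1 -> B i}.
Hypothesis d_bim : forall i, bimodule_map (fb i.+1) (fb i) (d i).
Hypothesis dd : forall i x, d i (d i.+1 x) = 0.
Variables (u : {linear W 0%N -> A}) (m : {linear B 0%N -> A}).
Hypothesis mE : forall a w b, m (bt a w b) = a * u w * b.
Hypothesis m_d : forall x, m (d 0%N x) = 0.
Variable aug_B : B 0%N -> k.
Hypothesis aug_BE : forall x, aug_B x = eps E (m x).
Notation eps_1 := (eps1 E).
Notation eps_M := (@epsM _ _ E).

Lemma aug_B_linear : linear (aug_B : B 0%N -> k^o).
Proof. by move=> c x y; rewrite !aug_BE !linearP. Qed.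

Lemma kmulDl (a x y c : k) : (a * x + y) * c = a * (x * c) + y * c.
Proof. by rewrite mulrDl mulrA. Qed.

Lemma kmulDr (a x y c : k) : c * (a * x + y) = a * (c * x) + c * y.
Proof. by rewrite mulrDr mulrCA. Qed.

Lemma aug_prod_linearl (c : k^o) : linear (fun y : B 0%N => aug_B y * c : k^o).
Proof. by move=> a x y; rewrite aug_B_linear; apply: kmulDl. Qed.

Lemma aug_prod_linearr (y : B 0%N) : linear (fun c : k^o => aug_B y * c : k^o).
Proof. by move=> a x x'; apply: kmulDr. Qed.

Section LeftComplex.
Variable r : forall i, B i -> A -> B i.
Hypothesis rE : forall i x a, r x a = ract (fb i) a x.
Hypothesis d_r : forall i x a, d i (r x a) = r (d i x) a.
Variables (L : nat -> lmodType k) (lt : forall i, A -> W i -> L i).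
Hypothesis fl : forall i, free_tensor (@lt i).
Notation tl := (@triv_l k A E).

Definition left_cplx : complex k :=
  @Complex k (fun i => tensA (@r i) tl)
    (fun i => tAmap (f := d i) (g := idfun : {linear k^o -> k^o}) (@d_r i) (fun _ _ => erefl)).

Definition left_cplx_aug (x : left_cplx 0) : k :=
  tlift (fun (y : B 0%N) (c : k^o) => aug_B y * c : k^o) (repr x).

Lemma left_cplx_augE : exists G : {linear left_cplx 0%N -> k^o},
  (forall x, left_cplx_aug x = G x) /\
  forall y c, G (tApair (@r 0%N) tl y c) = aug_B y * c.
Proof.
have [x a c|G GE] := @tensA_lift k A (B 0%N) k^o (@r 0%N) tl k^o
  (fun y c => aug_B y * c : k^o) aug_prod_linearl aug_prod_linearr.
  have H : m (ract (fb 0%N) a x) = m x * a.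
    by have := left_dX_act d_bim mE (i := 0) a x; rewrite left_act0.
  by rewrite rE !aug_BE H epsM /triv_l mulrA.
exists G; split=> // x; rewrite -[in RHS](class_repr x) /left_cplx_aug; move: (repr x) => t.
have l1 := tlift_linear (b := fun (y : B 0%N) (c : k^o) => aug_B y * c : k^o)
  (fun a x y c => aug_prod_linearl c a x y) (fun a y => aug_prod_linearr y a).
move: t; apply: (tens_eqf l1 (lin_comp G (class _))) => y c.
rewrite [LHS](tlift_pair (fun a x y c => aug_prod_linearl c a x y) (fun a y => aug_prod_linearr y a)).
by rewrite -GE.
Qed.

Theorem left_resolves : resolves left_cplx_aug <-> left_exact (eps E) fb d m fl.
Proof.
have H i : exists F : {linear left_cplx i -> L i},
    [/\ forall x c, F (tApair (@r i) tl x c) = (c : k) *: theta (eps E) (left_free fb fl) i.+1 x,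
        forall z, F z = 0 -> z = 0 & forall y, exists z, F z = y].
  apply: (left_triv_iso (op := fun a b => b * a) (@mul1r A) (epsMC eps_M) (left_free fb fl)
    (left_actE fb fl) (i := i.+1)) => x a; exact: rE.
pose F i := projT1 (cid (H i)).
have FE i x c : F i (tApair (@r i) tl x c) = (c : k) *: theta (eps E) (left_free fb fl) i.+1 x.
  by have [] := projT2 (cid (H i)).
have dYth i x := left_dY_theta eps_1 eps_M d_bim mE fl (i := i) x.
apply: (resolves_aug_exact (F := F)) => [i x|i z|i y|i z|z].
- exact: (left_dY_dY eps_1 eps_M d_bim dd mE m_d fl).
- by have [_ inj _] := projT2 (cid (H i)); apply: inj.
- by have [_ _ surj] := projT2 (cid (H i)); apply: surj.
- move: z; apply: (tensA_span (S := equalizer (F i \o cplx_d left_cplx i)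
    (left_dY (eps E) fb d m fl i.+1 \o F i.+1))) => x c.
  change (F i (cplx_d left_cplx i (tApair (@r i.+1) tl x c)) =
    left_dY (eps E) fb d m fl i.+1 (F i.+1 (tApair (@r i.+1) tl x c))).
  rewrite [cplx_d _ _ _]tAmap_pair !FE linearZ; congr (_ *: _).
  exact: (esym (dYth i.+1 x)).
- have [G [GA GE]] := left_cplx_augE; apply: (etrans (GA z)); move: z.
  apply: (tensA_span (S := equalizer G (left_dY (eps E) fb d m fl 0 \o F 0%N))) => x c.
  change (G (tApair (@r 0%N) tl x c) = left_dY (eps E) fb d m fl 0 (F 0%N (tApair (@r 0%N) tl x c))).
  rewrite GE FE linearZ [left_dY _ _ _ _ _ _ _]dYth aug_BE.
  have -> : theta (eps E) (left_free fb fl) 0 (m x) = eps E (m x).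
    rewrite -[m x in LHS]scale1r [LHS](thetaE _ (left_free fb fl) (i := 0)); exact: mulr1.
  exact: mulrC.
Qed.

End LeftComplex.
Section RightComplex.
Variable l : forall i, A -> B i -> B i.
Hypothesis lE : forall i x a, l a x = lact (fb i) a x.
Hypothesis d_l : forall i a x, d i (l a x) = l a (d i x).
Variables (L : nat -> lmodType k) (rt : forall i, W i -> A -> L i).
Hypothesis fr : forall i, free_tensor (@rt i).
Notation tr := (@triv_r k A E).

Definition right_cplx : complex k :=
  @Complex k (fun i => tensA tr (@l i))
    (fun i => tAmap (f := idfun : {linear k^o -> k^o}) (g := d i) (fun _ _ => erefl) (@d_l i)).

Definition right_cplx_aug (x : right_cplx 0) : k :=
  tlift (fun (c : k^o) (y : B 0%N) => c * aug_B y : k^o) (repr x).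

Lemma aug_prod_linearr' (y : B 0%N) : linear (fun c : k^o => c * aug_B y : k^o).
Proof. by move=> a x x'; apply: kmulDl. Qed.

Lemma aug_prod_linearl' (c : k^o) : linear (fun y : B 0%N => c * aug_B y : k^o).
Proof. by move=> a x y; rewrite aug_B_linear; apply: kmulDr. Qed.

Lemma right_cplx_augE : exists G : {linear right_cplx 0%N -> k^o},
  (forall x, right_cplx_aug x = G x) /\
  forall c y, G (tApair tr (@l 0%N) c y) = c * aug_B y.
Proof.
have [c a x|G GE] := @tensA_lift k A k^o (B 0%N) tr (@l 0%N) k^o
  (fun c y => c * aug_B y : k^o) aug_prod_linearr' aug_prod_linearl'.
  have H : m (lact (fb 0%N) a x) = a * m x.
    by have := right_dX_act d_bim mE (i := 0) a x; rewrite right_act0.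
  by rewrite lE !aug_BE H epsM /triv_r mulrA.
exists G; split=> // x; rewrite -[in RHS](class_repr x) /right_cplx_aug; move: (repr x) => t.
have l1 := tlift_linear (b := fun (c : k^o) (y : B 0%N) => c * aug_B y : k^o)
  (fun a x y c => aug_prod_linearr' c a x y) (fun a y => aug_prod_linearl' y a).
move: t; apply: (tens_eqf l1 (lin_comp G (class _))) => c y.
rewrite [LHS](tlift_pair (fun a x y c => aug_prod_linearr' c a x y) (fun a y => aug_prod_linearl' y a)).
by rewrite -GE.
Qed.

Theorem right_resolves : resolves right_cplx_aug <-> right_exact (eps E) fb d m fr.
Proof.
have H i : exists F : {linear right_cplx i -> L i},
    [/\ forall c x, F (tApair tr (@l i) c x) = (c : k) *: theta (eps E) (right_free fb fr) i.+1 x,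
        forall z, F z = 0 -> z = 0 & forall y, exists z, F z = y].
  apply: (right_triv_iso (op := fun a b => a * b) (@mulr1 A) eps_M (right_free fb fr)
    (right_actE fb fr) (i := i.+1)) => x a; exact: lE.
pose F i := projT1 (cid (H i)).
have FE i c x : F i (tApair tr (@l i) c x) = (c : k) *: theta (eps E) (right_free fb fr) i.+1 x.
  by have [] := projT2 (cid (H i)).
have dYth i x := right_dY_theta eps_1 eps_M d_bim mE fr (i := i) x.
apply: (resolves_aug_exact (F := F)) => [i x|i z|i y|i z|z].
- exact: (right_dY_dY eps_1 eps_M d_bim dd mE m_d fr).
- by have [_ inj _] := projT2 (cid (H i)); apply: inj.
- by have [_ _ surj] := projT2 (cid (H i)); apply: surj.
- move: z; apply: (tensA_span (S := equalizer (F i \o cplx_d right_cplx i)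
    (right_dY (eps E) fb d m fr i.+1 \o F i.+1))) => c x.
  change (F i (cplx_d right_cplx i (tApair tr (@l i.+1) c x)) =
    right_dY (eps E) fb d m fr i.+1 (F i.+1 (tApair tr (@l i.+1) c x))).
  rewrite [cplx_d _ _ _]tAmap_pair !FE linearZ; congr (_ *: _).
  exact: (esym (dYth i.+1 x)).
- have [G [GA GE]] := right_cplx_augE; apply: (etrans (GA z)); move: z.
  apply: (tensA_span (S := equalizer G (right_dY (eps E) fb d m fr 0 \o F 0%N))) => c x.
  change (G (tApair tr (@l 0%N) c x) = right_dY (eps E) fb d m fr 0 (F 0%N (tApair tr (@l 0%N) c x))).
  rewrite GE FE linearZ [right_dY _ _ _ _ _ _ _]dYth aug_BE.
  have -> : theta (eps E) (right_free fb fr) 0 (m x) = eps E (m x).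
    rewrite -[m x in LHS]scale1r [LHS](thetaE _ (right_free fb fr) (i := 0)); exact: mulr1.
  by [].
Qed.

End RightComplex.
End OneSidedComplexes.

(** * Both one-sided complexes against Tor *)

Section Main.
Variables (k : fieldType) (T : lalgType k) (X : choiceType) (word : seq X -> T).
Hypothesis fw : free_words word.
Variable deg : X -> nat.
Hypothesis deg_gt0 : forall x, (0 < deg x)%N.
Hypothesis deg_fin : forall n, exists s : seq X, forall x, deg x = n -> x \in s.
Variables (R : subspace T) (J : nat -> subspace T).
Hypothesis ks : koszul_spaces word R J.
Notation prT := (word_pr fw deg).
Hypothesis prT_R : wstable prT R.
Hypothesis prT_J : forall i, wstable prT (J i).
Variables (A : algType k) (E : presentation A) (pi : {linear T -> A}).
Hypotheses (piM : forall x y, pi (x * y) = pi x * pi y) (pi1 : pi 1 = 1).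
Hypothesis pi_ker : forall t, pi t = 0 <-> mulsp (mulsp (fullsp T) R) (fullsp T) t.
Hypothesis pi_surj : forall a, exists t, pi t = a.
Hypothesis eps_V : forall v, letters word v -> eps E (pi v) = 0.
Hypothesis pi_gr : forall n t, word_gr word deg n t -> Agr E n (pi t).
Variables (B : nat -> lmodType k) (bt : forall i, A -> subsp (J i) -> A -> B i).
Hypothesis fb : forall i, free_bimodule (@bt i).
Variable d : forall i, {linear B i.+1 -> B i}.
Hypothesis kd : kdifferential word pi fb d.
Variable P : graded_resolution E.

Definition tor_iso_spaces : Prop := forall i,
  exists f : {linear Tor P i -> subsp (J i)}, bijective f /\
    forall n h, Tor_gr n h <-> word_gr word deg n (inc (f h)).

Variables (u : {linear subsp (J 0%N) -> A}) (m : {linear B 0%N -> A}).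
Hypothesis uE : forall w, u w = pi (inc w).
Hypothesis mE : forall a w b, m (bt a w b) = a * u w * b.

(** The right-hand equivalence comes from the left-hand one through the bimodule complex, so that
    Tor is computed from a resolution by left modules in both cases. *)
Theorem koszul_tor (L L' : nat -> lmodType k) (lt : forall i, A -> subsp (J i) -> L i)
    (rt : forall i, subsp (J i) -> A -> L' i) (fl : forall i, free_tensor (@lt i))
    (fr : forall i, free_tensor (@rt i)) :
  (left_exact (eps E) fb d m fl <-> tor_iso_spaces) /\
  (right_exact (eps E) fb d m fr <-> tor_iso_spaces).
Proof.
have dT := word_pr_dec fw deg; have prT_mul := @word_pr_mul _ _ _ _ fw deg.
have prT_1 := word_pr_1 fw deg; have prT_V := @word_pr_V _ _ _ _ fw deg.
pose H i := cid (wd_sub dT (@prT_J i)); pose prJ i := projT1 (H i).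
have dJ i : wdecomp (prJ i) := (projT2 (H i)).1.
have prJE i n w : inc (prJ i n w) = prT n (inc w) := (projT2 (H i)).2 n w.
have [prA [dA pi_pr]] := quotient_weights prT_R pi_ker pi_surj.
have prA_mul := quotient_pr_mul piM pi_surj pi_pr.
have prA_0 := quotient_pr_0 deg_gt0 piM pi1 pi_surj eps_V pi_pr.
have prA_gr n a : Agr E n (prA n a).
  have [t <-] := pi_surj a; rewrite pi_pr; apply/pi_gr/word_grP; exact: (wd_id dT).
pose Hb i := cid (weighted_exists dA dJ fb i); pose prB i := projT1 (Hb i).
have wB i : weighted prA prJ (@bt) (prB i) := projT2 (Hb i).
have pi_pr' n t : pi (prT n t) = prA n (pi t) by [].
have finJ i n := sub_fin deg_gt0 deg_fin n (prJE i).
have LT : left_exact (eps E) fb d m fl <-> tor_iso_spaces.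
  apply: (iff_trans (left_exact_tor fw dT prT_mul prT_1 prT_V ks prJE dJ finJ piM pi1 pi_ker
    pi_surj eps_V dA prA_mul prA_0 prA_gr pi_pr' kd uE mE fl wB P)).
  have prJP i n w : prJ i n w = w <-> word_gr word deg n (inc w).
    by split=> [wn|/word_grP wn]; [apply/word_grP; rewrite -prJE wn|apply: inc_inj; rewrite prJE].
  split=> iso i; have [f [fb' fP]] := iso i; exists f; split=> // n h; rewrite fP; first exact: prJP.
  exact: iff_sym (prJP _ _ _).
split=> //; apply: iff_trans LT.
have d_bim := kdiff_bim kd.
have dd := @koszul_dd _ _ _ _ fw _ _ ks _ _ piM pi1 pi_ker _ _ _ _ kd.
have d_pr := kdifferential_pr fw dT prT_mul prT_1 prT_V ks prJE pi1 pi_pr' wB kd.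
have md := m_d fw ks piM pi1 kd uE mE.
have upr := u_pr prJE pi_pr' uE.
have R1 := right_bim_exact (eps1 E) (@epsM _ _ E) dA prA_mul prA_0 dJ wB d_bim dd d_pr mE md upr fr.
have L1 := left_bim_exact (eps1 E) (@epsM _ _ E) dA prA_mul prA_0 dJ wB d_bim dd d_pr mE md upr fl.
exact: (iff_trans R1 (iff_sym L1)).
Qed.

End Main.

Lemma tens_aug_linear (k : fieldType) (A : algType k) (W : lmodType k)
    (e : {linear A -> k^o}) (h : {linear W -> k^o}) :
  linear (fun x : tens (tens A W) A =>
    tlift (fun y b => tlift (fun a w => e a * h w : k^o) y * e b : k^o) x : k^o).
Proof.
have l c u u' w : e (c *: u + u') * h w = c *: (e u * h w : k^o) + e u' * h w :> k^o.
  by rewrite linearP; apply: kmulDl.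
have r c u w w' : e u * h (c *: w + w') = c *: (e u * h w : k^o) + e u * h w' :> k^o.
  by rewrite linearP; apply: kmulDr.
apply: tlift_linear => c u.
  by move=> u' b; rewrite (tlift_linear l r); apply: kmulDl.
by move=> b b'; rewrite linearP; apply: kmulDr.
Qed.

Section Presentation.
Variables (k : fieldType) (A : algType k) (E : presentation A).
Notation X := (gen E).
Notation word := (@malg_word k X : seq X -> TL E).
Notation deg := (@gdeg _ _ E).

Definition TL_free_words : @free_words k (TL E) X word := malg_free_words k X.

Definition JL_koszul : koszul_spaces word (rels E : subspace (TL E)) (JL E) := J_koszul E.

Notation prT := (word_pr TL_free_words deg).

Lemma rels_stable : wstable prT (rels E : subspace (TL E)).
Proof. exact: rels_wstable. Qed.

Lemma JL_stable i : wstable prT (JL E i).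
Proof.
have dT := word_pr_dec TL_free_words deg.
exact: (wstable_Jspace TL_free_words (J_0 E) (J_2 E) (@J_wodd _ _ E) (@J_weven _ _ E)
  dT (@word_pr_mul _ _ _ _ TL_free_words deg) (word_pr_1 TL_free_words deg)
  (@word_pr_V _ _ _ _ TL_free_words deg) rels_stable).
Qed.

Lemma projL_mul x y : projL E (x * y) = projL E x * projL E y.
Proof. exact: rmorphM. Qed.

Lemma projL_1 : projL E 1 = 1.
Proof. exact: rmorph1. Qed.

Lemma projL_ker t : projL E t = 0 <->
  mulsp (mulsp (fullsp (TL E)) (rels E)) (fullsp (TL E)) t.
Proof. exact: proj_ker. Qed.

Lemma projL_surj a : exists t, projL E t = a.
Proof. exact: proj_surj. Qed.

Lemma projL_V v : letters word v -> eps E (projL E v) = 0.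
Proof. by move=> Vv; apply: aug_V; rewrite -letters_Vsp. Qed.

Lemma projL_gr n t : word_gr word deg n t -> Agr E n (projL E t).
Proof. by move=> tn; exists t => //; rewrite -word_gr_Tgr. Qed.

Lemma tor_iso_spacesP (P : graded_resolution E) :
  tor_iso_spaces word deg (JL E) P <-> forall i, Tor_iso_J P i.
Proof.
have gr n t : word_gr word deg n t <-> Tgr k deg n t by rewrite -word_gr_Tgr.
split=> iso i; have [f [bf fP]] := iso i; exists f; split=> // n h.
  exact: iff_trans (fP n h) (gr _ _).
exact: iff_trans (fP n h) (iff_sym (gr _ _)).
Qed.

Definition K_augL : KL E 0%N -> k := @K_aug k A E.

Lemma K_augL_linear : linear (K_augL : KL E 0%N -> k^o).
Proof.
exact: (@tens_aug_linear k A (subsp (JL E 0%N)) (eps E) (eps E \o (projL E \o @inc _ _ (JL E 0%N)))).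
Qed.

Lemma K_augLE a (w : subsp (JL E 0%N)) b :
  K_augL (kt a w b) = eps E a * eps E (projL E (inc w)) * eps E b.
Proof. exact: (@K_augE k A E a w b). Qed.

Section Differential.
Variables (D : k_differential E) (P : graded_resolution E).
Notation d := (kd_mapL D).
Notation fl := (fun i => free_tensor_tens A (subsp (JL E i))).
Notation fr := (fun i => free_tensor_tens (subsp (JL E i)) A).

(** Valid for every admissible differential [D], so the existential quantifier in the definition of
    multi-Koszul algebras makes no difference. *)
Lemma resolves_tor : (resolves (@left_aug k A E D) <-> forall i, Tor_iso_J P i) /\
  (resolves (@right_aug k A E D) <-> forall i, Tor_iso_J P i).
Proof.
have kL := kdiffL_kd_map D; have kd := (kdiffL_kdifferential d).1 kL.
have [u uE] : exists u : {linear subsp (JL E 0%N) -> A}, forall w, u w = projL E (inc w).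
  by exists (projL E \o @inc _ _ (JL E 0%N)).
have [m mE'] := aug_exists (projL E) (@K_free k A E).
have mE a w b : m (kt a w b) = a * u w * b by rewrite mE' uE.
have d_bim := kdiff_bim kd.
have dd := @koszul_dd _ _ _ _ TL_free_words _ _ JL_koszul _ _ projL_mul projL_1
  projL_ker _ _ _ _ kd.
have md := m_d TL_free_words JL_koszul projL_mul projL_1 kd uE mE.
have augE x : K_augL x = eps E (m x).
  move: x; apply: (bim_eqf (@K_free k A E 0) K_augL_linear (lin_comp (eps E) m)) => a w b.
  by rewrite K_augLE mE uE !epsM.
have [HL HR] := koszul_tor (@gdeg_gt0 _ _ E) (@gdeg_fin _ _ E) JL_koszul rels_stable JL_stable
  projL_mul projL_1 projL_ker projL_surj projL_V projL_gr kd P uE mE fl fr.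
have rE i (x : KL E i) a : Kr x a = ract (@K_free k A E i) a x by apply: Kr_ract.
have lE i (x : KL E i) a : Kl a x = lact (@K_free k A E i) a x by apply: Kl_lact.
have RL := left_resolves d_bim dd mE md augE rE (@kL_ract _ _ _ _ kL) fl.
have RR := right_resolves d_bim dd mE md augE lE (@kL_lact _ _ _ _ kL) fr.
split.
  exact: (iff_trans RL (iff_trans HL (tor_iso_spacesP P))).
exact: (iff_trans RR (iff_trans HR (tor_iso_spacesP P))).
Qed.

End Differential.

Lemma k_differential_inhabited : exists D : k_differential E, True.
Proof.
have [d kd] := kdifferential_exists TL_free_words JL_koszul projL_1 (@K_free k A E).
by have [D _] := k_differential_exists ((kdiffL_kdifferential d).2 kd); exists D.
Qed.

End Presentation.

Theorem proposition3p23 (k : fieldType) (A : algType k) (E : presentation A)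
    (P : graded_resolution E) :
  (left_multi_Koszul E <-> forall i : nat, Tor_iso_J P i) /\
  (right_multi_Koszul E <-> forall i : nat, Tor_iso_J P i).
Proof.
(* From Tor to the multi-Koszul property a differential has to be supplied; in the other direction
   the given one is used. *)
have [D0 _] := k_differential_inhabited E.
split; split=> [[D res]|iso]; try exists D0.
- exact: (resolves_tor D P).1.1 res.
- exact: (resolves_tor D0 P).1.2 iso.
- exact: (resolves_tor D P).2.1 res.
- exact: (resolves_tor D0 P).2.2 iso.
Qed.
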